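(* Let $n\ge 2$, let $a>0$, and let $\Omega\subset\mathbb R^n$ be a bounded convex domain. Let $L=a^{ij}D_{ij}+b^iD_i-c$ be an operator whose coefficients are measurable functions on $\mathbb R^n$ satisfying, for some constants $K>0$ and $0<\lambda\le\Lambda<\infty$, $$a^{ij}=a^{ji},\quad \sum_i (b^i)^2\le K,\quad 0\le c\le K,$$ $$\lambda|\xi|^2\le a^{ij}(x)\xi_i\xi_j\le\Lambda|\xi|^2\quad\text{for all } x\in\Omega,\ \xi\in\mathbb R^n.$$ Then there exists at most one $C^2(\Omega)$ (or $W^{2,n}_{loc}(\Omega)$) solution $u$ of the problem $$Lu=e^{au}\ \text{ in }\Omega,\qquad u(x)\to+\infty\ \text{ as } \operatorname{dist}(x,\partial\Omega)\to 0.$$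
   Context: Summation over repeated indices is understood; $D_i=\partial/\partial x_i$, $D_{ij}=\partial^2/\partial x_i\partial x_j$. Solutions: $u\in W^{2,n}_{loc}(\Omega)$ is a solution of $Lu=g$ if $Lu=g$ almost everywhere in $\Omega$; functions in $W^{2,n}_{loc}(\Omega)$ are identified with their continuous representatives. $W^{2,q}_{loc}(\Omega)$ is the set of twice weakly differentiable $u$ with $\sum_{|\beta|\le 2}\int_{\Omega'}|D^\beta u|^q<\infty$ for all bounded open $\Omega'$ with $\overline{\Omega'}\subset\Omega$. *)

(* Defs.v *)
From HB Require Import structures.
From mathcomp Require Import all_boot all_order all_algebra.
From mathcomp Require Import all_classical all_reals all_analysis.
Set Implicit Arguments.
Unset Strict Implicit.
Unset Printing Implicit Defensive.
Import Order.TTheory GRing.Theory Num.Theory.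
Import numFieldNormedType.Exports.
Local Open Scope classical_set_scope.
Local Open Scope ring_scope.

(* R^n is 'rV[R]_n. Its library norm is the sup norm, which is equivalent to
   the Euclidean one: open, compact and bounded sets, continuity and partial
   derivatives are therefore the usual ones. *)

Section LebesgueMeasure.
Context (R : realType) (n : nat).
Implicit Types (A : set 'rV[R]_n) (p : 'rV[R]_n * 'rV[R]_n).

Definition box p : set 'rV[R]_n :=
  [set x | forall i, p.1 0 i < x 0 i <= p.2 0 i].

Definition box_volume p : R := \prod_(i < n) Num.max 0 (p.2 0 i - p.1 0 i).

Local Open Scope ereal_scope.

(* The sum runs over countable (possibly finite or empty) families of boxes. *)
Definition lebesgue_outer_rV A : \bar R :=
  ereal_inf [set \esum_(p in D) (box_volume p)%:E |
    D in [set D : set ('rV[R]_n * 'rV[R]_n) |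
           countable D /\ A `<=` \bigcup_(p in D) box p]].

Lemma box_volume_ge0 p : 0 <= (box_volume p)%:E.
Proof. by rewrite lee_fin; apply: prodr_ge0 => i _; rewrite le_max lexx. Qed.

Lemma lebesgue_outer_rV_ge0 A : 0 <= lebesgue_outer_rV A.
Proof.
apply: le_ereal_inf_tmp => _ [D _ <-].
by apply: esum_ge0 => p _; exact: box_volume_ge0.
Qed.

Lemma lebesgue_outer_rV0 : lebesgue_outer_rV set0 = 0.
Proof.
apply/eqP; rewrite eq_le lebesgue_outer_rV_ge0 andbT.
apply: ereal_inf_lbound; exists set0; last by rewrite esum_set0.
by split => //; exact: sub0set.
Qed.

Lemma le_lebesgue_outer_rV :
  {homo lebesgue_outer_rV : A B / A `<=` B >-> A <= B}.
Proof.
move=> A B AB; apply/ereal_inf_le_tmp => _ [D [cD BD] <-].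
by exists D => //; split => //; exact: subset_trans AB BD.
Qed.

Lemma lebesgue_outer_rV_sigma_subadditive :
  sigma_subadditive lebesgue_outer_rV.
Proof.
move=> A; have [[i ioo]|] := pselect (exists i, lebesgue_outer_rV (A i) = +oo).
  rewrite (eseries_pinfty _ _ ioo) ?leey// => k _.
  by rewrite -ltNye (lt_le_trans _ (lebesgue_outer_rV_ge0 _)).
rewrite -forallNE => Aoo; apply/lee_addgt0Pr => e e0.
apply: (le_trans _ (epsilon_trick _ _ (ltW e0))) => //; last first.
  by move=> k; exact: lebesgue_outer_rV_ge0.
pose P k (D : set ('rV[R]_n * 'rV[R]_n)) :=
  (countable D /\ A k `<=` \bigcup_(p in D) box p) /\
  \esum_(p in D) (box_volume p)%:E <=
  lebesgue_outer_rV (A k) + (e / (2 ^ k.+1)%:R)%:E.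
have [D PD] : {D : nat -> set ('rV[R]_n * 'rV[R]_n) & forall k, P k (D k)}.
  apply: (@choice _ _ P) => k.
  have e2 : (0 < e / (2 ^ k.+1)%:R)%R by rewrite divr_gt0// ltr0n expn_gt0.
  have fA : lebesgue_outer_rV (A k) \is a fin_num.
    by rewrite ge0_fin_numE ?lebesgue_outer_rV_ge0// ltey; apply/eqP/Aoo.
  have [_ [B [cB AB] <-] lt] := lb_ereal_inf_adherent e2 fA.
  by exists B; split => //; exact: ltW.
apply: (@le_trans _ _ (\esum_(p in \bigcup_k D k) (box_volume p)%:E)).
  apply: ereal_inf_lbound; exists (\bigcup_k D k) => //; split.
    by apply: bigcup_countable => // k _; exact: (PD k).1.1.
  move=> x [k _ /(PD k).1.2[p Dp px]].
  by exists p => //; exists k.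
rewrite seqDU_bigcup_eq nneseries_sum_bigcup; last 2 first.
- exact: trivIset_seqDU.
- exact: box_volume_ge0.
apply: lee_nneseries => [k _ _|k _].
  by apply: esum_ge0 => p _; exact: box_volume_ge0.
apply: le_trans (PD k).2; rewrite esum_mkcond [leRHS]esum_mkcond.
apply: le_esum => p _; case: ifPn => [|_].
  by rewrite inE => Dp; rewrite mem_set//; exact: subset_seqDU Dp.
by case: ifPn => // _; exact: box_volume_ge0.
Qed.

HB.instance Definition _ := isOuterMeasure.Build R 'rV[R]_n lebesgue_outer_rV
  lebesgue_outer_rV0 lebesgue_outer_rV_ge0 le_lebesgue_outer_rV
  lebesgue_outer_rV_sigma_subadditive.

End LebesgueMeasure.

(* R^n with the (complete) sigma-algebra of Lebesgue measurable sets. *)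
Notation Rn R n := (caratheodory_type (@lebesgue_outer_rV R n)).

Definition lebesgue_rV (R : realType) (n : nat) : set (Rn R n) -> \bar R :=
  @lebesgue_outer_rV R n.

HB.instance Definition _ (R : realType) (n : nat) := Measure.copy
  (@lebesgue_rV R n)
  ((@lebesgue_outer_rV R n : {outer_measure set 'rV[R]_n -> \bar R}) :
     set (Rn R n) -> \bar R).

Section Calculus.
Context (R : realType) (n : nat).
Local Notation mu := (@lebesgue_rV R n).
Implicit Types (Om : set 'rV[R]_n) (f u v phi : 'rV[R]_n -> R).
Implicit Types (s : seq 'I_n).

(* D_s f with s = [:: i; j; ...] is D_i D_j ... f. *)
Definition pderiv s f : 'rV[R]_n -> R :=
  foldr (fun i g x => 'D_(delta_mx 0 i) g x) f s.

Definition Ck (k : nat) Om f : Prop :=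
  (forall s i x, (size s < k)%N -> Om x ->
     derivable (pderiv s f) x (delta_mx 0 i)) /\
  (forall s x, (size s <= k)%N -> Om x -> {for x, continuous (pderiv s f)}).

Definition test_function Om phi : Prop :=
  [/\ forall k, Ck k setT phi,
      compact (closure [set x | phi x != 0]) &
      closure [set x | phi x != 0] `<=` Om].

Definition loc_integrable Om f : Prop :=
  measurable_fun (Om : set (Rn R n)) f /\
  forall K, compact K -> K `<=` Om -> (\int[mu]_(x in K) `|f x|%:E < +oo)%E.

Definition is_weak_pderiv Om s u v : Prop :=
  [/\ loc_integrable Om u, loc_integrable Om v &
      forall phi, test_function Om phi ->
        \int[mu]_(x in Om) (u x * pderiv s phi x) =
        (-1) ^+ size s * \int[mu]_(x in Om) (v x * phi x)].

(* A version of the weak derivative D_s u (unique up to a null set) when it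
   exists, and 0 otherwise. *)
Definition weak_pderiv Om s u : 'rV[R]_n -> R :=
  xget (fun=> 0) [set v | is_weak_pderiv Om s u v].

Definition W2loc (q : nat) Om u : Prop :=
  forall s, (size s <= 2)%N ->
    is_weak_pderiv Om s u (weak_pderiv Om s u) /\
    forall Om', open Om' -> bounded_set Om' -> closure Om' `<=` Om ->
      (\int[mu]_(x in Om') (`|weak_pderiv Om s u x| ^+ q)%:E < +oo)%E.

Definition enorm (x : 'rV[R]_n) : R := Num.sqrt (\sum_(i < n) x 0 i ^+ 2).

Definition edist (x : 'rV[R]_n) (A : set 'rV[R]_n) : R :=
  inf [set enorm (x - y) | y in A].

Definition boundary Om : set 'rV[R]_n := closure Om `\` interior Om.

Definition domain Om : Prop := [/\ open Om, connected Om & Om !=set0].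

Definition blows_up Om u : Prop :=
  forall M : R, exists2 d : R, 0 < d &
    forall x, Om x -> edist x (boundary Om) < d -> M < u x.

(* a^ij D_ij u + b^i D_i u - c u, where D s stands for D_s u, in the classical
   or in the weak sense. *)
Definition elliptic_op (a : 'I_n -> 'I_n -> 'rV[R]_n -> R)
    (b : 'I_n -> 'rV[R]_n -> R) (c : 'rV[R]_n -> R)
    (D : seq 'I_n -> 'rV[R]_n -> R) u (x : 'rV[R]_n) : R :=
  \sum_(i < n) \sum_(j < n) a i j x * D [:: i; j] x +
  \sum_(i < n) b i x * D [:: i] x - c x * u x.

(* The equation is required almost everywhere, also for C^2 functions, the
   coefficients being merely measurable. *)
Definition C2_solution a b c (alpha : R) Om u : Prop :=
  [/\ Ck 2 Om u,
      {ae mu, forall x : 'rV[R]_n, Om x ->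
         elliptic_op a b c (pderiv^~ u) u x = expR (alpha * u x)} &
      blows_up Om u].

(* Elements of W^{2,n}_loc are represented by their continuous versions. *)
Definition W2n_solution a b c (alpha : R) Om u : Prop :=
  [/\ W2loc n Om u /\ {in Om, continuous u},
      {ae mu, forall x : 'rV[R]_n, Om x ->
         elliptic_op a b c (fun s => weak_pderiv Om s u) u x
         = expR (alpha * u x)} &
      blows_up Om u].

End Calculus.

(* Main.v *)
Require Import Defs.
From mathcomp Require Import all_boot all_order all_algebra.
From mathcomp Require Import all_classical all_reals all_analysis.
From mathcomp Require Import ring lra.
Import Order.TTheory GRing.Theory Num.Theory.
Import numFieldNormedType.Exports.
Import measurable_realfun.
Set Implicit Arguments.
Unset Strict Implicit.
Unset Printing Implicit Defensive.
Local Open Scope classical_set_scope.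
Local Open Scope ring_scope.

(* Let u, v be two solutions and let d be the distance of x0 to the complement of
   Om.  Comparison with W = -(2/alpha) ln (rho^2 - |x - x0|^2) + C on a ball
   gives exp (alpha u(x0)) <= C / d^2.  As Om is convex, it lies in a half space
   bounded by the hyperplane through a nearest point of the complement, and
   comparison with -(2/alpha) ln (1 - exp (-k t)) - C, t the shifted distance to
   that hyperplane, gives exp (alpha v) >= c / d^2 near x0.  Hence u - v is bounded
   above.  If M = sup (u - v) > 0, then u - v is a strict subsolution where it is
   at least M / 2, with a right-hand side of order M / d^2, and comparison with
   M (1 - del) + 4 M del |x - x0|^2 / d^2 on the ball of radius d / 2 shows
   u - v <= (1 - del) M at every x0, with del independent of x0: a contradiction.

   The comparisons rest on the maximum principle for W^{2,n}_loc functions: if w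
   has a strict local maximum and A D^2 w + b D w >= kappa > 0 a.e., mollify w at
   the mesh h of a grid.  The slopes of the contact hyperplanes of the mollified
   function cover a cube of fixed size r, whereas on a cell meeting the contact set
   ellipticity bounds the Hessian, up to small errors, by the mean over
   neighbouring cells of |D^2 w - gamma|, gamma continuous and close to D^2 w in
   L^n.  Summing the n-th powers of the slope oscillations bounds r^n by
   C ||D^2 w - gamma||^n plus a small error, which is arbitrarily small. *)

(** * Covers by boxes and Lebesgue measure *)

(** Both solutions tend to infinity at the boundary, where nothing controls their difference, so the
    supremum of u - v need not be attained and cannot be examined at a maximum point. The cure is
    scaling: the gain of the subsolution and the cost of the quadratic bump are both of order M /
    d^2, which makes del independent of d. Convexity enters through the half space, which supplies
    the matching lower bound of order 1 / d^2. As the equation holds almost everywhere with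
    measurable coefficients, nothing can be read off at a single point, and mollifying the equation
    fails because the coefficients do not commute with averaging. So the function alone is
    mollified, and its Hessian at a contact point is paired with the coefficients at almost every
    nearby point. Counting slopes cell by cell takes the place of the change of variables formula
    and rests on the volume inequality for covers by cubes. A C^2 summand is carried beside the
    W^{2,n}_loc one and never mollified ([D2on]). Barriers that are C^2 only on a ball and both
    notions of solution thus fall under one argument. *)

Section BoxCover.
Context {R : realType}.
Local Open Scope ereal_scope.

(* Induction on the dimension: freeze the last coordinate and integrate the
   lower-dimensional inequality over it.  The flags [P k] select the boxes that
   meet the current slice. *)
Lemma box_cover_prod_le (n : nat) (a b : nat -> R) (lo hi : nat -> nat -> R)
    (P : nat -> bool) :
  (forall x : nat -> R, (forall i, (i < n)%N -> (a i < x i <= b i)%R) ->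
     exists2 k, P k & forall i, (i < n)%N -> (lo k i <= x i <= hi k i)%R) ->
  (\prod_(i < n) Num.max 0 (b i - a i))%:E <=
  \sum_(0 <= k <oo) ((P k)%:R * \prod_(i < n) Num.max 0 (hi k i - lo k i))%:E.
Proof.
have max_ge0 (x : R) : (0 <= Num.max 0 x)%R by rewrite le_max lexx.
have term_ge0 m Q k :
    0 <= ((Q k : bool)%:R * \prod_(i < m) Num.max 0 (hi k i - lo k i))%:E.
  by rewrite lee_fin mulr_ge0 ?ler0n// prodr_ge0.
elim: n P => [P cov|n IH P cov].
  (* In dimension zero all products are empty, so a single selected box already contributes 1 to the
     series. *)
  have [k Pk _] := cov (fun=> 0%R) (fun i => False_rect _ \o notF).
  rewrite big_ord0; apply: le_trans (nneseries_lim_ge k.+1 _); last first.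
    by move=> *; exact: term_ge0.
  rewrite big_nat_recr//= Pk big_ord0 mulr1 leeDr//.
  by rewrite sume_ge0 => // i _; exact: (term_ge0 0%N).
have [ba|ab] := leP (b n) (a n).
  rewrite big_ord_recr/= (_ : Num.max 0 (b n - a n) = 0)%R ?mulr0.
    by apply: nneseries_ge0 => k _ _; exact: term_ge0.
  by apply/max_idPl; rewrite subr_le0.
set V := (\prod_(i < n) Num.max 0 (b i - a i))%R.
pose v k : R := (\prod_(i < n) Num.max 0 (hi k i - lo k i))%R.
have V0 : (0 <= V)%R by rewrite prodr_ge0.
have v0 k : (0 <= v k)%R by rewrite prodr_ge0.
pose S k := [set` `[lo k n, hi k n]] : set R.
pose f k : R -> \bar R := fun t => (((P k)%:R * v k)%R : R)%:E * (\1_(S k) t : R)%:E.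
have f0 k t : 0 <= f k t by rewrite mule_ge0// lee_fin ?mulr_ge0.
have mf k : measurable_fun `]a n, b n] (f k).
  apply: emeasurable_funM => //; apply/measurable_EFinP.
  by apply: measurable_indic; exact: measurable_itv.
have slice t : t \in `]a n, b n] -> V%:E <= \sum_(0 <= k <oo) f k t.
  rewrite in_itv/= => abt.
  have /IH : forall x : nat -> R, (forall i, (i < n)%N -> (a i < x i <= b i)%R) ->
     exists2 k, P k && (t \in `[lo k n, hi k n]%R) &
       forall i, (i < n)%N -> (lo k i <= x i <= hi k i)%R.
    move=> x abx; have [|k Pk xk] := cov (fun i => if i == n then t else x i).
      by move=> i; rewrite ltnS leq_eqVlt; case: eqP => [->//|_ /=]; exact: abx.
    exists k => [|i ilt]; first by rewrite Pk in_itv/=; have := xk n; rewrite eqxx; exact.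
    by have := xk i (ltnW ilt); rewrite ltn_eqF.
  move/le_trans; apply; apply: lee_nneseries => k _.
    by move=> _; exact: (term_ge0 n (fun k => P k && (t \in `[lo k n, hi k n]%R))).
  rewrite /f /v /S indicE -EFinM lee_fin mem_setE -mulnb natrM mulrAC.
  exact: lexx.
have : \int[lebesgue_measure]_(t in `]a n, b n]) (cst V%:E t) <=
       \int[lebesgue_measure]_(t in `]a n, b n]) (\sum_(0 <= k <oo) f k t).
  apply: ge0_le_integral => //.
  have h0 k t : `]a n, b n]%classic t -> xpredT k -> 0 <= f k t by move=> *; exact: f0.
  exact: (ge0_emeasurable_sum h0 (fun k _ => mf k)).
rewrite integral_cst//= lebesgue_measure_itv/= lte_fin ab -EFinB -EFinM.
rewrite integral_nneseries//.
rewrite big_ord_recr/= (max_idPr _) ?subr_ge0 ?(ltW ab)// => /le_trans; apply.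
apply: lee_nneseries => k _.
  by move=> _; apply: integral_ge0 => t _; exact: f0.
rewrite big_ord_recr/= ge0_integralZl_EFin; last 4 first.
- exact: measurable_itv.
- by move=> t _; rewrite lee_fin.
- by apply/measurable_EFinP; apply: measurable_indic; exact: measurable_itv.
- by rewrite mulr_ge0.
rewrite integral_indic//; last exact: measurable_itv.
rewrite mulrA [leRHS]EFinM.
apply: lee_wpmul2l; first by rewrite lee_fin mulr_ge0.
apply: (@le_trans _ _ (lebesgue_measure (S k))).
  by apply: measureIl; exact: measurable_itv.
rewrite /S lebesgue_measure_itv/= lte_fin; case: ifPn => [lh|_].
  by rewrite -EFinB lee_fin le_max lexx orbT.
by rewrite lee_fin.
Qed.

End BoxCover.

Lemma max_split (R : realDomainType) (a b t : R) :
  Num.max 0 (Num.min b t - a) + Num.max 0 (b - Num.max a t) = Num.max 0 (b - a).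
Proof.
case: (leP b t) => bt; case: (leP a t) => at_.
- by rewrite [X in _ + X](max_idPl _) ?addr0//; lra.
- by rewrite !(max_idPl _) ?addr0//; lra.
- by rewrite !(max_idPr _)//; lra.
- by rewrite [X in X + _](max_idPl _) ?add0r//; lra.
Qed.

Section BoxMeasure.
Context {R : realType} {n : nat}.
Local Notation outer := (@lebesgue_outer_rV R n).
Local Notation mu := (@lebesgue_rV R n).
Implicit Types (A : set 'rV[R]_n) (p : 'rV[R]_n * 'rV[R]_n).
Local Open Scope ereal_scope.

Lemma outer_box_le p : outer (box p) <= (box_volume p)%:E.
Proof.
apply: ereal_inf_lbound; exists [set p].
  by split; [exact: countable1|exists p].
by rewrite esum_set1// box_volume_ge0.
Qed.

Lemma outer_le_series A (p : nat -> 'rV[R]_n * 'rV[R]_n) :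
  A `<=` \bigcup_k box (p k) -> outer A <= \sum_(0 <= k <oo) (box_volume (p k))%:E.
Proof.
move=> Ap; apply: (le_trans (le_outer_measure _ _ _ Ap)).
apply: (le_trans (outer_measure_sigma_subadditive _ _)).
by apply: lee_nneseries => [k _ _|k _]; [exact: outer_measure_ge0|exact: outer_box_le].
Qed.

Lemma outer_series_adherent A (e : R) : (0 < n)%N -> (0 < e)%R ->
  outer A \is a fin_num ->
  exists2 p : nat -> 'rV[R]_n * 'rV[R]_n, A `<=` \bigcup_k box (p k) &
    \sum_(0 <= k <oo) (box_volume (p k))%:E <= outer A + e%:E.
Proof.
move=> n0 e0 fA; have [_ [D [cD AD] <-] lt] := lb_ereal_inf_adherent e0 fA.
have /countable_injP[g gI] := cD.
pose z : 'rV[R]_n * 'rV[R]_n := (0%R, 0%R).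
pose p k := xget z [set q | D q /\ g q = k].
have pg q : D q -> p (g q) = q.
  move=> Dq; rewrite /p; case: xgetP => [q' _ [Dq' gq']|/(_ q)[]//].
  by apply: gI => //; rewrite inE.
exists p => [x /AD[q Dq qx]|]; first by exists (g q) => //; rewrite pg.
apply: le_trans (ltW lt); rewrite nneseries_esumT; last by move=> k; exact: box_volume_ge0.
have bij : set_bij D (g @` D) g by split => [q Dq|q q' Dq Dq'|//]; [exists q|exact: gI].
rewrite (_ : \esum_(q in D) _ = \esum_(q in D) (box_volume (p (g q)))%:E); last first.
  by apply: eq_esum => q Dq; rewrite pg.
rewrite -(@reindex_esum _ _ _ _ _ _ (fun k => (box_volume (p k))%:E) bij).
rewrite [leRHS]esum_mkcond; apply: le_esum => k _; case: ifPn => [//|].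
rewrite notin_setE => gk; rewrite /p; case: xgetP => [q _ [Dq gq]|_].
  by exfalso; apply: gk; exists q.
rewrite /box_volume (bigD1 (Ordinal n0))//= mxE subrr maxxx mul0r; exact: lexx.
Qed.

Definition row_upd (x : 'rV[R]_n) i (t : R) : 'rV[R]_n :=
  \row_j if j == i then t else x 0%R j.

Lemma box_halfspace p i (t : R) :
  box p `&` [set x | (x 0 i <= t)%R] = box (p.1, row_upd p.2 i (Num.min (p.2 0%R i) t)).
Proof.
apply/seteqP; split => x /=.
  move=> [px xt] j; rewrite mxE; case: eqP => [->|_]; last exact: px.
  by rewrite le_min xt andbT; exact: px.
move=> px; split=> [j|].
  have := px j; rewrite mxE; case: eqP => [->|//].
  by rewrite le_min => /and3P[-> ->].
by have := px i; rewrite mxE eqxx le_min => /and3P[].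
Qed.

Lemma box_halfspaceC p i (t : R) :
  box p `&` ~` [set x | (x 0 i <= t)%R] = box (row_upd p.1 i (Num.max (p.1 0%R i) t), p.2).
Proof.
apply/seteqP; split => x /=.
  move=> [px /negP]; rewrite -ltNge => xt j; rewrite mxE; case: eqP => [->|_]; last exact: px.
  by rewrite gt_max xt andbT; exact: px.
move=> px; split=> [j|].
  have := px j; rewrite mxE; case: eqP => [->|//].
  by rewrite gt_max => /andP[/andP[-> _] ->].
by apply/negP; have := px i; rewrite -ltNge mxE eqxx gt_max => /andP[/andP[]].
Qed.

Lemma box_volume_split p i (t : R) :
  (box_volume (p.1, row_upd p.2 i (Num.min (p.2 0 i) t)) +
   box_volume (row_upd p.1 i (Num.max (p.1 0 i) t), p.2) = box_volume p)%R.
Proof.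
rewrite /box_volume (bigD1 i)//= [X in (_ + X)%R](bigD1 i)//= [RHS](bigD1 i)//= !mxE !eqxx.
rewrite (eq_bigr (fun j => Num.max 0 (p.2 0 j - p.1 0 j)))%R; last first.
  by move=> j /negbTE ji; rewrite mxE ji.
rewrite [X in (_ + _ * X)%R](eq_bigr (fun j => Num.max 0 (p.2 0 j - p.1 0 j)))%R; last first.
  by move=> j /negbTE ji; rewrite mxE ji.
rewrite -mulrDl; congr (_ * _)%R.
exact: max_split.
Qed.

Hypothesis n0 : (0 < n)%N.

(** The hyperplane cuts every half-open box of a cover into two half-open boxes with the same total
    volume, so a cover of [X] yields covers of both pieces at no extra cost. This is Caratheodory's
    condition. *)
Lemma measurable_halfspace i (t : R) :
  measurable ([set x | (x 0 i <= t)%R] : set (Rn R n)).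
Proof.
apply: le_caratheodory_measurable => X.
have [fX|] := boolP (outer X \is a fin_num); last first.
  by rewrite ge0_fin_numE ?outer_measure_ge0// -leNgt leye_eq => /eqP Xy; rewrite [leRHS](_ : _ = +oo) ?leey.
apply/lee_addgt0Pr => e e0.
have [p Xp Sp] := outer_series_adherent n0 e0 fX; apply: le_trans Sp.
rewrite (_ : \sum_(0 <= k <oo) _ =
  \sum_(0 <= k <oo) ((box_volume ((p k).1, row_upd (p k).2 i (Num.min ((p k).2 0%R i) t)))%:E +
   (box_volume (row_upd (p k).1 i (Num.max ((p k).1 0%R i) t), (p k).2))%:E)); last first.
  by apply: eq_eseriesr => k _; rewrite -EFinD box_volume_split.
rewrite nneseriesD; [|by move=> *; exact: box_volume_ge0..].
apply: leeD; apply: outer_le_series => x [/Xp[k _ px] xt]; exists k => //.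
  by rewrite -box_halfspace.
by rewrite -box_halfspaceC.
Qed.

Lemma measurable_box p : measurable (box p : set (Rn R n)).
Proof.
rewrite (_ : box p = \bigcap_(i in [set: 'I_n])
    (~` [set x | (x 0 i <= p.1 0 i)%R] `&` [set x | (x 0 i <= p.2 0 i)%R])); last first.
  apply/seteqP; split => x px i.
    by move=> _; have /andP[x1 x2] := px i; split => //=; apply/negP; rewrite -ltNge.
  by have [/negP x1 x2] := px i Logic.I; rewrite ltNge x1.
apply: fin_bigcap_measurable => // i _; apply: measurableI; last exact: measurable_halfspace.
by apply: measurableC; exact: measurable_halfspace.
Qed.

Lemma box_volume_le (p : 'rV[R]_n * 'rV[R]_n) (q : nat -> 'rV[R]_n * 'rV[R]_n) :
  box p `<=` \bigcup_k box (q k) ->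
  (box_volume p)%:E <= \sum_(0 <= k <oo) (box_volume (q k))%:E.
Proof.
(* Rows are extended by 0 to sequences, the indexing under which the induction on the dimension is
   carried out. *)
move=> pq; pose c (x : 'rV[R]_n) i := if insub i is Some j then x 0%R j else 0%R.
have cE x (i : 'I_n) : c x i = x 0%R i by rewrite /c valK.
have := @box_cover_prod_le R n (c p.1) (c p.2) (fun k => c (q k).1) (fun k => c (q k).2) xpredT.
rewrite (eq_bigr (fun i => Num.max 0 (p.2 0 i - p.1 0 i)))%R; last by move=> i _; rewrite !cE.
move/(_ _)/le_trans; apply.
  move=> x px; have [|k _ qx] := pq (\row_i x i).
    by move=> i; rewrite mxE; have := px i (ltn_ord i); rewrite !cE.
  exists k => // i ilt; have /andP[/ltW] := qx (Ordinal ilt).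
  by rewrite !mxE -!cE => /= -> ->.
apply: lee_nneseries => k _.
  by move=> _; rewrite lee_fin mul1r prodr_ge0// => i _; rewrite le_max lexx.
by rewrite mul1r; under eq_bigr do rewrite !cE; exact: lexx.
Qed.

Lemma mu_box p : mu (box p) = (box_volume p)%:E.
Proof.
apply/eqP; rewrite eq_le outer_box_le/=.
have fp : outer (box p) \is a fin_num.
  by rewrite ge0_fin_numE ?outer_measure_ge0// (le_lt_trans (outer_box_le p))// ltry.
apply/lee_addgt0Pr => e e0.
by have [q pq] := outer_series_adherent n0 e0 fp; apply: le_trans; exact: box_volume_le.
Qed.

End BoxMeasure.

(** * Translation invariance of the measure *)

Section Translation.
Context {R : realType} {n : nat}.
Local Notation outer := (@lebesgue_outer_rV R n).
Local Notation mu := (@lebesgue_rV R n).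
Implicit Types (A : set 'rV[R]_n).
Hypothesis n0 : (0 < n)%N.
Local Open Scope ereal_scope.

Let outer_shift_le A (v : 'rV[R]_n) : outer ((fun x => x + v)%R @^-1` A) <= outer A.
Proof.
have [fX|] := boolP (outer A \is a fin_num); last first.
  by rewrite ge0_fin_numE ?outer_measure_ge0// -leNgt leye_eq => /eqP ->; rewrite leey.
apply/lee_addgt0Pr => e e0.
have [p Ap Sp] := outer_series_adherent n0 e0 fX; apply: le_trans Sp.
rewrite [leRHS](_ : _ = \sum_(0 <= k <oo) (box_volume ((p k).1 - v, (p k).2 - v)%R)%:E).
  apply: outer_le_series => x /= /Ap[k _ px]; exists k => // i; have := px i.
  by rewrite !mxE ltrBlDr lerBrDr.
apply: eq_eseriesr => k _; congr (_%:E); apply: eq_bigr => i _.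
by rewrite !mxE opprB addrA subrK.
Qed.

Lemma outer_shift A (v : 'rV[R]_n) : outer ((fun x => x + v)%R @^-1` A) = outer A.
Proof.
apply/eqP; rewrite eq_le outer_shift_le/=.
rewrite [X in outer X <= _](_ : A = (fun x => x - v)%R @^-1` ((fun x => x + v)%R @^-1` A)).
  exact: outer_shift_le.
by apply/seteqP; split => x /=; rewrite subrK.
Qed.

Lemma measurable_rVP A : measurable (A : set (Rn R n)) <->
  (forall X, outer X = outer (X `&` A) + outer (X `&` ~` A)).
Proof. by []. Qed.

Lemma measurable_shift (v : 'rV[R]_n) :
  measurable_fun [set: Rn R n] (fun x : Rn R n => (x + v)%R : Rn R n).
Proof.
move=> _ Y /measurable_rVP mY; rewrite setTI; apply/measurable_rVP => X.
rewrite -[in LHS](outer_shift X (- v)) (mY _); congr (_ + _).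
  rewrite -[RHS](outer_shift _ (- v)); congr (lebesgue_outer_rV _).
  by apply/seteqP; split => x /=; rewrite subrK.
rewrite -[RHS](outer_shift _ (- v)); congr (lebesgue_outer_rV _).
by apply/seteqP; split => x /=; rewrite subrK.
Qed.

Lemma integral_shift (v : 'rV[R]_n) (f : 'rV[R]_n -> \bar R) :
  measurable_fun [set: Rn R n] f -> (forall x, 0 <= f x) ->
  \int[mu]_x f (x + v)%R = \int[mu]_x f x.
Proof.
move=> mf f0.
have E : pushforward mu (fun x : Rn R n => (x + v)%R : Rn R n) = mu :> (set _ -> _).
  by apply/funext => A; exact: outer_shift.
have := ge0_integral_pushforward (measurable_shift v) mu measurableT mf (fun x _ => f0 x).
by rewrite E preimage_setT.
Qed.

End Translation.

Section Topology.
Context {R : realType} {n : nat}.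
Local Notation mu := (@lebesgue_rV R n).
Hypothesis n0 : (0 < n)%N.

Lemma nbhs_rVP (x : 'rV[R]_n) (A : set 'rV[R]_n) :
  nbhs x A <-> exists2 e : R, 0 < e & forall y : 'rV[R]_n, (forall i, `|y 0 i - x 0 i| < e) -> A y.
Proof.
split => [/nbhs_ballP[e /= e0 xA]|[e e0 xA]].
  exists e => // y xy; apply: xA; split => // i j.
  by rewrite ord1 /ball/= distrC.
apply/nbhs_ballP; exists e => //= y [_ xy]; apply: xA => i.
by have := xy 0 i; rewrite /ball/= distrC.
Qed.

Lemma open_measurable_rV (U : set 'rV[R]_n) : open U -> measurable (U : set (Rn R n)).
Proof.
move=> oU.
(* Boxes with rational corners are countably many, and those contained in [U] exhaust it. *)
pose q (r : 'rV[rat]_n * 'rV[rat]_n) :=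
  (map_mx (ratr : rat -> R) r.1, map_mx (ratr : rat -> R) r.2).
pose F r := if pselect (box (q r) `<=` U) then box (q r) else set0.
rewrite (_ : U = \bigcup_r F r); last first.
  apply/seteqP; split => [x Ux|x [r _]]; last first.
    by rewrite /F; case: pselect => // rU /rU.
  have /nbhs_rVP[e e0 xU] : nbhs x U by apply: open_nbhs_nbhs.
  have lo i : exists r : rat, x 0 i - e < ratr r < x 0 i.
    by have [|r] := @rat_in_itvoo R (x 0 i - e) (x 0 i); [lra|rewrite in_itv/=; exists r].
  have hi i : exists r : rat, x 0 i < ratr r < x 0 i + e.
    by have [|r] := @rat_in_itvoo R (x 0 i) (x 0 i + e); [lra|rewrite in_itv/=; exists r].
  have /choice[a ha] := lo; have /choice[b hb] := hi.
  exists (\row_i a i, \row_i b i) => //.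
  rewrite /F; case: pselect => [_ i|[]].
    by rewrite !mxE; have := ha i; have := hb i; lra.
  move=> y yab; apply: xU => i; have := yab i; rewrite !mxE.
  by have := ha i; have := hb i; rewrite ltr_norml; lra.
have mF r : measurable (F r : set (Rn R n)).
  by rewrite /F; case: pselect => rU; [exact: measurable_box|exact: measurable0].
exact: (countable_bigcupT_measurable _ mF).
Qed.

Lemma closed_measurable_rV (A : set 'rV[R]_n) : closed A -> measurable (A : set (Rn R n)).
Proof.
move=> cA; rewrite -(setCK A); apply: measurableC.
by apply: open_measurable_rV; exact: closed_openC.
Qed.

Lemma open_continuous_measurable_rV (U : set 'rV[R]_n) (f : 'rV[R]_n -> R) :
  open U -> (forall x, U x -> {for x, continuous f}) -> measurable_fun (U : set (Rn R n)) f.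
Proof.
move=> oU cf mU; apply: (measurability _ (RGenOInfty.measurableE R)) => // _ [_ [a ->] <-].
apply: open_measurable_rV; rewrite openE => x /= [Ux ax].
have h1 : nbhs x U by apply: open_nbhs_nbhs.
have h2 : nbhs x (f @^-1` [set` `]a, +oo[]).
  by apply: cf => //; apply: open_nbhs_nbhs; split => //; exact: interval_open.
exact: filterI h1 h2.
Qed.

Lemma continuous_measurable_rV (f : 'rV[R]_n -> R) :
  continuous f -> measurable_fun [set: Rn R n] f.
Proof. by move=> cf; apply: (open_continuous_measurable_rV openT) => x _; exact: cf. Qed.

(** Stands in for the change of variables formula: it is applied in slope space, where [q] runs over
    the grid cells and the cube of index [q] collects the slopes of the contact points of that
    cell. *)
Lemma closed_cubes_cover (I : finType) (c : I -> 'I_n -> R) (s : I -> R)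
    (x0 : 'I_n -> R) (r : R) : 0 <= r -> (forall q, 0 <= s q) ->
  (forall x : 'I_n -> R, (forall i, `|x i - x0 i| <= r) ->
     exists q, forall i, `|x i - c q i| <= s q) ->
  (2 * r) ^+ n <= \sum_q (2 * s q) ^+ n.
Proof.
move=> r0 s0 cov.
pose ex (f : 'I_n -> R) i := if insub i is Some j then f j else 0.
have exE f (i : 'I_n) : ex f i = f i by rewrite /ex valK.
pose m := #|I|.
(* The finite family becomes a sequence; the flag [k < m] discards the padding, so the series
   reduces to a finite sum. *)
pose C k := if insub k : option 'I_m is Some j then c (enum_val j) else fun=> 0.
pose S k := if insub k : option 'I_m is Some j then s (enum_val j) else 0.
have := @box_cover_prod_le R n (fun i => ex x0 i - r) (fun i => ex x0 i + r)
  (fun k i => ex (C k) i - S k) (fun k i => ex (C k) i + S k) (fun k => k < m)%N.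
have H (y t : R) : 0 <= t -> Num.max 0 (y + t - (y - t)) = 2 * t.
  by move=> t0; rewrite (max_idPr _); lra.
rewrite (eq_bigr (fun=> 2 * r)); last by move=> i _; rewrite H.
rewrite prodr_const card_ord => /(_ _)/le_trans le; rewrite -lee_fin.
apply: le.
  move=> x xr; have [i|q qx] := cov (fun i => x i).
    by have := xr i (ltn_ord i); rewrite exE ler_norml; lra.
  exists (enum_rank q); first exact: ltn_ord.
  move=> i ilt; have := qx (Ordinal ilt); rewrite /C /S valK enum_rankK.
  by rewrite -[i in ex _ i]/(val (Ordinal ilt)) exE/= ler_norml; lra.
have S0 k : 0 <= S k by rewrite /S; case: insub.
rewrite (nneseries_split 0 m) ?add0n; last first.
  by move=> k _; rewrite lee_fin mulr_ge0// prodr_ge0// => i _; rewrite le_max lexx.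
rewrite [X in (_ + X)%E]eseries0 ?adde0; last by move=> k mk _ /=; rewrite ltnNge mk mul0r.
rewrite big_mkord sumEFin lee_fin.
rewrite [leRHS](reindex_onto (enum_val : 'I_m -> I) enum_rank)/=; last by move=> q _; exact: enum_rankK.
rewrite [leRHS](eq_bigl predT); last by move=> k; rewrite enum_valK eqxx.
apply: ler_sum => k _; rewrite ltn_ord mul1r.
rewrite (eq_bigr (fun=> 2 * S k)); last by move=> i _; rewrite H.
by rewrite prodr_const card_ord /S valK.
Qed.

End Topology.

(** * Calculus along coordinate directions *)

Definition cube (R : realType) (n : nat) (x : 'rV[R]_n) (r : R) : set 'rV[R]_n :=
  [set y | forall i, `|y 0 i - x 0 i| <= r].

(** This box contains the staircase path from [x] to [y] that changes one coordinate at a time,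
    along which partial derivatives control the increment. *)
Definition between (R : realType) (n : nat) (x y : 'rV[R]_n) : set 'rV[R]_n :=
  [set z | forall i, Num.min (x 0 i) (y 0 i) <= z 0 i <= Num.max (x 0 i) (y 0 i)].

Section DirectionalCalculus.
Context {R : realType} {n : nat}.
Local Notation e i := (delta_mx 0 i : 'rV[R]_n).
Implicit Types (x y w : 'rV[R]_n) (f g : 'rV[R]_n -> R).

Lemma nbhs_cube x (r : R) : 0 < r -> nbhs x (cube x r).
Proof. by move=> r0; apply/nbhs_rVP; exists r => // y xy i; exact/ltW. Qed.

Lemma continuous_rVP g x : {for x, continuous g} <->
  forall eps, 0 < eps -> exists2 d, 0 < d & forall y, cube x d y -> `|g y - g x| < eps.
Proof.
split => [cg eps eps0|H].
  have /nbhs_rVP[d d0 xd] : nbhs x (fun y => `|g y - g x| < eps).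
    have /cvgr_dist_lt/(_ _ eps0) := cg.
    by apply: filterS => y; rewrite distrC.
  exists (d / 2); first by rewrite divr_gt0.
  move=> y xy; apply: xd => i; rewrite (le_lt_trans (xy i))//.
  by rewrite ltr_pdivrMr// ltr_pMr// ltr1n.
apply/(@cvgrPdist_lt _ _ _ (nbhs x) (nbhs_filter x)) => eps /H[d d0 xd].
by apply: filterS (nbhs_cube x d0) => y /xd; rewrite distrC.
Qed.

Lemma is_derive_line f (w v : 'rV[R]_n) (t d : R) :
  is_derive (w + t *: v) v f d -> is_derive t 1 (fun s => f (w + s *: v)) d.
Proof.
have E : (fun h : R => h^-1 *: (((fun s => f (w + s *: v)) \o shift t) (h *: 1) - f (w + t *: v)))
       = (fun h : R => h^-1 *: ((f \o shift (w + t *: v)) (h *: v) - f (w + t *: v))).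
  apply/funext => h /=; congr (_ *: (f _ - _)).
  by rewrite [h *: 1]mulr1 scalerDl addrCA.
by case=> df <-; apply: DeriveDef; rewrite /derivable /derive /= E.
Qed.

Lemma is_derive_line0 f (w v : 'rV[R]_n) (d : R) :
  is_derive (0 : R) 1 (fun s => f (w + s *: v)) d -> is_derive w v f d.
Proof.
have E : (fun h : R => h^-1 *: (((fun s => f (w + s *: v)) \o shift 0) (h *: 1) - f (w + 0 *: v)))
       = (fun h : R => h^-1 *: ((f \o shift w) (h *: v) - f w)).
  by apply/funext => h /=; rewrite scale0r !addr0 [h *: 1]mulr1 [w + _]addrC.
by case=> df <-; apply: DeriveDef; move: df; rewrite /derivable /derive /= E.
Qed.

(** Both signs of [t] are covered, because the steps of a staircase path may go either way. *)
Lemma MVT0 (g dg : R -> R) (t : R) :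
  (forall s, Num.min 0 t <= s <= Num.max 0 t -> is_derive s 1 g (dg s)) ->
  exists2 s, Num.min 0 t <= s <= Num.max 0 t & g t - g 0 = dg s * t.
Proof.
move=> gd; have cont (a b : R) : (forall s, a <= s <= b -> is_derive s 1 g (dg s)) ->
    {within `[a, b], continuous g}.
  by move=> ab; apply: derivable_within_continuous => s; rewrite in_itv/= => /ab[].
have [t0|/ltW t0] := leP 0 t.
  move: gd; rewrite min_l// max_r// => gd.
  have [|s] := @MVT_segment R g dg 0 t t0 _ (cont _ _ gd).
    by move=> s; rewrite in_itv/= => /andP[s0 st]; apply: gd; rewrite !ltW.
  by rewrite in_itv/= subr0; exists s.
move: gd; rewrite min_r// max_l// => gd.
have [|s] := @MVT_segment R g dg t 0 t0 _ (cont _ _ gd).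
  by move=> s; rewrite in_itv/= => /andP[s0 st]; apply: gd; rewrite !ltW.
rewrite in_itv/= sub0r mulrN => st E; exists s => //.
by rewrite -(opprB (g 0)) E opprK.
Qed.

Lemma betweenP x y z : between x y z <-> forall i,
  (x 0 i <= z 0 i <= y 0 i) || (y 0 i <= z 0 i <= x 0 i).
Proof.
split => H i; have := H i.
  by case: (leP (x 0 i) (y 0 i)) => _ -> //; rewrite orbT.
by case: (leP (x 0 i) (y 0 i)) => xy /orP[]; lra.
Qed.

Lemma between_cube (c x y z : 'rV[R]_n) (r : R) :
  cube c r x -> cube c r y -> between x y z -> cube c r z.
Proof.
move=> cx cy /betweenP xyz i; have := cx i; have := cy i.
by rewrite !ler_norml; have /orP[] := xyz i; lra.
Qed.

(** The increment telescopes along the corners [w k], which take their first [k] coordinates from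
    [y] and the others from [x]; each edge is an ordinary mean value step, with its own point
    [z i]. *)
Lemma mean_value_axes f (f1 : 'I_n -> 'rV[R]_n -> R) x y :
  (forall z i, between x y z -> is_derive z (e i) f (f1 i z)) ->
  exists2 z : 'I_n -> 'rV[R]_n, (forall i, between x y (z i)) &
    f y - f x = \sum_(i < n) f1 i (z i) * (y 0 i - x 0 i).
Proof.
move=> fd.
pose w (k : nat) : 'rV[R]_n := \row_i if (i < k)%N then y 0 i else x 0 i.
have w0 : w 0 = x by apply/rowP => i; rewrite mxE.
have wn : w n = y by apply/rowP => i; rewrite mxE ltn_ord.
have wS (i : 'I_n) : w i.+1 = w i + (y 0 i - x 0 i) *: e i.
  apply/rowP => j; rewrite !mxE eqxx/= ltnS.
  have [ji|ij|/val_inj ->] := ltngtP j i.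
  - by rewrite -val_eqE ltn_eqF// mulr0 addr0.
  - by rewrite -val_eqE gtn_eqF// mulr0 addr0.
  - by rewrite eqxx mulr1 addrC subrK.
have H (i : 'I_n) : exists2 z, between x y z &
    f (w i.+1) - f (w i) = f1 i z * (y 0 i - x 0 i).
  have btw s : Num.min 0 (y 0 i - x 0 i) <= s <= Num.max 0 (y 0 i - x 0 i) ->
      between x y (w i + s *: e i).
    move=> sxy; apply/betweenP => j; rewrite !mxE eqxx/=.
    have [->|ji] := eqVneq j i.
      rewrite ltnn mulr1; move: sxy.
      by case: (leP 0 (y 0 i - x 0 i)) => yx sxy; apply/orP; [left|right]; lra.
    by rewrite mulr0 addr0; case: ifP => _; rewrite lexx/= ?andbT le_total.
  have [|s sxy E] := @MVT0 (fun s => f (w i + s *: e i)) (fun s => f1 i (w i + s *: e i))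
      (y 0 i - x 0 i).
    by move=> s /btw/fd ?; exact: is_derive_line.
  by exists (w i + s *: e i); [exact: btw|rewrite wS -E scale0r addr0].
have /choice[z zP] : forall i : 'I_n, exists z, between x y z /\
    f (w i.+1) - f (w i) = f1 i z * (y 0 i - x 0 i).
  by move=> i; have [z] := H i; exists z.
exists z => [i|]; first by have [] := zP i.
rewrite -{1}wn -{1}w0 -(telescope_sumr (fun k => f (w k)))// big_mkord.
by apply: eq_bigr => i _; have [] := zP i.
Qed.

Lemma lipschitz_axes f (f1 : 'I_n -> 'rV[R]_n -> R) x y (M d : R) :
  (forall z i, between x y z -> is_derive z (e i) f (f1 i z)) ->
  (forall z i, between x y z -> `|f1 i z| <= M) ->
  (forall i, `|y 0 i - x 0 i| <= d) ->
  `|f y - f x| <= n%:R * (M * d).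
Proof.
move=> fd fM xyd; have [z xyz ->] := mean_value_axes fd.
apply: (le_trans (ler_norm_sum _ _ _)).
rewrite mulr_natl -[X in _ *+ X]card_ord -sumr_const; apply: ler_sum => i _.
by rewrite normrM ler_pM//; exact: fM.
Qed.

(** The functions below come with partial derivatives only, whereas the conditions at a maximum are
    read along arbitrary lines. Continuity of the partial derivatives at [x] closes the gap. *)
Lemma is_derive_dir f (f1 : 'I_n -> 'rV[R]_n -> R) x (xi : 'rV[R]_n) (r : R) :
  0 < r -> (forall z i, cube x r z -> is_derive z (e i) f (f1 i z)) ->
  (forall i, {for x, continuous (f1 i)}) ->
  is_derive x xi f (\sum_(i < n) f1 i x * xi 0 i).
Proof.
move=> r0 fd fc; set L := \sum_(i < n) _.
suff cv : (fun h : R => h^-1 *: ((f \o shift x) (h *: xi) - f x)) @ 0^' --> L.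
  by apply: DeriveDef; [apply/cvg_ex; exists L|exact/cvg_lim].
pose S := \sum_(i < n) `|xi 0 i|.
have S0 : 0 <= S by exact: sumr_ge0.
have xiS i : `|xi 0 i| <= S by rewrite /S (bigD1 i)//= lerDl sumr_ge0.
apply/cvgrPdist_le => eps eps0.
(* Dividing by [1 + S] instead of [S] allows for the direction [xi = 0]. *)
have e1 : 0 < eps / (1 + S) by rewrite divr_gt0// ltr_pwDl.
have /choice[d dP] : forall i, exists d, 0 < d /\
    forall y, cube x d y -> `|f1 i y - f1 i x| < eps / (1 + S).
  by move=> i; have [d] := (continuous_rVP _ _).1 (fc i) _ e1; exists d.
pose d0 := \big[Num.min/r]_i d i.
have d00 : 0 < d0 by apply: lt_bigmin => // i _; have [] := dP i.
have d0r : d0 <= r by exact: bigmin_le_id.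
have d0i i : d0 <= d i by exact: bigmin_le.
near=> h.
have h0 : h != 0 by near: h; exact: nbhs_dnbhs_neq.
have hd : `|h| * (1 + S) <= d0.
  rewrite -ler_pdivlMr ?ltr_pwDl//; near: h; apply/dnbhs0_le.
  by rewrite divr_gt0// ltr_pwDl.
have xh : cube x d0 (x + h *: xi).
  move=> i; rewrite !mxE addrAC subrr add0r normrM (le_trans _ hd)// ler_wpM2l//.
  by rewrite (le_trans (xiS i))// lerDr.
have xx : cube x d0 x by move=> i; rewrite subrr normr0 ltW.
have [|z xyz] := @mean_value_axes f f1 x (x + h *: xi).
  move=> z i /(between_cube xx xh) xz; apply: fd => j.
  by rewrite (le_trans (xz j)).
rewrite /= [h *: xi + x]addrC => ->.
rewrite scaler_sumr -sumrB (le_trans (ler_norm_sum _ _ _))//.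
apply: (@le_trans _ _ (\sum_(i < n) eps / (1 + S) * `|xi 0 i|)).
  apply: ler_sum => i _; rewrite !mxE [x 0 i + _]addrC addrK.
  have -> : h^-1 *: (f1 i (z i) * (h * xi 0 i)) = f1 i (z i) * xi 0 i :> R.
    by rewrite [LHS]mulrCA mulKf.
  rewrite -mulrBl normrM.
  rewrite ler_wpM2r// distrC ltW//; apply: (dP i).2 => j.
  by rewrite (le_trans _ (d0i i))//; exact: (between_cube xx xh (xyz i)).
rewrite -mulr_sumr -/S mulrAC ler_pdivrMr ?ltr_pwDl// ler_wpM2l ?(ltW eps0)//.
by rewrite lerDr.
Unshelve. all: by end_near. Qed.

End DirectionalCalculus.

(** Derivatives are data, so that sums, compositions and convolutions carry explicit formulas.
    Symmetry of the Hessian is a field: it is evident for explicit functions and follows from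
    Schwarz's theorem for functions given by [Ck]. *)
Record C2on (R : realType) (n : nat) (U : set 'rV[R]_n) (f : 'rV[R]_n -> R)
    (f1 : 'I_n -> 'rV[R]_n -> R) (f2 : 'I_n -> 'I_n -> 'rV[R]_n -> R) : Prop := C2on_intro {
  C2_cont : forall x, U x -> {for x, continuous f};
  C2_cont1 : forall i x, U x -> {for x, continuous (f1 i)};
  C2_cont2 : forall i j x, U x -> {for x, continuous (f2 i j)};
  C2_derive1 : forall i x, U x -> is_derive x (delta_mx 0 i) f (f1 i x);
  C2_derive2 : forall i j x, U x -> is_derive x (delta_mx 0 j) (f1 i) (f2 i j x);
  C2_sym : forall i j x, U x -> f2 i j x = f2 j i x }.

Section SecondOrder.
Context {R : realType} {n : nat}.
Local Notation e i := (delta_mx 0 i : 'rV[R]_n).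
Implicit Types (x y w : 'rV[R]_n) (U V : set 'rV[R]_n).

Lemma C2on_sub U V f f1 f2 : V `<=` U -> C2on U f f1 f2 -> C2on V f f1 f2.
Proof. by move=> VU [? ? ? ? ? ?]; split => *; eauto. Qed.

Lemma C2onD U f f1 f2 g g1 g2 : C2on U f f1 f2 -> C2on U g g1 g2 ->
  C2on U (fun x => f x + g x) (fun i x => f1 i x + g1 i x) (fun i j x => f2 i j x + g2 i j x).
Proof.
move=> F G; split.
- by move=> x Ux; apply: continuousD; [exact: C2_cont F _ Ux|exact: C2_cont G _ Ux].
- by move=> i x Ux; apply: continuousD; [exact: C2_cont1 F _ _ Ux|exact: C2_cont1 G _ _ Ux].
- by move=> i j x Ux; apply: continuousD; [exact: C2_cont2 F _ _ _ Ux|exact: C2_cont2 G _ _ _ Ux].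
- by move=> i x Ux; apply: is_deriveD; [exact: C2_derive1 F _ _ Ux|exact: C2_derive1 G _ _ Ux].
- by move=> i j x Ux; apply: is_deriveD; [exact: C2_derive2 F _ _ _ Ux|exact: C2_derive2 G _ _ _ Ux].
- by move=> i j x Ux; rewrite (C2_sym F)// (C2_sym G).
Qed.

Lemma C2onN U f f1 f2 : C2on U f f1 f2 ->
  C2on U (fun x => - f x) (fun i x => - f1 i x) (fun i j x => - f2 i j x).
Proof.
move=> F; split.
- by move=> x Ux; apply: continuousN; exact: C2_cont F _ Ux.
- by move=> i x Ux; apply: continuousN; exact: C2_cont1 F _ _ Ux.
- by move=> i j x Ux; apply: continuousN; exact: C2_cont2 F _ _ _ Ux.
- by move=> i x Ux; apply: is_deriveN; exact: C2_derive1 F _ _ Ux.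
- by move=> i j x Ux; apply: is_deriveN; exact: C2_derive2 F _ _ _ Ux.
- by move=> i j x Ux; rewrite (C2_sym F).
Qed.

Lemma is_derive_comp1 (g dg : R -> R) (f : 'rV[R]_n -> R) (x v : 'rV[R]_n) (df : R) :
  is_derive x v f df -> is_derive (f x) 1 g (dg (f x)) ->
  is_derive x v (fun y => g (f y)) (dg (f x) * df).
Proof.
move=> fd gd; apply: is_derive_line0.
apply: (@is_derive1_comp R g (fun s => f (x + s *: v)) 0).
  by rewrite scale0r addr0.
by apply: is_derive_line; rewrite scale0r addr0.
Qed.

Lemma C2on_comp U f f1 f2 (g dg ddg : R -> R) : C2on U f f1 f2 ->
  (forall x, U x -> is_derive (f x) 1 g (dg (f x))) ->
  (forall x, U x -> is_derive (f x) 1 dg (ddg (f x))) ->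
  (forall x, U x -> {for f x, continuous ddg}) ->
  C2on U (fun x => g (f x)) (fun i x => dg (f x) * f1 i x)
    (fun i j x => ddg (f x) * (f1 i x * f1 j x) + dg (f x) * f2 i j x).
Proof.
move=> F gd dgd ddgc.
have dcont (h dh : R -> R) (t : R) : is_derive t 1 h (dh t) -> {for t, continuous h}.
  by move=> [hd _]; apply: differentiable_continuous; exact/derivable1_diffP.
have gc x : U x -> {for x, continuous (g \o f)}.
  by move=> Ux; apply: continuous_comp; [exact: C2_cont F _ Ux|exact: dcont (gd _ Ux)].
have dgc x : U x -> {for x, continuous (dg \o f)}.
  by move=> Ux; apply: continuous_comp; [exact: C2_cont F _ Ux|exact: dcont (dgd _ Ux)].
have ddgfc x : U x -> {for x, continuous (ddg \o f)}.
  by move=> Ux; apply: continuous_comp; [exact: C2_cont F _ Ux|exact: ddgc].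
split.
- by [].
- by move=> i x Ux; apply: continuousM; [exact: dgc|exact: C2_cont1 F _ _ Ux].
- move=> i j x Ux; apply: continuousD; apply: continuousM.
  + exact: ddgfc.
  + by apply: continuousM; exact: C2_cont1 F _ _ Ux.
  + exact: dgc.
  + exact: C2_cont2 F _ _ _ Ux.
- by move=> i x Ux; apply: is_derive_comp1; [exact: C2_derive1 F _ _ Ux|exact: gd].
- move=> i j x Ux.
  have d1 := is_derive_comp1 (C2_derive1 F j Ux) (dgd _ Ux).
  have D := is_deriveM d1 (C2_derive2 F i j Ux).
  apply: (is_derive_eq D); rewrite addrC; congr (_ + _).
  by rewrite [LHS]mulrCA.
- by move=> i j x Ux; rewrite (C2_sym F)// [f1 i x * _]mulrC.
Qed.

(** The second difference [D] over a small square of side [s] is symmetric in the two directions,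
    and two mean value steps, taken in either order, identify it with [s * s] times a nearby value
    of either mixed derivative. *)
Lemma Schwarz_C2 U (f : 'rV[R]_n -> R) f1 f2 x (i j : 'I_n) : open U -> U x ->
  (forall i x, U x -> is_derive x (e i) f (f1 i x)) ->
  (forall i j x, U x -> is_derive x (e j) (f1 i) (f2 i j x)) ->
  {for x, continuous (f2 i j)} -> {for x, continuous (f2 j i)} ->
  f2 i j x = f2 j i x.
Proof.
move=> oU Ux d1 d2 cij cji.
have [->//|ij] := eqVneq i j.
have /nbhs_rVP[r r0 rU] : nbhs x U by apply: open_nbhs_nbhs.
apply/eqP; rewrite eq_sym -subr_eq0 -normr_le0; apply/ler_addgt0Pl => eps eps0.
rewrite addr0.
have e2 : 0 < eps / 2 by rewrite divr_gt0.
have [da da0 Ha] := (continuous_rVP _ _).1 cij _ e2.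
have [db db0 Hb] := (continuous_rVP _ _).1 cji _ e2.
pose s := Num.min (r / 2) (Num.min da db).
have s0 : 0 < s by rewrite !lt_min divr_gt0// da0 db0.
have sr : s < r by rewrite gt_min; apply/orP; left; lra.
have sa : s <= da by rewrite !ge_min lexx orbT.
have sb : s <= db by rewrite !ge_min lexx !orbT.
pose pt (i j : 'I_n) (t u : R) := x + t *: e i + u *: e j.
have ptC k l t u : pt k l t u = pt l k u t by rewrite /pt addrAC.
have ptcube k l t u : k != l -> 0 <= t <= s -> 0 <= u <= s -> cube x s (pt k l t u).
  move=> kl ts us m; rewrite !mxE eqxx/= (_ : _ - x 0 m = t * (m == k)%:R + u * (m == l)%:R); last by ring.
  have [->|mk] := eqVneq m k.
    by rewrite (negbTE kl) mulr0 addr0 mulr1 ger0_norm; lra.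
  have [ml|ml] := eqVneq m l; first by rewrite mulr0 add0r mulr1 ger0_norm; lra.
  by rewrite !mulr0 addr0 normr0 ltW.
have ptU k l t u : k != l -> 0 <= t <= s -> 0 <= u <= s -> U (pt k l t u).
  move=> kl ts us; apply: rU => m; apply: le_lt_trans sr.
  exact: ptcube.
pose D k l := f (pt k l s s) - f (pt k l s 0) - (f (pt k l 0 s) - f (pt k l 0 0)).
have minmax t : Num.min 0 s <= t <= Num.max 0 s = (0 <= t <= s).
  by rewrite (min_l (ltW s0)) (max_r (ltW s0)).
have ss : 0 <= s <= s by rewrite lexx ltW.
have s00 : 0 <= (0:R) <= s by rewrite lexx ltW.
have key k l : k != l -> exists2 z, cube x s z & D k l = f2 k l z * (s * s).
  move=> kl.
  have line t u : 0 <= t <= s -> 0 <= u <= s ->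
      is_derive t 1 (fun t => f (pt k l t u)) (f1 k (pt k l t u)).
    move=> ts us; have := @is_derive_line R n f (x + u *: e l) (e k) t (f1 k (pt k l t u)).
    have E q : x + u *: e l + q *: e k = pt k l q u by rewrite /pt addrAC.
    by rewrite E; under eq_fun do rewrite E; apply; apply: d1; exact: ptU.
  have [|t] := @MVT0 R (fun t => f (pt k l t s) - f (pt k l t 0))
     (fun t => f1 k (pt k l t s) - f1 k (pt k l t 0)) s.
    by move=> t; rewrite minmax => ts; apply: is_deriveB; exact: line.
  rewrite minmax => ts E1.
  have [|u] := @MVT0 R (fun u => f1 k (pt k l t u)) (fun u => f2 k l (pt k l t u)) s.
    by move=> u; rewrite minmax => us; apply: is_derive_line; apply: d2; exact: ptU.
  rewrite minmax => us E2; exists (pt k l t u); first exact: ptcube.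
  by rewrite /D E1 E2 mulrA.
have [z1 xz1 E1] := key i j ij.
have ji : j != i by rewrite eq_sym.
have [z2 xz2] := key j i ji.
rewrite (_ : D j i = D i j); last first.
  by rewrite /D (ptC j i s s) (ptC j i s 0) (ptC j i 0 s) (ptC j i 0 0); ring.
rewrite E1 => /(mulIf (lt0r_neq0 (mulr_gt0 s0 s0))) E.
have Ha' := Ha z1 (fun k => le_trans (xz1 k) sa).
have Hb' := Hb z2 (fun k => le_trans (xz2 k) sb).
rewrite -(subrKA (f2 j i z2)) -{2}E (le_trans (ler_normD _ _))//.
by rewrite distrC [eps]splitr ltW// ltrD.
Qed.

Lemma Ck2_C2on U (f : 'rV[R]_n -> R) : open U -> Ck 2 U f ->
  C2on U f (fun i => pderiv [:: i] f) (fun i j => pderiv [:: j; i] f).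
Proof.
move=> oU [fd fc].
have d1 i x : U x -> is_derive x (e i) f (pderiv [:: i] f x).
  by move=> Ux; apply: derivableP; exact: (fd [::]).
have d2 i j x : U x -> is_derive x (e j) (pderiv [:: i] f) (pderiv [:: j; i] f x).
  by move=> Ux; apply: derivableP; exact: (fd [:: i]).
have c0 x : U x -> {for x, continuous f} by exact: (fc [::]).
have c1 i x : U x -> {for x, continuous (pderiv [:: i] f)} by exact: (fc [:: i]).
have c2 i j x : U x -> {for x, continuous (pderiv [:: j; i] f)} by exact: (fc [:: j; i]).
apply: (C2on_intro c0 c1 c2 d1 d2) => i j x Ux.
exact: (Schwarz_C2 oU Ux d1 d2 (c2 _ _ _ Ux) (c2 _ _ _ Ux)).
Qed.

(** Along a line, [h] is the function minus its affine majorant and is maximal at 0, so its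
    derivative [k] vanishes there. Were the second derivative [Q] positive, [k] would be positive
    just to the right of 0 and [h] would exceed its maximum by the mean value theorem. *)
Lemma C2_max_conditions (x : 'rV[R]_n) (r : R) f f1 f2 (p : 'I_n -> R) : 0 < r ->
  C2on (cube x r) f f1 f2 ->
  (forall y, cube x r y -> f y <= f x + \sum_(i < n) p i * (y 0 i - x 0 i)) ->
  (forall i, f1 i x = p i) /\
  (forall xi : 'rV[R]_n, \sum_(i < n) \sum_(j < n) f2 i j x * xi 0 i * xi 0 j <= 0).
Proof.
move=> r0 F fmax.
pose P (xi : 'rV[R]_n) := \sum_(i < n) p i * xi 0 i.
pose h (xi : 'rV[R]_n) (t : R) := f (x + t *: xi) - t * P xi.
pose k (xi : 'rV[R]_n) (t : R) := \sum_(i < n) f1 i (x + t *: xi) * xi 0 i - P xi.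
have small (xi : 'rV[R]_n) : exists2 d, 0 < d &
    forall t : R, `|t| < d -> exists2 s, 0 < s & cube (x + t *: xi) s `<=` cube x r.
  pose S := \sum_(i < n) `|xi 0 i|.
  have S0 : 0 <= S by exact: sumr_ge0.
  have xiS i : `|xi 0 i| <= S by rewrite /S (bigD1 i)//= lerDl sumr_ge0.
  exists (r / 2 / (1 + S)); first by rewrite !divr_gt0// ltr_pwDl.
  move=> t; rewrite ltr_pdivlMr ?ltr_pwDl// => tS.
  exists (r / 2); first by rewrite divr_gt0.
  move=> z xz i; have := xz i; rewrite !mxE.
  have : `|t * xi 0 i| <= r / 2.
    rewrite normrM (le_trans _ (ltW tS))// ler_wpM2l// (le_trans (xiS i))//.
    by rewrite lerDr.
  by rewrite !ler_norml; lra.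
have hd xi d (t : R) : 0 < d -> (forall t : R, `|t| < d -> exists2 s, 0 < s & cube (x + t *: xi) s `<=` cube x r) ->
    `|t| < d -> is_derive t 1 (h xi) (k xi t).
  move=> d0 sm /sm[s s0 sr].
  have D1 : is_derive t 1 (fun t => f (x + t *: xi)) (\sum_(i < n) f1 i (x + t *: xi) * xi 0 i).
    apply: is_derive_line; apply: (@is_derive_dir R n f f1 _ xi s s0).
      by move=> z i /sr; exact: C2_derive1 F _ _.
    move=> i; apply: (C2_cont1 F); apply: sr.
    by move=> j; rewrite subrr normr0 ltW.
  have D2 := is_deriveB D1 (is_deriveZ (P xi) (is_derive_id t 1)).
  rewrite (_ : h xi = (fun t => f (x + t *: xi)) - P xi *: (id : R -> R)); last first.
    by apply/funext => u; rewrite /h [u * _]mulrC.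
  by apply: (is_derive_eq D2); rewrite [P xi *: _]mulr1.
have hmax xi t : cube x r (x + t *: xi) -> h xi t <= h xi 0.
  move=> /fmax; rewrite /h scale0r addr0 mul0r subr0 lerBlDr => /le_trans; apply.
  rewrite lerD2l mulr_sumr; apply: ler_sum => i _.
  by rewrite !mxE [x 0 i + _]addrC addrK mulrCA.
have k0 xi : k xi 0 = 0.
  have [d d0 sm] := small xi.
  have inD (t : R) : t \in `]- d, d[ -> `|t| < d by rewrite in_itv/= ltr_norml.
  have M : is_derive (0 : R) 1 (h xi) 0.
    apply: (@derive1_at_max R (h xi) (- d) d 0).
    - by rewrite ge0_cp// ltW.
    - by move=> t /inD td; have [] := hd xi d t d0 sm td.
    - by rewrite in_itv/= oppr_lt0 d0.
    - move=> t /inD/sm[s s0 sr]; apply: hmax; apply: sr => i.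
      by rewrite subrr normr0 ltW.
  have d00 : `|0 : R| < d by rewrite normr0.
  have [_ E1] := M; have [_ E2] := hd xi d 0 d0 sm d00.
  by rewrite -E2 E1.
have f1p i : f1 i x = p i.
  have := k0 (e i); rewrite /k /P scale0r addr0 (bigD1 i)//= big1 ?addr0; last first.
    by move=> j /negbTE ji; rewrite mxE ji andbF mulr0.
  rewrite (bigD1 i)//= big1 ?addr0; last first.
    by move=> j /negbTE ji; rewrite mxE ji andbF mulr0.
  by rewrite mxE !eqxx !mulr1 => /eqP; rewrite subr_eq0 => /eqP.
split => // xi.
set Q := \sum_(i < n) _.
rewrite leNgt; apply/negP => Q0.
have [d d0 sm] := small xi.
have kd : is_derive (0 : R) 1 (k xi) Q.
  pose dk i := \sum_(j < n) f2 i j x * xi 0 j.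
  have d1 i : is_derive (0 : R) 1 (fun t => f1 i (x + t *: xi) * xi 0 i) (dk i * xi 0 i).
    have dd : is_derive (0 : R) 1 (fun t => f1 i (x + t *: xi)) (dk i).
      apply: is_derive_line; rewrite scale0r addr0; apply: (@is_derive_dir R n (f1 i) (f2 i) x xi r r0).
        by move=> z j /(C2_derive2 F i j).
      by move=> j; apply: (C2_cont2 F) => l; rewrite subrr normr0 ltW.
    have D := is_deriveZ (xi 0 i) dd.
    rewrite (_ : (fun t => _) = xi 0 i *: (fun t => f1 i (x + t *: xi)) :> (R -> R)).
      by apply: (is_derive_eq D); rewrite [LHS]mulrC.
    by apply/funext => t; rewrite [LHS]mulrC.
  have D := is_deriveB (is_derive_sum d1) (is_derive_cst (P xi) (0:R) 1).
  rewrite (_ : k xi = (\sum_(i < n) (fun t => f1 i (x + t *: xi) * xi 0 i)) - cst (P xi)); last first.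
    by apply/funext => t; rewrite /k fctE fct_sumE.
  apply: (is_derive_eq D); rewrite subr0; apply: eq_bigr => i _.
  by rewrite /dk mulr_suml; apply: eq_bigr => j _; rewrite mulrAC.
have [dk Ek] := kd.
have : (fun t : R => t^-1 *: (k xi (t *: 1 + 0) - k xi 0)) @ 0^' --> Q.
  by rewrite -Ek; exact: dk.
move=> /cvgrPdist_lt/(_ _ Q0) near0.
have [t0 t00 Ht] : exists2 t0, 0 < t0 & forall t, 0 < t < t0 -> 0 < k xi t.
  have [/= t0 t00 H] := near0; exists t0 => // t /andP[tp tt].
  have Hb : ball (0 : R) t0 t by rewrite /ball/= sub0r normrN gtr0_norm.
  have tn0 : t != 0 by rewrite gt_eqF.
  have := H t Hb tn0; rewrite k0 subr0 addr0 [t *: 1]mulr1 ltr_norml => /andP[_].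
  by rewrite ltrBlDr ltrDl [_ *: _]/(_ * _) pmulr_rgt0 ?invr_gt0.
pose t := Num.min (t0 / 2) (d / 2).
have tpos : 0 < t by rewrite lt_min !divr_gt0.
have td : t < d by rewrite gt_min; apply/orP; right; lra.
have tt0 : t < t0 by rewrite gt_min; apply/orP; left; lra.
have [s] : exists2 s, s \in `]0, t[%R & h xi t - h xi 0 = k xi s * (t - 0).
  apply: MVT; first exact: tpos.
    move=> s; rewrite in_itv/= => /andP[s0 st]; apply: (hd _ _ _ d0 sm).
    by rewrite gtr0_norm// (lt_trans st).
  apply: derivable_within_continuous => s; rewrite in_itv/= => /andP[s0 st].
  have sd : `|s| < d by rewrite ger0_norm// (le_lt_trans st).
  by have [] := hd _ _ _ d0 sm sd.
rewrite in_itv/= subr0 => /andP[s0 st] E.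
have : h xi t <= h xi 0.
  apply: hmax; have [|u u0] := sm t; first by rewrite gtr0_norm.
  by apply => i; rewrite subrr normr0 ltW.
rewrite -subr_le0 E pmulr_lle0// leNgt Ht// s0.
exact: lt_trans tt0.
Qed.

End SecondOrder.

(** * Quadratic forms and contact slopes *)

Section QuadraticForms.
Context {R : realFieldType} {n : nat}.
Implicit Types (A Q H : 'I_n -> 'I_n -> R) (xi : 'I_n -> R).

Definition qform Q xi : R := \sum_(i < n) \sum_(j < n) Q i j * xi i * xi j.

Definition symf Q := forall i j, Q i j = Q j i.

Lemma sum_pickr (F : 'I_n -> R) k : \sum_(j < n) F j * (j == k)%:R = F k.
Proof.
rewrite (bigD1 k)//= eqxx mulr1 big1 ?addr0// => j /negbTE ->.
by rewrite mulr0.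
Qed.

Lemma sum_pickl (F : 'I_n -> R) k : \sum_(j < n) (k == j)%:R * F j = F k.
Proof. by rewrite -[RHS]sum_pickr; apply: eq_bigr => j _; rewrite mulrC eq_sym. Qed.

Lemma qform_unit Q k : qform Q (fun i => (i == k)%:R) = Q k k.
Proof.
rewrite /qform -[RHS](sum_pickr (fun i => Q i k) k); apply: eq_bigr => i _.
by rewrite sum_pickr.
Qed.

Lemma qform_shift Q xi k t : symf Q ->
  qform Q (fun i => xi i + t * (i == k)%:R) =
  qform Q xi + 2 * t * (\sum_(i < n) Q i k * xi i) + t ^+ 2 * Q k k.
Proof.
move=> sQ; rewrite /qform.
have row i : \sum_(j < n) Q i j * (xi i + t * (i == k)%:R) * (xi j + t * (j == k)%:R) =
    \sum_(j < n) Q i j * xi i * xi j + t * (Q i k * xi i) +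
    (t * (\sum_(j < n) Q i j * xi j) + t ^+ 2 * Q i k) * (i == k)%:R.
  rewrite -(sum_pickr (fun j => Q i j * xi i)) -[X in _ + (_ + _ * X) * _](sum_pickr (fun j => Q i j)).
  rewrite !mulr_sumr -!big_split/= mulr_suml -!big_split/=.
  by apply: eq_bigr => j _; ring.
rewrite (eq_bigr _ (fun i _ => row i)) !big_split/= sum_pickr -!mulr_sumr.
have -> : \sum_(j < n) Q k j * xi j = \sum_(i < n) Q i k * xi i.
  by apply: eq_bigr => i _; rewrite sQ.
by rewrite -!addrA; congr (_ + _); ring.
Qed.

(* Schur complements: eliminating one variable at a time writes Q as a sum of
   rank one positive forms. *)
Lemma sum_psd_mul_ge0 A Q : symf Q -> (forall xi, 0 <= qform A xi) ->
  (forall xi, 0 <= qform Q xi) -> 0 <= \sum_(i < n) \sum_(j < n) A i j * Q i j.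
Proof.
move=> sQ A0 Q0; suff H m : (m <= n)%N -> forall Q, symf Q -> (forall xi, 0 <= qform Q xi) ->
    (forall i j : 'I_n, (m <= i)%N -> Q i j = 0) ->
    0 <= \sum_(i < n) \sum_(j < n) A i j * Q i j.
  by apply: (H n) => // i j; rewrite leqNgt ltn_ord.
elim: m => [|m IH] mn {sQ Q0} {}Q sQ Q0 Qm.
  by rewrite big1// => i _; rewrite big1// => j _; rewrite Qm// mulr0.
pose k : 'I_n := Ordinal mn.
have lt_of (i : 'I_n) : (m <= i)%N -> i = k \/ (m < i)%N.
  by rewrite leq_eqVlt => /orP[/eqP E|]; [left; apply: val_inj|right].
have qk0 : 0 <= Q k k.
  have := Q0 (fun i => 0 + 1 * (i == k)%:R); rewrite qform_shift// /qform.
  rewrite big1 ?add0r; last by move=> i _; rewrite big1// => j _; rewrite mulr0.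
  rewrite big1 ?mulr0 ?add0r; last by move=> i _; rewrite mulr0.
  by rewrite expr1n mul1r.
have [q0|qn0] := eqVneq (Q k k) 0.
  apply: (IH (ltnW mn) _ sQ Q0) => i j /lt_of[->|]; last exact: Qm.
  apply/eqP; apply: contraT => Qkj0.
  (* With [Q k k = 0] the form is affine in the shift along [k]; this shift gives it the value -1,
     so the whole row must vanish. *)
  have := Q0 (fun i => (i == j)%:R + (- (Q j j + 1) / (2 * Q k j)) * (i == k)%:R).
  rewrite qform_shift// q0 mulr0 addr0.
  have -> : \sum_(i < n) Q i k * (i == j)%:R = Q k j.
    by rewrite sum_pickr sQ.
  rewrite qform_unit.
  have -> : 2 * (- (Q j j + 1) / (2 * Q k j)) * Q k j = - (Q j j + 1) by field.
  by lra.
have q0 : 0 < Q k k by rewrite lt_neqAle eq_sym qn0.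
pose Q' i j := Q i j - Q i k * Q k j / Q k k.
have E : \sum_(i < n) \sum_(j < n) A i j * Q i j =
    \sum_(i < n) \sum_(j < n) A i j * Q' i j + qform A (fun i => Q i k) / Q k k.
  rewrite /qform mulr_suml -big_split/=; apply: eq_bigr => i _.
  rewrite mulr_suml -big_split/=; apply: eq_bigr => j _.
  by rewrite /Q' (sQ j k); field.
rewrite E addr_ge0//; last by rewrite divr_ge0.
apply: (IH (ltnW mn)).
- by move=> i j; rewrite /Q' (sQ i j) (sQ i k) (sQ k j); congr (_ - _ / _); ring.
- move=> xi.
  (* This shift minimises the form along the variable [k], and the minimum is [qform Q' xi]. *)
  have := Q0 (fun i => xi i + (- (\sum_(i < n) Q i k * xi i) / Q k k) * (i == k)%:R).
  rewrite qform_shift//; set S := \sum_(i < n) Q i k * xi i.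
  suff -> : qform Q' xi = qform Q xi - S ^+ 2 / Q k k.
    have -> : (- S / Q k k) ^+ 2 * Q k k = S ^+ 2 / Q k k by field.
    have -> : 2 * (- S / Q k k) * S = - (2 * (S ^+ 2 / Q k k)) by field.
    by lra.
  rewrite /S expr2 big_distrlr/= mulr_suml /qform -sumrB.
  apply: eq_bigr => i _; rewrite mulr_suml -sumrB; apply: eq_bigr => j _.
  by rewrite /Q' (sQ k j); field.
- move=> i j /lt_of[->|mi]; rewrite /Q'; first by field.
  by rewrite (Qm i j mi) (Qm i k mi) !mul0r subr0.
Qed.

(** Testing on the sum and the difference of two unit vectors bounds an off-diagonal entry by the
    two diagonal ones; the remaining diagonal entries have the right sign. A bound on the trace
    thereby bounds the whole Hessian. *)
Lemma nsd_entry_le H k l : symf H -> (forall xi, qform H xi <= 0) ->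
  `|H k l| <= - \sum_(i < n) H i i.
Proof.
move=> sH H0.
have diag j : H j j <= 0 by rewrite -qform_unit.
have cross t : H k k + 2 * t * H k l + t ^+ 2 * H l l <= 0.
  have := H0 (fun i => (i == k)%:R + t * (i == l)%:R).
  by rewrite qform_shift// qform_unit sum_pickr (sH k l).
have tr : \sum_(i < n) H i i <= H k k + (if k == l then 0 else H l l).
  rewrite (bigD1 k)//= lerD2l; case: eqP => [_|/eqP kl]; first by rewrite sumr_le0.
  by rewrite (bigD1 l) ?[l == k]eq_sym//= gerDl sumr_le0.
have := cross 1; have := cross (-1); have := diag k; have := diag l; move: tr.
rewrite sqrrN expr1n ler_norml; case: eqP => [->|_]; lra.
Qed.

(** Both [A - lam I] and [- H] are positive semidefinite, so their pairing is nonnegative.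
    Ellipticity thus turns information on [A D^2 w] into information on the trace. *)
Lemma elliptic_nsd_le A H (lam : R) : symf A -> symf H ->
  (forall xi, lam * (\sum_(i < n) xi i ^+ 2) <= qform A xi) ->
  (forall xi, qform H xi <= 0) ->
  \sum_(i < n) \sum_(j < n) A i j * H i j <= lam * \sum_(i < n) H i i.
Proof.
move=> sA sH A0 H0.
pose B i j := A i j - lam * (i == j)%:R.
have B0 xi : 0 <= qform B xi.
  rewrite (_ : qform B xi = qform A xi - lam * \sum_(i < n) xi i ^+ 2) ?subr_ge0//.
  rewrite mulr_sumr /qform -sumrB; apply: eq_bigr => i _.
  rewrite -(sum_pickl (fun j => lam * (xi i * xi j)) i) -sumrB.
  by apply: eq_bigr => j _; rewrite /B; ring.
have sN : symf (fun i j => - H i j) by move=> i j; rewrite sH.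
have N0 xi : 0 <= qform (fun i j => - H i j) xi.
  rewrite (_ : qform _ xi = - qform H xi) ?oppr_ge0// /qform -sumrN.
  by apply: eq_bigr => i _; rewrite -sumrN; apply: eq_bigr => j _; rewrite !mulNr.
have := sum_psd_mul_ge0 sN B0 N0.
rewrite (_ : \sum_(i < n) _ = lam * (\sum_(i < n) H i i) - \sum_(i < n) \sum_(j < n) A i j * H i j).
  by rewrite subr_ge0.
rewrite mulr_sumr -sumrB; apply: eq_bigr => i _.
rewrite -(sum_pickl (fun j => lam * H i j) i) -sumrB; apply: eq_bigr => j _.
by rewrite /B; ring.
Qed.

End QuadraticForms.

Lemma continuous_sum_at {R : realType} {n : nat} (I : finType) (F : I -> 'rV[R]_n -> R) (x : 'rV[R]_n) :
  (forall i, {for x, continuous (F i)}) -> {for x, continuous (fun y => \sum_i F i y)}.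
Proof.
move=> Fc; have := @cvg_big R I +%R 0 xpredT (@add_continuous _) _ (nbhs x) (index_enum I) F (F^~ x) (nbhs_filter x).
by apply => i _; exact: Fc.
Qed.

(** * Grid cells of a cube *)

Section Grid.
Context {R : realType} {n : nat}.
Implicit Types (N : nat).

(** The margin [m] is measured in units of the mesh [2 * rho / N]: [m = 0] is the closed cell of
    index [q], and [m = 1] enlarges it by one cell width on every side. *)
Definition cell (x0 : 'rV[R]_n) (rho : R) N (q : {ffun 'I_n -> 'I_N}) (m : R) : set 'rV[R]_n :=
  [set y | forall i, - m <= (y 0 i - (x0 0 i - rho)) / (2 * rho / N%:R) - (q i)%:R <= 1 + m].

Lemma grid_index N (t : R) : (0 < N)%N -> 0 <= t <= N%:R ->
  exists k : 'I_N, 0 <= t - k%:R <= 1.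
Proof.
case: N => // N _; elim: N => [|N IH] tN; first by exists ord0; rewrite subr0.
have [tN1|tN1] := leP t N.+1%:R.
  have [|k kt] := IH; first by rewrite tN1; case/andP: tN => ->.
  by exists (widen_ord (leqnSn _) k).
exists ord_max => /=; case/andP: tN => _; rewrite -[N.+2]addn1 natrD; lra.
Qed.

Lemma cell_cover (x0 : 'rV[R]_n) (rho : R) N : 0 < rho -> (0 < N)%N ->
  forall y, cube x0 rho y -> exists q : {ffun 'I_n -> 'I_N}, cell x0 rho q 0 y.
Proof.
move=> rho0 N0 y xy.
have N0' : 0 < N%:R :> R by rewrite ltr0n.
have h0 : 0 < 2 * rho / N%:R by rewrite divr_gt0// mulr_gt0.
have /choice[q qP] : forall i, exists k : 'I_N,
    0 <= (y 0 i - (x0 0 i - rho)) / (2 * rho / N%:R) - k%:R <= 1.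
  move=> i; apply: grid_index => //; have := xy i; rewrite ler_norml => yi.
  rewrite divr_ge0 ?(ltW h0)//=; last by lra.
  by rewrite ler_pdivrMr// mulrCA divff ?gt_eqF// mulr1; lra.
by exists [ffun i => q i] => i; rewrite ffunE oppr0 addr0.
Qed.

Lemma cell_dist (x0 : 'rV[R]_n) (rho : R) N (q : {ffun 'I_n -> 'I_N}) m (y z : 'rV[R]_n) : 0 < rho -> (0 < N)%N ->
  cell x0 rho q m y -> cell x0 rho q m z ->
  forall i, `|y 0 i - z 0 i| <= (1 + 2 * m) * (2 * rho / N%:R).
Proof.
move=> rho0 N0 qy qz i; have := qy i; have := qz i.
have h0 : 0 < 2 * rho / N%:R by rewrite divr_gt0 ?mulr_gt0// ltr0n.
set h := _ / N%:R in h0 *; rewrite -ler_pdivrMr//.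
have -> : `|y 0 i - z 0 i| / h = `|(y 0 i - z 0 i) / h| by rewrite normrM normfV (gtr0_norm h0).
rewrite !mulrBl ler_norml; lra.
Qed.

Lemma cell_widen (x0 : 'rV[R]_n) (rho : R) N (q : {ffun 'I_n -> 'I_N}) m (y z : 'rV[R]_n) : 0 < rho -> (0 < N)%N ->
  cell x0 rho q 0 y -> (forall i, `|z 0 i - y 0 i| <= m * (2 * rho / N%:R)) ->
  cell x0 rho q m z.
Proof.
move=> rho0 N0 qy yz i; have := qy i; have := yz i.
have h0 : 0 < 2 * rho / N%:R by rewrite divr_gt0 ?mulr_gt0// ltr0n.
set h := _ / N%:R in h0 *; rewrite -ler_pdivrMr//.
have -> : `|z 0 i - y 0 i| / h = `|(z 0 i - y 0 i) / h| by rewrite normrM normfV (gtr0_norm h0).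
rewrite !mulrBl ler_norml oppr0 addr0; lra.
Qed.

Lemma cell_between (x0 : 'rV[R]_n) (rho : R) N (q : {ffun 'I_n -> 'I_N}) m (x y z : 'rV[R]_n) : 0 < rho -> (0 < N)%N ->
  cell x0 rho q m x -> cell x0 rho q m y -> between x y z -> cell x0 rho q m z.
Proof.
move=> rho0 N0 qx qy /betweenP xyz i; have := qx i; have := qy i.
have h0 : 0 < (2 * rho / N%:R)^-1 by rewrite invr_gt0 divr_gt0 ?mulr_gt0// ltr0n.
set h := _^-1 in h0 *.
have mono (s t : R) : s <= t -> (s - (x0 0 i - rho)) * h <= (t - (x0 0 i - rho)) * h.
  by move=> st; rewrite ler_wpM2r ?(ltW h0)// lerD2r.
by have /orP[/andP[/mono ? /mono ?]|/andP[/mono ? /mono ?]] := xyz i; lra.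
Qed.

Lemma cube_compact (x0 : 'rV[R]_n) (rho : R) : compact (cube x0 rho).
Proof.
have := @rV_compact R n (fun i => [set` `[x0 0 i - rho, x0 0 i + rho]])
  (fun i => @segment_compact _ _ _).
congr compact; apply/seteqP; split => y H i; have := H i; rewrite /= in_itv/= ler_norml; lra.
Qed.

End Grid.

(* The set of slopes p of contact hyperplanes lying above the graph of w contains
   a full cube of side 2r, while on each grid cell that meets the contact set the
   gradient oscillates at most by the size of the Hessian times the mesh. *)
Lemma contact_slopes_cover {R : realType} {n : nat} (x0 : 'rV[R]_n) (rho rho' delta r : R)
    (N : nat) w w1 w2 (tau : {ffun 'I_n -> 'I_N} -> R) :
  (0 < n)%N -> 0 < rho -> rho < rho' -> (0 < N)%N -> C2on (cube x0 rho') w w1 w2 ->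
  (forall y, cube x0 rho y -> (exists i, `|y 0 i - x0 0 i| = rho) -> w y + delta <= w x0) ->
  0 <= r -> n%:R * (rho * r) < delta -> (forall q, 0 <= tau q) ->
  (forall q x, cell x0 rho q 0 x -> cube x0 rho x -> (forall i, `|w1 i x| <= r) ->
     (forall xi, qform (fun i j => w2 i j x) xi <= 0) ->
     forall y i j, cell x0 rho q 0 y -> cube x0 rho y -> `|w2 i j y| <= tau q) ->
  (2 * r) ^+ n <= \sum_q (2 * (n%:R * (tau q * (2 * rho / N%:R)))) ^+ n.
Proof.
move=> n0 rho0 rr' N0 W wbd r0 rdelta tau0 Htau.
have h0 : 0 < 2 * rho / N%:R by rewrite divr_gt0 ?mulr_gt0// ltr0n.
have sub : cube x0 rho `<=` cube x0 rho'.
  by move=> y xy i; rewrite (le_trans (xy i))// ltW.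
pose contact (q : {ffun 'I_n -> 'I_N}) x := [/\ cell x0 rho q 0 x, cube x0 rho x, forall i, `|w1 i x| <= r &
  forall xi, qform (fun i j => w2 i j x) xi <= 0].
(* One contact point per cell centres its cube of slopes. In a cell without contact points the
   default merely adds a cube to the cover. *)
pose c q := xget x0 [set x | contact q x].
apply: (@closed_cubes_cover R n _ (fun q i => w1 i (c q))
  (fun q => n%:R * (tau q * (2 * rho / N%:R))) (fun=> 0)) => //.
  by move=> q; rewrite !mulr_ge0// ltW.
move=> p pr.
pose lin (y : 'rV[R]_n) := \sum_(i < n) p i * (y 0 i - x0 0 i).
have [x] : exists2 x, x \in cube x0 rho &
    forall y, y \in cube x0 rho -> w y - lin y <= w x - lin x.
  apply: EVT_max_rV.
  - by exists x0 => i; rewrite subrr normr0 ltW.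
  - exact: cube_compact.
  - apply: continuous_in_subspaceT => y; rewrite inE => /sub xy.
    apply: (@continuousB _ _ _ w lin); first exact: C2_cont W _ xy.
    rewrite /lin; apply: (@continuous_sum_at R n _ (fun i y => p i * (y 0 i - x0 0 i))) => i.
    apply: continuousM; first exact: cst_continuous.
    by apply: continuousB; [exact: coord_continuous|exact: cst_continuous].
rewrite inE => xx xmax.
have linb y : cube x0 rho y -> `|lin y| <= n%:R * (rho * r).
  move=> xy; rewrite (le_trans (ler_norm_sum _ _ _))//.
  rewrite mulr_natl -[X in _ *+ X]card_ord -sumr_const; apply: ler_sum => i _.
  by rewrite normrM mulrC ler_pM//; have := pr i; rewrite subr0.
(* On the boundary [w] has dropped by [delta], more than an affine function with slopes at most [r]
   can make up, so the maximum of [w - lin] is interior. *)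
have xint i : `|x 0 i - x0 0 i| < rho.
  rewrite lt_neqAle xx andbT; apply/eqP => xi.
  have w1' : w x + delta <= w x0 by apply: wbd => //; exists i.
  have := xmax x0; rewrite inE => /(_ _).
  have -> : lin x0 = 0 by rewrite /lin big1// => j _; rewrite subrr mulr0.
  have /ler_normlP[] := linb _ xx; rewrite subr0 => l1 l2 /(_ _).
  by move=> H; have : w x0 <= w x - lin x; [apply: H => j; rewrite subrr normr0 ltW|lra].
pose d := \big[Num.min/rho]_i (rho - `|x 0 i - x0 0 i|).
have d0 : 0 < d by apply: lt_bigmin => // i _; rewrite subr_gt0.
have dcube y : cube x d y -> cube x0 rho y.
  move=> xy i; rewrite -(subrKA (x 0 i)) (le_trans (ler_normD _ _))//.
  rewrite -lerBrDr (le_trans (xy i))//; exact: bigmin_le.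
have [||xp xn] := @C2_max_conditions R n x d w w1 w2 p d0.
- by apply: C2on_sub W => y /dcube/sub.
- move=> y /dcube xy; have := xmax y; rewrite inE => /(_ xy).
  rewrite lerBlDr => /le_trans; apply; rewrite -addrA lerD2l /lin addrC -sumrB.
  by rewrite le_eqVlt; apply/orP; left; apply/eqP; apply: eq_bigr => i _; ring.
have [q qx] := cell_cover rho0 N0 xx.
have cx : contact q x.
  split => // [i|xi]; first by rewrite xp; have := pr i; rewrite subr0.
  have := xn (\row_i xi i); congr (_ <= 0).
  by apply: eq_bigr => i _; apply: eq_bigr => j _; rewrite !mxE.
have cq : contact q (c q) by rewrite /c; case: xgetP => [? -> //|/(_ x)].
have [qc xc cr cn] := cq.
exists q => i; rewrite -xp.
apply: (@lipschitz_axes R n (w1 i) (fun j => w2 i j)) => [z j btw|z j btw|j].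
- by apply: C2_derive2 W _ _ _ _; apply: sub; exact: between_cube btw.
- apply: (Htau q (c q)) => //; first exact: cell_between btw.
  exact: between_cube btw.
- by have := cell_dist rho0 N0 qx qc j; rewrite mulr0 addr0 mul1r.
Qed.

(** * Mollification *)

Section Bump.
Context {R : realType}.
Implicit Types (t u : R) (j k : nat) (g h : R -> R).

(** The family is closed under differentiation up to linear combinations: the derivative of [flat k]
    is [flat k.+2 - k%:R * flat k.+1], also at 0. Smoothness of the bump built from it follows. *)
Definition flat k t : R := if 0 < t then t^-1 ^+ k * expR (- t^-1) else 0.

Lemma flat_gt0E k t : 0 < t -> flat k t = t^-1 ^+ k * expR (- t^-1).
Proof. by rewrite /flat => ->. Qed.

Lemma flat_le0E k t : t <= 0 -> flat k t = 0.
Proof. by rewrite /flat ltNge => ->. Qed.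

Lemma expR_ge_pow k u : 0 <= u -> u ^+ k / k`!%:R <= expR u.
Proof.
case: k => [|k] u0.
  by rewrite expr0 fact0 divr1 -expR0 ler_expR.
by apply: le_trans (expR_ge1Dxn k u0); rewrite lerDr.
Qed.

Lemma pow_expRN_le k u : 0 <= u -> u ^+ k * expR (- u) <= k`!%:R.
Proof.
move=> u0; rewrite expRN ler_pdivrMr ?expR_gt0// mulrC -ler_pdivrMr ?ltr0n ?fact_gt0//.
exact: expR_ge_pow.
Qed.

Lemma flat_ge0 k t : 0 <= flat k t.
Proof.
by rewrite /flat; case: ifP => // t0; rewrite mulr_ge0 ?expR_ge0// exprn_ge0// invr_ge0 ltW.
Qed.

Lemma flat_le k t : flat k t <= k`!%:R.
Proof. by rewrite /flat; case: ifP => // t0; rewrite pow_expRN_le// invr_ge0 ltW. Qed.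

Lemma flat_le_lin k t : flat k.+1 t <= k.+2`!%:R * `|t|.
Proof.
rewrite /flat; case: ifP => t0; last by rewrite mulr_ge0.
rewrite gtr0_norm// -ler_pdivrMr// mulrAC -exprSr.
by rewrite pow_expRN_le// invr_ge0 ltW.
Qed.

Lemma is_derive_flat k t : is_derive t 1 (flat k) (flat k.+2 t - k%:R * flat k.+1 t).
Proof.
have [t0|t0|->] := ltgtP t 0.
- rewrite (flat_le0E k.+2 (ltW t0)) (flat_le0E k.+1 (ltW t0)) mulr0 subr0.
  apply: (@near_eq_is_derive R R R (cst 0)).
  near=> s; rewrite flat_le0E// ltW//.
  by near: s; exact: lt_nbhsl.
- rewrite (flat_gt0E k.+2 t0) (flat_gt0E k.+1 t0).
  pose G u := u ^+ k * expR (- u).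
  apply: (@near_eq_is_derive R R R (fun s => G s^-1)).
    by near=> s; rewrite flat_gt0E//; near: s; exact: lt_nbhsr.
  have D1 : is_derive t 1 (fun s : R => s^-1) (- t ^- 2).
    have := @is_deriveV R id t 1 1 (lt0r_neq0 t0) (is_derive_id _ _).
    by rewrite [_ *: 1]mulr1.
  have D2 u : is_derive u 1 G (k%:R * u ^+ k.-1 * expR (- u) - u ^+ k * expR (- u)).
    have E1 : is_derive u 1 (fun s : R => s ^+ k) (k%:R * u ^+ k.-1).
      have := @is_deriveX R R id k u 1 1 (is_derive_id _ _).
      by rewrite exprfctE [_ *: 1]mulr1.
    have E2 : is_derive u 1 (fun s : R => expR (- s)) (- expR (- u)).
      have := @is_derive1_comp R expR (fun s => - s) u _ _ (is_derive_expR _) (is_deriveNid _ _).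
      by rewrite mulrN1.
    apply: (is_derive_eq (is_deriveM E1 E2)).
    by rewrite [_ *: - _]mulrN [_ *: (_ * _)]mulrC addrC.
  have D := @is_derive1_comp R G (fun s : R => s^-1) t _ _ (D2 _) D1.
  apply: (is_derive_eq D); rewrite -exprVn !exprS; case: k => [|k] in G D2 D *.
    by rewrite !mul0r; ring.
  by rewrite /= exprS; ring.
- suff cv : (fun h : R => h^-1 *: ((flat k \o shift 0) (h *: 1) - flat k 0)) @ 0^' --> (0 : R).
    have f0 m : flat m 0 = 0 by rewrite /flat ltxx.
    rewrite !f0 mulr0 subr0.
    by apply: DeriveDef; [apply/cvg_ex; exists 0|exact/cvg_lim].
  apply/cvgrPdist_le => eps eps0; near=> h.
  have h0 : h != 0 by near: h; exact: nbhs_dnbhs_neq.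
  (* At 0 the difference quotient of [flat k] is [flat k.+1], which [flat_le_lin] bounds by a
     multiple of [|h|]. *)
  have -> : h^-1 *: ((flat k \o shift 0) (h *: 1) - flat k 0) = flat k.+1 h.
    rewrite /= addr0 [h *: 1]mulr1 /flat ltxx subr0; case: ifP => // _.
      by rewrite [LHS]mulrA exprS.
    exact: scaler0.
  rewrite sub0r normrN ger0_norm ?flat_ge0// (le_trans (flat_le_lin _ _))//.
  rewrite mulrC -ler_pdivlMr ?ltr0n ?fact_gt0//; near: h; apply/dnbhs0_le.
  by rewrite divr_gt0// ltr0n fact_gt0.
Unshelve. all: by end_near. Qed.

(** This linear span contains the bump and is stable under differentiation, so what is wanted of all
    derivatives at once, vanishing outside (-1, 1) and boundedness, is an induction on
    membership. *)
Inductive bump_alg : (R -> R) -> Prop :=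
| bump_alg_base j k : bump_alg (fun t => flat j (1 - t) * flat k (1 + t))
| bump_alg_add g h : bump_alg g -> bump_alg h -> bump_alg (fun t => g t + h t)
| bump_alg_scale c g : bump_alg g -> bump_alg (fun t => c * g t).

Lemma bump_alg_derive g : bump_alg g ->
  exists2 dg, bump_alg dg & forall t, is_derive t 1 g (dg t).
Proof.
elim=> {g} [j k|g h _ [dg bdg gd] _ [dh bdh hd]|c g _ [dg bdg gd]].
- pose B a b t : R := flat a (1 - t) * flat b (1 + t).
  exists (fun t => (- 1 * B j.+2 k t + j%:R * B j.+1 k t) + (B j k.+2 t + - k%:R * B j k.+1 t)).
    by do 2?apply: bump_alg_add; try apply: bump_alg_scale; exact: bump_alg_base.
  move=> t.
  have D1 : is_derive t 1 (fun s : R => flat j (1 - s)) ((flat j.+2 (1 - t) - j%:R * flat j.+1 (1 - t)) * - 1).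
    apply: (@is_derive1_comp R (flat j) (fun s => 1 - s)); first exact: is_derive_flat.
    by have := is_deriveB (is_derive_cst (1 : R) t 1) (is_derive_id t 1); rewrite sub0r.
  have D2 : is_derive t 1 (fun s : R => flat k (1 + s)) ((flat k.+2 (1 + t) - k%:R * flat k.+1 (1 + t)) * 1).
    apply: (@is_derive1_comp R (flat k) (fun s => 1 + s)); first exact: is_derive_flat.
    by have := is_deriveD (is_derive_cst (1 : R) t 1) (is_derive_id t 1); rewrite add0r.
  apply: (is_derive_eq (is_deriveM D1 D2)).
  rewrite /B [LHS](_ : _ = flat j (1 - t) * ((flat k.+2 (1 + t) - k%:R * flat k.+1 (1 + t)) * 1) +
    flat k (1 + t) * ((flat j.+2 (1 - t) - j%:R * flat j.+1 (1 - t)) * - 1)) //.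
  by ring.
- by exists (fun t => dg t + dh t) => [|t]; [exact: bump_alg_add|exact: is_deriveD].
- exists (fun t => c * dg t) => [|t]; [exact: bump_alg_scale|exact: is_deriveZ].
Qed.

Lemma bump_alg_eq0 g t : bump_alg g -> 1 <= `|t| -> g t = 0.
Proof.
move=> bg t1; elim: bg => {g} [j k|g h _ -> _ ->|c g _ ->]; rewrite ?addr0 ?mulr0//.
rewrite /flat; move: t1; rewrite ler_normr => /orP[t1|t1].
  by rewrite ifF ?mul0r//; apply/negbTE; lra.
by rewrite [X in _ * X]ifF ?mulr0//; apply/negbTE; lra.
Qed.

Lemma bump_alg_bounded g : bump_alg g -> exists2 M, 0 <= M & forall t, `|g t| <= M.
Proof.
elim=> {g} [j k|g h _ [M M0 gM] _ [N N0 hN]|c g _ [M M0 gM]].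
- exists (j`!%:R * k`!%:R); first by rewrite mulr_ge0.
  by move=> t; rewrite ger0_norm ?mulr_ge0 ?flat_ge0// ler_pM ?flat_ge0 ?flat_le.
- exists (M + N) => [|t]; first exact: addr_ge0.
  by rewrite (le_trans (ler_normD _ _))// lerD.
- exists (`|c| * M) => [|t]; first exact: mulr_ge0.
  by rewrite normrM ler_wpM2l.
Qed.

Definition psi k : R -> R := derive1n k (fun t => flat 0 (1 - t) * flat 0 (1 + t)).

Lemma bump_alg_psi k : bump_alg (psi k).
Proof.
elim: k => [|k IH]; first exact: bump_alg_base.
have [dg bdg gd] := bump_alg_derive IH.
rewrite /psi derive1nS -/(psi k) (_ : _^`()%classic = dg)//.
by apply/funext => t; rewrite derive1E; have [_ ->] := gd t.
Qed.

Lemma is_derive_psi k t : is_derive t 1 (psi k) (psi k.+1 t).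
Proof.
have [dg bdg gd] := bump_alg_derive (bump_alg_psi k).
rewrite /psi derive1nS -/(psi k) derive1E; have [D ->] := gd t; exact: gd.
Qed.

Lemma psi_continuous k : continuous (psi k).
Proof.
move=> t; have [D _] := is_derive_psi k t.
by apply: differentiable_continuous; exact/derivable1_diffP.
Qed.

Lemma psi_eq0 k t : 1 <= `|t| -> psi k t = 0.
Proof. exact: bump_alg_eq0 (bump_alg_psi k). Qed.

Lemma psi_bounded k : exists2 M, 0 <= M & forall t, `|psi k t| <= M.
Proof. exact: bump_alg_bounded (bump_alg_psi k). Qed.

Lemma psi0_ge0 t : 0 <= psi 0 t.
Proof. by rewrite /psi /= mulr_ge0 ?flat_ge0. Qed.

Lemma psi0_le1 t : psi 0 t <= 1.
Proof. by rewrite /psi /= mulr_ile1 ?flat_ge0// (le_trans (flat_le _ _)). Qed.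

(** Source of the factor [expR 4 ^+ n] in later estimates: it bounds the mass of the kernel from
    below. *)
Lemma psi0_ge t : `|t| <= 1 / 2 -> expR (- 4) <= psi 0 t.
Proof.
rewrite ler_norml => t2; rewrite /psi /=.
have H s : 1 / 2 <= s -> expR (- 2) <= flat 0 s.
  move=> s2; have s0 : 0 < s by lra.
  rewrite /flat s0 expr0 mul1r ler_expR lerN2 invf_ple ?posrE//.
  by lra.
rewrite (_ : - 4 = (- 2) + (- 2)); last by lra.
by rewrite expRD ler_pM ?expR_ge0//; apply: H; lra.
Qed.

End Bump.

Section BoundedFactor.
Context d {T : measurableType d} {R : realType} (mu : {measure set T -> \bar R}).
Implicit Types (B : set T) (f h : T -> R).

Lemma integrable_mul_bounded B f h (M : R) : measurable B ->
  mu.-integrable B (EFin \o f) -> measurable_fun B h ->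
  (forall y, B y -> `|h y| <= M) -> mu.-integrable B (EFin \o (fun y => f y * h y)).
Proof.
move=> mB fi mh hM.
have bh : [bounded h x | x in B].
  exists M; split; first exact: num_real.
  by move=> t Mt y By; apply: le_trans (ltW Mt); exact: hM.
exact: (integrableMl mB fi mh bh).
Qed.

Lemma Rintegral_mul_bounded_le B f h (M : R) : measurable B ->
  mu.-integrable B (EFin \o f) -> measurable_fun B h ->
  (forall y, B y -> `|h y| <= M) ->
  `|\int[mu]_(y in B) (f y * h y)| <= M * \int[mu]_(y in B) `|f y|.
Proof.
move=> mB fi mh hM; have fhi := integrable_mul_bounded mB fi mh hM.
apply: (le_trans (le_normr_Rintegral mB fhi)).
have nfi : mu.-integrable B (EFin \o (fun y => `|f y|)) by exact: integrable_norm.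
rewrite -RintegralZl//; apply: le_Rintegral => //.
- exact: integrable_norm.
- by have := integrableZl mB M nfi; apply: eq_integrable => // y _; rewrite /= EFinM.
- by move=> y By; rewrite normrM mulrC ler_wpM2r// hM.
Qed.

End BoundedFactor.

Section Kernel.
Context {R : realType} {n : nat}.
Local Notation e i := (delta_mx 0 i : 'rV[R]_n).
Implicit Types (m : 'I_n -> nat) (eps : R) (x y : 'rV[R]_n).

(** The multi-index [m] holds the order of differentiation in each variable. Powers of [eps] and the
    normalisation stay outside, so one family comprises the kernel and all its derivatives. *)
Definition kern m eps x y : R := \prod_(i < n) psi (m i) ((y 0 i - x 0 i) / eps).

Definition incr m (j : 'I_n) : 'I_n -> nat := fun i => (m i + (i == j))%N.

Lemma incrC m i j : incr (incr m i) j = incr (incr m j) i.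
Proof. by apply/funext => k; rewrite /incr addnAC. Qed.

Lemma kern_eq0 m eps x y : 0 < eps -> ~ cube x eps y -> kern m eps x y = 0.
Proof.
move=> eps0 /existsNP[i /negP]; rewrite -ltNge => xy.
rewrite /kern (bigD1 i)//= psi_eq0 ?mul0r// normrM normfV (gtr0_norm eps0).
by rewrite ler_pdivlMr// mul1r ltW.
Qed.

Lemma kern_bounded m : exists2 M, 0 <= M & forall eps x y, `|kern m eps x y| <= M.
Proof.
have /choice[M MP] : forall i, exists M, 0 <= M /\ forall t : R, `|psi (m i) t| <= M.
  by move=> i; have [M M0 MP] := @psi_bounded R (m i); exists M.
exists (\prod_i M i); first by apply: prodr_ge0 => i _; have [] := MP i.
by move=> eps x y; rewrite normr_prod; apply: ler_prod => i _; rewrite normr_ge0 (MP i).2.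
Qed.

Lemma continuous_prod_at (I : finType) (F : I -> 'rV[R]_n -> R) x :
  (forall i, {for x, continuous (F i)}) -> {for x, continuous (fun y => \prod_i F i y)}.
Proof.
move=> Fc; have := @cvg_big R I *%R 1 xpredT (@mul_continuous _) _ (nbhs x) (index_enum I) F (F^~ x) (nbhs_filter x).
by apply => i _; exact: Fc.
Qed.

Lemma kern_continuous m eps x : continuous (kern m eps x).
Proof.
move=> y; apply: (@continuous_prod_at _ (fun i y => psi (m i) ((y 0 i - x 0 i) / eps))) => i.
apply: (@continuous_comp _ _ _ (fun y : 'rV[R]_n => (y 0 i - x 0 i) / eps) (psi (m i))); last first.
  exact: psi_continuous.
apply: continuousM; last exact: cst_continuous.
by apply: continuousB; [exact: coord_continuous|exact: cst_continuous].
Qed.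

Lemma kern_line_y m eps x y j (t : R) :
  kern m eps x (y + t *: e j) =
  psi (m j) ((y 0 j + t - x 0 j) / eps) * \prod_(i < n | i != j) psi (m i) ((y 0 i - x 0 i) / eps).
Proof.
rewrite /kern (bigD1 j)//= !mxE !eqxx mulr1; congr (_ * _).
by apply: eq_bigr => i /negbTE ij; rewrite !mxE ij andbF mulr0 addr0.
Qed.

Lemma kern_line_x m eps x y j (t : R) :
  kern m eps (x + t *: e j) y =
  psi (m j) ((y 0 j - x 0 j - t) / eps) * \prod_(i < n | i != j) psi (m i) ((y 0 i - x 0 i) / eps).
Proof.
rewrite /kern (bigD1 j)//= !mxE !eqxx mulr1 opprD addrA; congr (_ * _).
by apply: eq_bigr => i /negbTE ij; rewrite !mxE ij andbF mulr0 addr0.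
Qed.

Lemma kern_incr m eps x y j :
  kern (incr m j) eps x y =
  psi (m j).+1 ((y 0 j - x 0 j) / eps) * \prod_(i < n | i != j) psi (m i) ((y 0 i - x 0 i) / eps).
Proof.
rewrite /kern (bigD1 j)//= /incr eqxx addn1; congr (_ * _).
by apply: eq_bigr => i /negbTE ij; rewrite ij addn0.
Qed.

Lemma is_derive_kern m eps x y j :
  is_derive y (e j) (kern m eps x) (eps^-1 * kern (incr m j) eps x y).
Proof.
apply: is_derive_line0.
set P := \prod_(i < n | i != j) psi (m i) ((y 0 i - x 0 i) / eps).
rewrite (_ : (fun s => _) = (fun s => P * psi (m j) ((y 0 j + s - x 0 j) / eps))); last first.
  by apply/funext => s; rewrite kern_line_y mulrC.
rewrite kern_incr -/P.
pose L (s : R) := (y 0 j + s - x 0 j) / eps.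
have DL : is_derive (0 : R) 1 L eps^-1.
  have D := is_deriveZ eps^-1 (is_deriveD (is_derive_cst (y 0 j - x 0 j) (0 : R) 1) (is_derive_id (0 : R) 1)).
  rewrite (_ : L = eps^-1 *: (cst (y 0 j - x 0 j) + id)).
    by apply: (is_derive_eq D); rewrite add0r [LHS]mulr1.
  by apply/funext => s; rewrite /L [LHS]mulrC addrAC.
have D := is_deriveZ P (@is_derive1_comp R (psi (m j)) L 0 _ _ (is_derive_psi _ _) DL).
apply: (is_derive_eq D).
by rewrite /L addr0 [LHS]mulrC mulrAC mulrC.
Qed.

Lemma pderiv_kern m eps x s :
  pderiv s (kern m eps x) =
  (fun y => eps^-1 ^+ size s * kern (fun i => m i + count_mem i s)%N eps x y).
Proof.
elim: s => [|i s IH].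
  apply/funext => y; rewrite expr0 mul1r; congr (kern _ _ _ _).
  by apply/funext => k; rewrite addn0.
apply/funext => y; rewrite /= -/(pderiv s _) IH.
have D := is_deriveZ (eps^-1 ^+ size s) (is_derive_kern (fun i => m i + count_mem i s)%N eps x y i).
have [_] := D; rewrite -[LHS]/('D_(delta_mx 0 i) _ y) => ->.
rewrite [LHS]mulrA exprSr; congr (_ * kern _ _ _ _).
by apply/funext => k; rewrite /incr/= eq_sym addnAC addnA.
Qed.

Lemma kern_test_function m eps x (Om : set 'rV[R]_n) : 0 < eps ->
  cube x eps `<=` Om -> test_function Om (kern m eps x).
Proof.
move=> eps0 xOm.
have ck : closed (cube x eps) by apply: compact_closed; [exact: norm_hausdorff|exact: cube_compact].
have sub : closure [set y | kern m eps x y != 0] `<=` cube x eps.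
  rewrite [X in _ `<=` X](closure_id _).1//; apply: closureS => y /= ky.
  by apply: contrapT => /(kern_eq0 m eps0) ky0; rewrite ky0 eqxx in ky.
split.
- move=> k; split.
    move=> s i y _ _; rewrite pderiv_kern.
    have D := is_deriveZ (eps^-1 ^+ size s) (is_derive_kern (fun i => m i + count_mem i s)%N eps x y i).
    by have [] := D.
  move=> s y _ _; rewrite pderiv_kern; apply: continuousM; first exact: cst_continuous.
  exact: kern_continuous.
- apply: subclosed_compact (@cube_compact _ _ x eps) sub; exact: closed_closure.
- exact: subset_trans xOm.
Qed.

Lemma psi_taylor k (a s M : R) : (forall t : R, `|psi k.+2 t| <= M) ->
  `|psi k (a + s) - psi k a - s * psi k.+1 a| <= M * s ^+ 2.
Proof.
move=> hM.
have DL j (b t : R) : is_derive t 1 (fun u => psi j (b + u)) (psi j.+1 (b + t)).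
  have D := @is_derive1_comp R (psi j) (fun u => b + u) t _ _ (is_derive_psi j (b + t))
    (is_deriveD (is_derive_cst b t 1) (is_derive_id t 1)).
  by apply: (is_derive_eq D); rewrite add0r mulr1.
have [s' s's E] := @MVT0 R (fun u => psi k (a + u)) (fun u => psi k.+1 (a + u)) s.
have [s'' s''s E'] := @MVT0 R (fun u => psi k.+1 (a + u)) (fun u => psi k.+2 (a + u)) s'.
move: E E'; rewrite !addr0 => E E'.
have s'le : `|s'| <= `|s|.
  move: s's; rewrite ler_norml.
  by case: (leP 0 s) => s0; [rewrite ger0_norm|rewrite ltr0_norm]; lra.
rewrite E [s * _]mulrC -mulrBl E' !normrM -mulrA.
apply: ler_pM; [exact: normr_ge0|by rewrite mulr_ge0|exact: hM|].
by rewrite -[leRHS]ger0_norm ?sqr_ge0// expr2 normrM ler_wpM2r.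
Qed.

(** The constant is uniform in [y]: integrating the estimate against an integrable function gives
    the derivative of the convolution with a quadratic remainder. *)
Lemma kern_taylor m eps j : 0 < eps -> exists2 C, 0 <= C & forall x y t,
  `|kern m eps (x + t *: e j) y - kern m eps x y - t * (- eps^-1 * kern (incr m j) eps x y)|
  <= C * t ^+ 2.
Proof.
move=> eps0.
have [M M0 hM] := @psi_bounded R (m j).+2.
have /choice[N NP] : forall i, exists N, 0 <= N /\ forall t : R, `|psi (m i) t| <= N.
  by move=> i; have [N N0 NP] := @psi_bounded R (m i); exists N.
have P0 : 0 <= \prod_(i < n | i != j) N i by apply: prodr_ge0 => i _; have [] := NP i.
exists (M * eps^-1 ^+ 2 * \prod_(i < n | i != j) N i).
  by apply: mulr_ge0 => //; apply: mulr_ge0 => //; exact: sqr_ge0.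
move=> x y t; rewrite kern_line_x kern_incr.
rewrite [kern m eps x y](_ : _ = psi (m j) ((y 0 j - x 0 j) / eps) *
   \prod_(i < n | i != j) psi (m i) ((y 0 i - x 0 i) / eps)); last by rewrite /kern (bigD1 j).
set P := \prod_(i < n | i != j) psi _ _; set a := (y 0 j - x 0 j) / eps.
rewrite (_ : _ - t * _ = (psi (m j) (a + (- (t / eps))) - psi (m j) a - (- (t / eps)) * psi (m j).+1 a) * P); last first.
  by rewrite (mulrBl _ _ t) /a; ring.
rewrite normrM (_ : M * _ * _ * _ = M * (- (t / eps)) ^+ 2 * \prod_(i < n | i != j) N i); last by ring.
apply: ler_pM => //; first exact: psi_taylor.
rewrite normr_prod; apply: ler_prod => i _.
by rewrite normr_ge0 (NP i).2.
Qed.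

Lemma is_derive_quadratic (g : 'rV[R]_n -> R) x (v : 'rV[R]_n) (d C : R) : 0 <= C ->
  (forall t, `|g (x + t *: v) - g x - t * d| <= C * t ^+ 2) -> is_derive x v g d.
Proof.
move=> C0 H.
suff cv : (fun h : R => h^-1 *: ((g \o shift x) (h *: v) - g x)) @ 0^' --> d.
  by apply: DeriveDef; [apply/cvg_ex; exists d|exact/cvg_lim].
apply/cvgrPdist_le => eps eps0; near=> h.
have h0 : h != 0 by near: h; exact: nbhs_dnbhs_neq.
have hp : 0 < `|h| by rewrite normr_gt0.
rewrite /= [h *: v + x]addrC -[_ *: _]/(_ * _) distrC.
rewrite -(ler_pM2l hp) -normrM mulrBr mulVKf//.
rewrite (le_trans (H h))// -[h ^+ 2]ger0_norm ?sqr_ge0// expr2 normrM mulrCA ler_wpM2l ?normr_ge0//.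
suff : `|h| <= eps / (C + 1).
  rewrite ler_pdivlMr ?ltr_wpDl// mulrDr mulr1 mulrC; have : 0 <= `|h| by [].
  lra.
near: h; apply/dnbhs0_le; rewrite divr_gt0//; lra.
Unshelve. all: by end_near. Qed.

End Kernel.

Section Convolution.
Context {R : realType} {n : nat}.
Hypothesis n0 : (0 < n)%N.
Local Notation e i := (delta_mx 0 i : 'rV[R]_n).
Local Notation mu := (@lebesgue_rV R n).
Variables (B : set (Rn R n)) (eps : R).
Hypotheses (mB : measurable B) (eps0 : 0 < eps).
Implicit Types (m : 'I_n -> nat) (f : 'rV[R]_n -> R) (x : 'rV[R]_n).

(** The integral runs over a set [B] on which [f] is integrable. At points whose [eps]-cube lies in
    [B] it is the usual convolution, up to the factor [mass eps]. *)
Definition kconv m f x : R := \int[mu]_(y in B) (f y * kern m eps x y).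

Lemma measurable_kern m x : measurable_fun B (kern m eps x : Rn R n -> R).
Proof.
apply: (@measurable_funS _ _ _ _ setT) => //.
by apply: continuous_measurable_rV => //; exact: kern_continuous.
Qed.

Lemma kconv_integrable m f x : mu.-integrable B (EFin \o f) ->
  mu.-integrable B (EFin \o (fun y => f y * kern m eps x y)).
Proof.
move=> fi; have [M M0 hM] := @kern_bounded R n m.
exact: (integrable_mul_bounded mB fi (measurable_kern m x) (fun y _ => hM eps x y)).
Qed.

Lemma kconv_bounded m f : mu.-integrable B (EFin \o f) ->
  exists2 M, 0 <= M & forall x, `|kconv m f x| <= M.
Proof.
move=> fi; have [M M0 hM] := @kern_bounded R n m.
exists (M * \int[mu]_(y in B) `|f y|); first by rewrite mulr_ge0// Rintegral_ge0.
move=> x; exact: (Rintegral_mul_bounded_le mB fi (measurable_kern m x) (fun y _ => hM eps x y)).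
Qed.

Lemma is_derive_kconv m f x j : mu.-integrable B (EFin \o f) ->
  is_derive x (e j) (kconv m f) (- eps^-1 * kconv (incr m j) f x).
Proof.
move=> fi; have [C C0 hC] := kern_taylor m j eps0.
apply: (@is_derive_quadratic _ _ _ _ _ _ (C * \int[mu]_(y in B) `|f y|)).
  by rewrite mulr_ge0// Rintegral_ge0.
move=> t; rewrite /kconv.
have i1 := kconv_integrable m (x + t *: e j) fi.
have i2 := kconv_integrable m x fi.
have i3 := kconv_integrable (incr m j) x fi.
rewrite mulrA -RintegralZl// -!RintegralB//; last 2 first.
- by have := integrableB mB i1 i2; exact.
- by have := integrableZl mB (t * - eps^-1) i3; exact.
pose h y := kern m eps (x + t *: e j) y - kern m eps x y - t * (- eps^-1 * kern (incr m j) eps x y).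
rewrite (@eq_Rintegral _ _ _ _ B (fun y => f y * h y)); last by move=> y _; rewrite /h; ring.
rewrite mulrAC.
apply: (Rintegral_mul_bounded_le mB fi).
  apply: measurable_funB; first by apply: measurable_funB; exact: measurable_kern.
  have m3 := measurable_funM (measurable_cst (- eps^-1)) (measurable_kern (incr m j) x).
  exact: (measurable_funM (measurable_cst t) m3).
by move=> y _; exact: hC.
Qed.

Lemma kconv_continuous m f : mu.-integrable B (EFin \o f) -> continuous (kconv m f).
Proof.
move=> fi x.
have /choice[M MP] : forall j, exists M, 0 <= M /\ forall x, `|kconv (incr m j) f x| <= M.
  by move=> j; have [M M0 MP] := kconv_bounded (incr m j) fi; exists M.
pose S := eps^-1 * \sum_j M j.
have S0 : 0 <= S by rewrite mulr_ge0 ?invr_ge0 ?(ltW eps0)// sumr_ge0// => j _; have [] := MP j.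
have lip (y : 'rV[R]_n) (d : R) : (forall i, `|y 0 i - x 0 i| <= d) -> `|kconv m f y - kconv m f x| <= n%:R * (S * d).
  move=> xy; apply: (@lipschitz_axes R n _ (fun j x => - eps^-1 * kconv (incr m j) f x)) => //.
    by move=> z i _; exact: is_derive_kconv.
  move=> z i _; rewrite normrM.
  have -> : `|- eps^-1| = eps^-1 by rewrite normrN gtr0_norm// invr_gt0.
  apply: ler_wpM2l; first by rewrite invr_ge0 ltW.
  rewrite (le_trans ((MP i).2 z))// (bigD1 i)//= lerDl sumr_ge0// => j _.
  by have [] := MP j.
apply/continuous_rVP => eta eta0.
have k0 : 0 < n%:R * S + 1 by rewrite ltr_wpDl// mulr_ge0.
exists (eta / 2 / (n%:R * S + 1)); first by rewrite !divr_gt0.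
move=> y /lip; set d := _ / (n%:R * S + 1) => /le_lt_trans; apply.
have d0 : 0 < d by rewrite !divr_gt0.
have : d * (n%:R * S + 1) = eta / 2 by rewrite /d divfK// gt_eqF.
rewrite mulrDr mulr1 mulrA [d * _]mulrC; lra.
Qed.

Lemma kconv_C2on m f : mu.-integrable B (EFin \o f) ->
  C2on setT (kconv m f) (fun i x => - eps^-1 * kconv (incr m i) f x)
    (fun i j x => eps^-1 ^+ 2 * kconv (incr (incr m i) j) f x).
Proof.
move=> fi; split.
- by move=> x _; exact: kconv_continuous.
- by move=> i x _; apply: continuousM; [exact: cst_continuous|exact: kconv_continuous].
- by move=> i j x _; apply: continuousM; [exact: cst_continuous|exact: kconv_continuous].
- by move=> i x _; exact: is_derive_kconv.
- move=> i j x _.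
  apply: (is_derive_eq (is_deriveZ (- eps^-1) (is_derive_kconv (incr m i) x j fi))).
  by rewrite [LHS]mulrA mulrNN -expr2.
- by move=> i j x _; rewrite incrC.
Qed.

End Convolution.

Lemma compact_cube_closed {R : realType} {n : nat} (x : 'rV[R]_n) (r : R) : closed (cube x r).
Proof. by apply: compact_closed; [exact: norm_hausdorff|exact: cube_compact]. Qed.

Section Mass.
Context {R : realType} {n : nat}.
Hypothesis n0 : (0 < n)%N.
Local Notation mu := (@lebesgue_rV R n).
Implicit Types (x y : 'rV[R]_n) (r eps : R).

Lemma measurable_cube x r : measurable (cube x r : set (Rn R n)).
Proof. by apply: closed_measurable_rV => //; exact: compact_cube_closed. Qed.

Lemma mu_cube_le x r : 0 <= r -> (mu (cube x r) <= ((4 * r + 2) ^+ n)%:E)%E.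
Proof.
move=> r0; pose p := (\row_i (x 0 i - (r + 1)), \row_i (x 0 i + r)) : 'rV[R]_n * 'rV[R]_n.
apply: (@le_trans _ _ (mu (box p))).
  apply: le_measure; rewrite ?inE; [exact: measurable_cube|exact: measurable_box|].
  by move=> y xy i; rewrite !mxE; have := xy i; rewrite ler_norml; lra.
rewrite mu_box// lee_fin /box_volume (eq_bigr (fun=> 2 * r + 1)).
  by rewrite prodr_const card_ord; apply: lerXn2r; rewrite ?nnegrE; lra.
by move=> i _; rewrite !mxE (max_idPr _); lra.
Qed.

Lemma mu_cube_lty x r : 0 <= r -> (mu (cube x r) < +oo)%E.
Proof. by move=> r0; apply: le_lt_trans (mu_cube_le x r0) _; exact: ltry. Qed.

Definition mass eps : R := fine (\int[mu]_y (kern (fun=> 0%N) eps 0 y)%:E).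

Lemma kern0_ge0 eps x y : 0 <= kern (fun=> 0%N) eps x y.
Proof. by apply: prodr_ge0 => i _; exact: psi0_ge0. Qed.

Lemma kern0_le1 eps x y : kern (fun=> 0%N) eps x y <= 1.
Proof.
rewrite [leRHS](_ : _ = \prod_(i < n) 1); last by rewrite big1.
by apply: ler_prod => i _; rewrite psi0_ge0 psi0_le1.
Qed.

Lemma measurable_kernT m eps x : measurable_fun [set: Rn R n] (kern m eps x).
Proof. by apply: continuous_measurable_rV => //; exact: kern_continuous. Qed.

Lemma integral_kern_shift eps x :
  (\int[mu]_y (kern (fun=> 0%N) eps x y)%:E = \int[mu]_y (kern (fun=> 0%N) eps 0 y)%:E)%E.
Proof.
have m0 : measurable_fun [set: Rn R n] (fun y => (kern (fun=> 0%N) eps (0 : 'rV[R]_n) y)%:E).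
  by apply/measurable_EFinP; exact: measurable_kernT.
rewrite -(integral_shift n0 (- x) m0); last by move=> y; rewrite lee_fin kern0_ge0.
apply: eq_integral => y _; congr (_%:E); apply: eq_bigr => i _.
by rewrite !mxE subr0.
Qed.

Lemma integral_supp (B C : set (Rn R n)) (h : 'rV[R]_n -> \bar R) :
  B `<=` C -> (forall y, ~ B y -> h y = 0%E) -> (\int[mu]_(y in C) h y = \int[mu]_(y in B) h y)%E.
Proof.
move=> BC hB; rewrite integral_mkcond [RHS]integral_mkcond; congr (integral _ _ _).
apply/funext => y; rewrite !patchE; case: ifPn => yC; case: ifPn => yB //.
  by rewrite hB// => By; rewrite (mem_set By) in yB.
by rewrite (mem_set (BC _ (set_mem yB))) in yC.
Qed.

Lemma Rintegral_supp (B C : set (Rn R n)) (h : 'rV[R]_n -> R) :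
  B `<=` C -> (forall y, ~ B y -> h y = 0) -> \int[mu]_(y in C) h y = \int[mu]_(y in B) h y.
Proof.
by move=> BC hB; rewrite /Rintegral (integral_supp BC)// => y /hB ->.
Qed.

Lemma mass_ge eps : 0 < eps -> expR (- 4) ^+ n * eps ^+ n <= mass eps.
Proof.
move=> eps0; set k := fun y : 'rV[R]_n => (kern (fun=> 0%N) eps 0 y)%:E.
have mk : measurable_fun [set: Rn R n] k by apply/measurable_EFinP; exact: measurable_kernT.
have fin : (\int[mu]_y k y < +oo)%E.
  rewrite (@integral_supp (cube 0 eps) setT) => [|//|y yn]; last by rewrite /k kern_eq0.
  apply: (@le_lt_trans _ _ (\int[mu]_(y in cube (0 : 'rV[R]_n) eps) (cst 1%E y))%E).
    apply: ge0_le_integral => //; first exact: measurable_cube.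
    - by move=> y _; rewrite lee_fin kern0_ge0.
    - exact: (measurable_funS measurableT (@subsetT _ _) mk).
    - by move=> y _; rewrite lee_fin kern0_le1.
  rewrite integral_cst ?mul1e; last exact: measurable_cube.
  by apply: mu_cube_lty; exact: ltW.
rewrite -lee_fin fineK ?ge0_fin_numE//; last by apply: integral_ge0 => y _; rewrite lee_fin kern0_ge0.
pose p := (\row_i (- (eps / 2)), \row_i (eps / 2)) : 'rV[R]_n * 'rV[R]_n.
have mp := @measurable_box R n n0 p.
apply: (@le_trans _ _ (\int[mu]_(y in box p) (cst (expR (- 4) ^+ n)%:E y))%E).
  rewrite integral_cst// [X in (_ * X)%E](_ : _ = (box_volume p)%:E); last exact: mu_box.
  rewrite -EFinM lee_fin ler_wpM2l ?exprn_ge0 ?expR_ge0// /box_volume (eq_bigr (fun=> eps)) ?prodr_const ?card_ord//.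
  by move=> i _; rewrite !mxE (max_idPr _); lra.
apply: (@le_trans _ _ (\int[mu]_(y in box p) k y)%E).
  apply: ge0_le_integral => //.
  - by move=> y _; rewrite lee_fin exprn_ge0// expR_ge0.
  - exact: (measurable_funS measurableT (@subsetT _ _) mk).
  - move=> y py; rewrite /k lee_fin -[X in _ ^+ X]card_ord -prodr_const.
    apply: ler_prod => i _; rewrite expR_ge0/= psi0_ge// mxE subr0 normrM normfV (gtr0_norm eps0).
    by rewrite ler_pdivrMr//; have := py i; rewrite !mxE ler_norml; lra.
apply: ge0_subset_integral => //.
by move=> y _; rewrite lee_fin kern0_ge0.
Qed.

Lemma mass_gt0 eps : 0 < eps -> 0 < mass eps.
Proof.
move=> eps0; apply: lt_le_trans (mass_ge eps0).
by rewrite mulr_gt0// exprn_gt0// expR_gt0.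
Qed.

Lemma Rintegral_kern eps x (B : set (Rn R n)) : 0 < eps -> cube x eps `<=` B ->
  \int[mu]_(y in B) kern (fun=> 0%N) eps x y = mass eps.
Proof.
move=> eps0 xB.
have k0 (y : Rn R n) : ~ B y -> kern (fun=> 0%N) eps x y = 0.
  by move=> yB; apply: kern_eq0 => // /xB.
have <- := Rintegral_supp (@subsetT _ B) k0.
by rewrite /Rintegral integral_kern_shift.
Qed.

(* Averages against the normalised kernel at scale eps deviate from a constant by at
   most a dimensional multiple of the mean deviation over a cube of size eps. *)
Lemma kconv_mean_dev (B C : set (Rn R n)) eps (h : 'rV[R]_n -> R) (c : R) x : 0 < eps ->
  measurable B -> measurable C -> (mu B < +oo)%E -> mu.-integrable B (EFin \o h) ->
  cube x eps `<=` C -> C `<=` B ->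
  `|kconv B eps (fun=> 0%N) h x / mass eps - c| <=
    (expR 4 ^+ n / eps ^+ n) * \int[mu]_(y in C) `|h y - c|.
Proof.
move=> eps0 mB mC finB hi xC CB.
have M0 := mass_gt0 eps0.
have ci : mu.-integrable B (EFin \o (cst c)).
  apply: measurable_bounded_integrable => //.
  by exists `|c|; split; [exact: num_real|move=> t ct y _ /=; rewrite ltW].
have hci : mu.-integrable B (EFin \o (fun y => h y - c)).
  by have := integrableB mB hi ci; exact.
have hciC : mu.-integrable C (EFin \o (fun y => h y - c)) by exact: integrableS hci.
have mk := @measurable_kern R n n0 C eps (fun=> 0%N) x.
have bk y : C y -> `|kern (fun=> 0%N) eps x y| <= 1.
  by move=> _; rewrite ger0_norm ?kern0_ge0// kern0_le1.
have E : kconv B eps (fun=> 0%N) h x - c * mass eps =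
    \int[mu]_(y in C) ((h y - c) * kern (fun=> 0%N) eps x y).
  rewrite -(Rintegral_supp CB); last first.
    by move=> y yC; rewrite kern_eq0 ?mulr0// => /xC.
  rewrite -(Rintegral_kern eps0 (subset_trans xC CB)) -RintegralZl//; last first.
    have := @kconv_integrable R n n0 B eps mB (fun=> 0%N) (cst 1) x.
    rewrite (_ : (fun y => cst 1 y * _) = kern (fun=> 0%N) eps x).
      apply; apply: measurable_bounded_integrable => //.
      by exists 1; split; [exact: num_real|move=> t ct y _ /=; rewrite normr1 ltW].
    by apply/funext => y; rewrite mul1r.
  rewrite /kconv -RintegralB//.
  - by apply: eq_Rintegral => y _; rewrite mulrBl.
  - exact: kconv_integrable.
  - exact: kconv_integrable.
have -> : kconv B eps (fun=> 0%N) h x / mass eps - c =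
    (kconv B eps (fun=> 0%N) h x - c * mass eps) / mass eps by field; rewrite gt_eqF.
rewrite E normrM normfV (gtr0_norm M0) mulrC.
have int0 : 0 <= \int[mu]_(y in C) `|h y - c| by exact: Rintegral_ge0.
have le1 := Rintegral_mul_bounded_le mC hciC mk bk.
rewrite mul1r in le1.
apply: (le_trans (ler_wpM2l _ le1)); first by rewrite invr_ge0 ltW.
apply: ler_wpM2r => //.
have -> : expR 4 ^+ n / eps ^+ n = (expR (- 4) ^+ n * eps ^+ n)^-1 :> R.
  by rewrite invfM expRN exprVn invrK.
by rewrite lef_pV2 ?posrE ?mass_ge// mulr_gt0 ?exprn_gt0 ?expR_gt0.
Qed.

End Mass.

Lemma C2onZ (R : realType) (n : nat) (U : set 'rV[R]_n) (c : R) f f1 f2 : C2on U f f1 f2 ->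
  C2on U (fun x => c * f x) (fun i x => c * f1 i x) (fun i j x => c * f2 i j x).
Proof.
move=> F; split.
- by move=> x Ux; apply: continuousM; [exact: cst_continuous|exact: C2_cont F _ Ux].
- by move=> i x Ux; apply: continuousM; [exact: cst_continuous|exact: C2_cont1 F _ _ Ux].
- by move=> i j x Ux; apply: continuousM; [exact: cst_continuous|exact: C2_cont2 F _ _ _ Ux].
- by move=> i x Ux; apply: is_deriveZ; exact: C2_derive1 F _ _ Ux.
- by move=> i j x Ux; apply: is_deriveZ; exact: C2_derive2 F _ _ _ Ux.
- by move=> i j x Ux; rewrite (C2_sym F).
Qed.

(** A W^{2,n}_loc function with its weak derivatives as data and integrability stated on cubes. The
    larger cube of size [r'] leaves room for an open set around the smaller one, since [W2loc]
    speaks of open subsets. *)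
Record weak2 (R : realType) (n : nat) (Om : set 'rV[R]_n) (f : 'rV[R]_n -> R)
    (g1 : 'I_n -> 'rV[R]_n -> R) (g2 : 'I_n -> 'I_n -> 'rV[R]_n -> R) : Prop := weak2_intro {
  weak2_cont : forall x, Om x -> {for x, continuous f};
  weak2_derive1 : forall i, is_weak_pderiv Om [:: i] f (g1 i);
  weak2_derive2 : forall i j, is_weak_pderiv Om [:: i; j] f (g2 i j);
  weak2_int1 : forall i x r r', 0 < r -> r < r' -> cube x r' `<=` Om ->
    (\int[@lebesgue_rV R n]_(y in cube x r) (`|g1 i y| ^+ n)%:E < +oo)%E;
  weak2_int2 : forall i j x r r', 0 < r -> r < r' -> cube x r' `<=` Om ->
    (\int[@lebesgue_rV R n]_(y in cube x r) (`|g2 i j y| ^+ n)%:E < +oo)%E }.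

Section Mollify.
Context {R : realType} {n : nat}.
Hypothesis n0 : (0 < n)%N.
Local Notation mu := (@lebesgue_rV R n).
Local Notation m0 := ((fun=> 0%N) : 'I_n -> nat).
Variables (Om : set 'rV[R]_n) (oOm : open Om).

Lemma measurable_fun_cube (f : 'rV[R]_n -> R) x r : measurable_fun (Om : set (Rn R n)) f ->
  cube x r `<=` Om -> measurable_fun (cube x r : set (Rn R n)) f.
Proof.
by move=> mf sub; exact: (measurable_funS (open_measurable_rV n0 oOm) sub mf).
Qed.

Lemma loc_integrable_cube (f : 'rV[R]_n -> R) x r : loc_integrable Om f ->
  cube x r `<=` Om -> mu.-integrable (cube x r) (EFin \o f).
Proof.
move=> [mf fi] sub; apply/integrableP; split.
  by apply/measurable_EFinP; exact: measurable_fun_cube.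
by apply: fi => //; exact: cube_compact.
Qed.

(** The kernel centred at [x] is an admissible test function. Its derivatives in [x] and in [y]
    differ by a sign, which cancels the sign in the definition of the weak derivative, so
    mollification commutes with differentiation. *)
Lemma weak_kconv (f v : 'rV[R]_n -> R) s x0 r eps x : 0 < eps ->
  is_weak_pderiv Om s f v -> cube x0 r `<=` Om -> cube x eps `<=` cube x0 r ->
  (- eps^-1) ^+ size s * kconv (cube x0 r) eps (fun k => count_mem k s) f x =
  kconv (cube x0 r) eps m0 v x.
Proof.
move=> eps0 [fi vi H] sub xB.
have fB := loc_integrable_cube fi sub; have vB := loc_integrable_cube vi sub.
have mB := @measurable_cube R n n0 x0 r.
have supp m (h : 'rV[R]_n -> R) (y : Rn R n) : ~ cube x0 r y -> h y * kern m eps x y = 0.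
  by move=> yB; rewrite kern_eq0 ?mulr0// => /xB.
have := H _ (kern_test_function m0 eps0 (subset_trans xB sub)).
rewrite pderiv_kern (Rintegral_supp sub); last first.
  by move=> y yB; rewrite mulrCA supp ?mulr0.
rewrite (Rintegral_supp sub); last by move=> y yB; exact: supp.
rewrite -/(kconv (cube x0 r) eps m0 v x).
rewrite (@eq_Rintegral _ _ _ mu _ (fun y => eps^-1 ^+ size s * (f y * kern (fun k => count_mem k s) eps x y))); last first.
  by move=> y _; rewrite mulrCA.
rewrite RintegralZl//; last exact: kconv_integrable.
rewrite -/(kconv _ _ _ f x) => E.
rewrite exprNn -mulrA E mulrA -exprMn mulrNN mulr1 expr1n mul1r.
by [].
Qed.

Lemma weak2_mollify f g1 g2 x0 r eps : weak2 Om f g1 g2 -> cube x0 r `<=` Om -> 0 < eps ->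
  exists F F1 F2, C2on setT F F1 F2 /\
    forall x, cube x eps `<=` cube x0 r ->
      [/\ F x = kconv (cube x0 r) eps m0 f x / @mass R n eps,
          forall i, F1 i x = kconv (cube x0 r) eps m0 (g1 i) x / @mass R n eps &
          forall i j, F2 i j x = kconv (cube x0 r) eps m0 (g2 i j) x / @mass R n eps].
Proof.
move=> W sub eps0; have mB := @measurable_cube R n n0 x0 r.
pose i0 : 'I_n := Ordinal n0.
have [fi _ _] := weak2_derive1 W i0.
have fB := loc_integrable_cube fi sub.
have C := C2onZ (@mass R n eps)^-1 (kconv_C2on n0 mB eps0 m0 fB).
exists (fun x => (@mass R n eps)^-1 * kconv (cube x0 r) eps m0 f x).
eexists; eexists; split; first exact: C.
move=> x xB; split.
- by rewrite mulrC.
- move=> i; rewrite mulrC; congr (_ / _).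
  have E : (fun k => count_mem k [:: i]) = incr m0 i.
    by apply/funext => k; rewrite /incr/= add0n addn0 eq_sym.
  have H := weak_kconv eps0 (weak2_derive1 W i) sub xB.
  by rewrite E expr1 in H.
- move=> i j; rewrite mulrC; congr (_ / _).
  have E : (fun k => count_mem k [:: i; j]) = incr (incr m0 i) j.
    by apply/funext => k; rewrite /incr/= add0n addn0 ![_ == k]eq_sym.
  have H := weak_kconv eps0 (weak2_derive2 W i j) sub xB.
  by rewrite E sqrrN in H.
Qed.

End Mollify.

(** * Density of continuous functions *)

Lemma exprD_le (R : realType) (p : nat) (a b : R) :
  `|a + b| ^+ p <= 2 ^+ p * (`|a| ^+ p + `|b| ^+ p).
Proof.
wlog ab : a b / `|a| <= `|b|.
  move=> H; have [/H//|/ltW/H] := leP `|a| `|b|.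
  by rewrite addrC [X in _ * X]addrC.
apply: (@le_trans _ _ ((2 * `|b|) ^+ p)).
  apply: lerXn2r; rewrite ?nnegrE ?mulr_ge0//.
  by rewrite (le_trans (ler_normD _ _))// mulr_natl mulr2n lerD2r.
by rewrite exprMn ler_wpM2l ?exprn_ge0// lerDr exprn_ge0.
Qed.

Section LpApproximation.
Import HBNNSimple.
Context d {T : measurableType d} {R : realType} (mu : {measure set T -> \bar R}).
Variables (B : set T) (p : nat).
Hypotheses (mB : measurable B) (p0 : (0 < p)%N).
Implicit Types (f g h : T -> R).
Local Open Scope ereal_scope.

(** The p-th root is not taken. The triangle inequality is replaced by [pintD] with its factor
    [2 ^+ p], whence the tolerances [del / (2 * c2)] below. *)
Definition pint g : \bar R := \int[mu]_(x in B) (`|g x| ^+ p)%:E.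

Lemma measurable_pow g : measurable_fun B g -> measurable_fun B (fun x => (`|g x| ^+ p)%:E).
Proof.
move=> mg; apply/measurable_EFinP; apply: measurable_funX.
by apply: measurableT_comp mg; exact: normr_measurable.
Qed.

Lemma pint_le g h : measurable_fun B g -> measurable_fun B h ->
  (forall x, B x -> (`|g x| <= `|h x|)%R) -> pint g <= pint h.
Proof.
move=> mg mh gh; apply: ge0_le_integral; first exact: mB.
- by move=> x _; rewrite lee_fin exprn_ge0.
- exact: measurable_pow.
- exact: measurable_pow.
- by move=> x Bx; rewrite lee_fin; apply: lerXn2r; rewrite ?nnegrE//; exact: gh.
Qed.

Lemma pintD g h : measurable_fun B g -> measurable_fun B h ->
  pint (fun x => g x + h x)%R <= (2 ^+ p)%:E * (pint g + pint h).
Proof.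
move=> mg mh; rewrite /pint -ge0_integralD; last 5 first.
- exact: mB.
- by move=> x _; rewrite lee_fin exprn_ge0.
- exact: measurable_pow.
- by move=> x _; rewrite lee_fin exprn_ge0.
- exact: measurable_pow.
rewrite -ge0_integralZl_EFin; last 4 first.
- exact: mB.
- by move=> x _; rewrite -EFinD lee_fin addr_ge0// exprn_ge0.
- by apply: emeasurable_funD; exact: measurable_pow.
- exact: exprn_ge0.
apply: ge0_le_integral; first exact: mB.
- by move=> x _; rewrite lee_fin exprn_ge0.
- by apply: measurable_pow; exact: measurable_funD.
- apply: emeasurable_funM => //; apply: emeasurable_funD; exact: measurable_pow.
- by move=> x _; rewrite -EFinD -EFinM lee_fin exprD_le.
Qed.

Variable K : set (T -> R).
Hypotheses (mK : forall g, K g -> measurable_fun B g) (K0 : K (cst 0%R))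
  (KD : forall g h, K g -> K h -> K (fun x => g x + h x)%R)
  (KZ : forall c g, K g -> K (fun x => c * g x)%R)
  (Kmax : forall g h, K g -> K h -> K (fun x => Num.max (g x) (h x))).

(** Approximability by a class [K] passes to limits, linear combinations and maxima, so it holds for
    all functions with finite [pint] once it holds for indicators: simple functions and dominated
    convergence do the rest. *)
Definition papprox g := measurable_fun B g /\
  forall del : R, (0 < del)%R -> exists2 k, K k & pint (fun x => g x - k x)%R <= del%:E.

Let c2 : R := (2 ^+ p)%R.
Let c20 : (0 < c2)%R. Proof. by rewrite exprn_gt0. Qed.

Lemma papprox_lim g : measurable_fun B g ->
  (forall del : R, (0 < del)%R -> exists2 h, papprox h & pint (fun x => g x - h x)%R <= del%:E) ->
  papprox g.
Proof.
move=> mg H; split => // del del0.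
have d0 : (0 < del / (2 * c2))%R by rewrite divr_gt0// mulr_gt0.
have [h [mh ah] gh] := H _ d0; have [k Kk hk] := ah _ d0; exists k => //.
rewrite (_ : (fun x => _) = (fun x => (g x - h x) + (h x - k x))%R); last first.
  by apply/funext => x; rewrite subrKA.
apply: (le_trans (pintD _ _)).
- exact: measurable_funB.
- by apply: measurable_funB => //; exact: mK.
apply: (@le_trans _ _ (c2%:E * ((del / (2 * c2))%:E + (del / (2 * c2))%:E))).
  by apply: lee_wpmul2l; [rewrite lee_fin ltW|exact: leeD].
by rewrite -EFinD -EFinM lee_fin le_eqVlt; apply/orP; left; apply/eqP; field; rewrite gt_eqF.
Qed.

Lemma papproxD g h : papprox g -> papprox h -> papprox (fun x => g x + h x)%R.
Proof.
move=> [mg ag] [mh ah]; split; first exact: measurable_funD.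
move=> del del0.
have d0 : (0 < del / (2 * c2))%R by rewrite divr_gt0// mulr_gt0.
have [k Kk gk] := ag _ d0; have [l Kl hl] := ah _ d0.
exists (fun x => k x + l x)%R; first exact: KD.
rewrite (_ : (fun x => _) = (fun x => (g x - k x) + (h x - l x))%R); last first.
  by apply/funext => x; rewrite opprD addrACA.
apply: (le_trans (pintD _ _)).
- by apply: measurable_funB => //; exact: mK.
- by apply: measurable_funB => //; exact: mK.
apply: (@le_trans _ _ (c2%:E * ((del / (2 * c2))%:E + (del / (2 * c2))%:E))).
  by apply: lee_wpmul2l; [rewrite lee_fin ltW|exact: leeD].
by rewrite -EFinD -EFinM lee_fin le_eqVlt; apply/orP; left; apply/eqP; field; rewrite gt_eqF.
Qed.

Lemma pintZ c g : measurable_fun B g -> pint (fun x => c * g x)%R = (`|c| ^+ p)%:E * pint g.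
Proof.
move=> mg; rewrite /pint -ge0_integralZl_EFin; [|exact: mB|..].
- by apply: eq_integral => x _; rewrite normrM exprMn EFinM.
- by move=> x _; rewrite lee_fin exprn_ge0.
- exact: measurable_pow.
- exact: exprn_ge0.
Qed.

Lemma papproxZ c g : papprox g -> papprox (fun x => c * g x)%R.
Proof.
move=> [mg ag]; split; first exact: measurable_funM.
move=> del del0.
have c0 : (0 < `|c| ^+ p + 1)%R by rewrite ltr_wpDl// exprn_ge0.
have [k Kk gk] := ag _ (divr_gt0 del0 c0); exists (fun x => c * k x)%R; first exact: KZ.
rewrite (_ : (fun x => _) = (fun x => c * (g x - k x))%R); last first.
  by apply/funext => x; rewrite mulrBr.
rewrite pintZ; last by apply: measurable_funB => //; exact: mK.
apply: (@le_trans _ _ ((`|c| ^+ p)%:E * (del / (`|c| ^+ p + 1))%:E)).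
  by apply: lee_wpmul2l => //; rewrite lee_fin exprn_ge0.
rewrite -EFinM lee_fin mulrA ler_pdivrMr// mulrC ler_wpM2l ?ltW//.
by rewrite ltrDl.
Qed.

Lemma papprox_sum (I : Type) (r : seq I) (F : I -> T -> R) :
  (forall i, papprox (F i)) -> papprox (fun x => \sum_(i <- r) F i x)%R.
Proof.
move=> aF; elim: r => [|i r IH].
  rewrite (_ : (fun x => _) = cst 0%R); last by apply/funext => x; rewrite big_nil.
  split => // del del0; exists (cst 0%R) => //.
  rewrite /pint integral0_eq ?lee_fin ?ltW// => x _.
  by rewrite subrr normr0 expr0n gtn_eqF.
rewrite (_ : (fun x => _) = (fun x => F i x + \sum_(j <- r) F j x)%R); last first.
  by apply/funext => x; rewrite big_cons.
exact: papproxD.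
Qed.

Lemma papprox_max g h : papprox g -> papprox h -> papprox (fun x => Num.max (g x) (h x)).
Proof.
move=> [mg ag] [mh ah]; split; first exact: measurable_maxr.
move=> del del0.
have d0 : (0 < del / (2 * c2))%R by rewrite divr_gt0// mulr_gt0.
have [k Kk gk] := ag _ d0; have [l Kl hl] := ah _ d0.
exists (fun x => Num.max (k x) (l x)); first exact: Kmax.
have mgk : measurable_fun B (fun x => g x - k x)%R by apply: measurable_funB => //; exact: mK.
have mhl : measurable_fun B (fun x => h x - l x)%R by apply: measurable_funB => //; exact: mK.
have mngk : measurable_fun B (fun x => `|g x - k x|)%R by apply: measurableT_comp mgk; exact: normr_measurable.
have mnhl : measurable_fun B (fun x => `|h x - l x|)%R by apply: measurableT_comp mhl; exact: normr_measurable.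
apply: (@le_trans _ _ (pint (fun x => `|g x - k x| + `|h x - l x|)%R)).
  apply: pint_le.
  - by apply: measurable_funB; apply: measurable_maxr => //; exact: mK.
  - exact: measurable_funD.
  - move=> x _; rewrite [X in (_ <= X)%R]ger0_norm ?addr_ge0//.
    have : (forall a b c z : R, `|Num.max a b - Num.max c z| <= `|a - c| + `|b - z|)%R.
      move=> a b c z; have := ler_norm (a - c); have := ler_norm (- (a - c)).
      have := ler_norm (b - z); have := ler_norm (- (b - z)); rewrite !normrN ler_norml.
      by case: (lerP a b) => ab; case: (lerP c z) => cz; lra.
    exact.
apply: (le_trans (pintD _ _)) => //.
apply: (@le_trans _ _ (c2%:E * ((del / (2 * c2))%:E + (del / (2 * c2))%:E))).
  apply: lee_wpmul2l; first by rewrite lee_fin ltW.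
  by apply: leeD; rewrite /pint; under eq_integral do rewrite normr_id.
by rewrite -EFinD -EFinM lee_fin le_eqVlt; apply/orP; left; apply/eqP; field; rewrite gt_eqF.
Qed.

Hypothesis aE : forall E, measurable E -> papprox (\1_E).

Lemma papprox_ge0 g : (forall x, (0 <= g x)%R) -> measurable_fun B g -> pint g < +oo -> papprox g.
Proof.
move=> g0 mg gfin; apply: papprox_lim => // del del0.
have meg : measurable_fun B (EFin \o g) by exact/measurable_EFinP.
pose s := nnsfun_approx mB meg.
have s_g x : B x -> (fun k => (s k x)%:E) @ \oo --> (g x)%:E.
  by move=> Bx; apply: cvg_nnsfun_approx => // y _; rewrite lee_fin.
have s_gR x : B x -> (fun k => s k x) @ \oo --> g x by move=> /s_g/fine_cvgP[_]; exact.
have sle k x : B x -> (s k x <= g x)%R.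
  move=> Bx; have nd : nondecreasing_seq (fun k => s k x).
    by move=> i j ij; exact/lefP/nd_nnsfun_approx.
  have /cvg_lim <- // := s_gR x Bx.
  by apply: nondecreasing_cvgn_le => //; apply/cvg_ex; exists (g x); exact: s_gR.
have as_ k : papprox (s k).
  have -> : (s k : T -> R) = (fun x => \sum_(y <- finmap.enum_fset (fset_set (range (s k))))
     (y * \1_(s k @^-1` [set y]) x))%R.
    by apply/funext => x; rewrite fimfunE fsbig_finite.
  apply: papprox_sum => i; apply: papproxZ; apply: aE.
  exact: measurable_funPTI.
have ms k : measurable_fun B (s k) by have [] := as_ k.
pose F k x := (`|g x - s k x| ^+ p)%:E.
have mF k : measurable_fun B (F k) by exact: measurable_pow (measurable_funB mg (ms k)).
have F0 : {ae mu, forall x, B x -> F ^~ x @ \oo --> (cst 0 x : \bar R)}.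
  apply: aeW => x Bx; rewrite -[cst 0 x]/(0%R%:E); apply: cvg_EFin; first by near=> k.
  rewrite (_ : _ \o _ = (fun k => `|g x - s k x| ^+ p)%R)//.
  have c1 : (fun k => `|g x - s k x|)%R @ \oo --> `|g x - g x|%R.
    by apply: cvg_norm; apply: cvgB; [exact: cvg_cst|exact: s_gR].
  have c3 : (fun k => `|g x - s k x| ^+ p)%R @ \oo --> (`|g x - g x| ^+ p)%R.
    exact: (@continuous_cvg _ _ _ _ _ _ (fun y : R => y ^+ p)%R _ (@exprn_continuous R p _) c1).
  by move: c3; rewrite subrr normr0 expr0n gtn_eqF.
have ig : mu.-integrable B (fun x => (`|g x| ^+ p)%:E).
  apply/integrableP; split; first exact: measurable_pow.
  rewrite (eq_integral (fun x => (`|g x| ^+ p)%:E)) => [|x _]; first exact: gfin.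
  by rewrite gee0_abs// lee_fin exprn_ge0.
have dom : {ae mu, forall x k, B x -> `|F k x| <= (`|g x| ^+ p)%:E}.
  apply: aeW => x k Bx; rewrite gee0_abs ?lee_fin ?exprn_ge0//.
  apply: lerXn2r; rewrite ?nnegrE//.
  rewrite (ger0_norm (g0 x)) ler_norml; have := sle k x Bx; have : (0 <= s k x)%R by [].
  by have := g0 x; lra.
have [_ _] := dominated_convergence mB mF (measurable_cst 0) F0 ig dom.
rewrite integral0 => cv.
have /= [k _ Hk] : \forall k \near \oo, [sequence \int[mu]_(x in B) F k x]_k k < del%:E.
  apply: (cv [set y | y < del%:E]); apply: open_nbhs_nbhs; split; last by rewrite /= lte_fin.
  exact: open_ereal_lt_ereal.
exists (s k) => //; apply: ltW; exact: (Hk k (leqnn k)).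
Unshelve. all: by end_near. Qed.

Lemma papprox_all g : measurable_fun B g -> pint g < +oo -> papprox g.
Proof.
move=> mg gfin.
rewrite (_ : g = (fun x => Num.max (g x) 0 + -1 * Num.max (- g x) 0)%R); last first.
  by apply/funext => x; case: (lerP (g x) 0) => h1; case: (lerP (- g x) 0) => h2; lra.
have mp : measurable_fun B (fun x => Num.max (g x) 0)%R.
  by apply: measurable_maxr => //; exact: measurable_cst.
have mn : measurable_fun B (fun x => Num.max (- g x) 0)%R.
  by apply: measurable_maxr; [exact: measurable_funN|exact: measurable_cst].
have H (c : R) : (`|Num.max c 0| <= `|c|)%R.
  by rewrite ger0_norm ?le_max ?lexx ?orbT// ge_max normr_ge0 ler_norm.
apply: papproxD; last apply: papproxZ; apply: papprox_ge0 => //.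
- by move=> x; rewrite le_max lexx orbT.
- by apply: le_lt_trans gfin; apply: pint_le => // x _; exact: H.
- by move=> x; rewrite le_max lexx orbT.
- apply: le_lt_trans gfin; apply: pint_le => // x _.
  by rewrite -[X in (_ <= X)%R]normrN; exact: H.
Qed.

End LpApproximation.

Section ContinuousDense.
Context {R : realType} {n : nat}.
Hypothesis n0 : (0 < n)%N.
Local Notation mu := (@lebesgue_rV R n).
Variables (x0 : 'rV[R]_n) (r : R).
Hypothesis r0 : 0 <= r.
Local Notation B := (cube x0 r : set (Rn R n)).
Local Notation K := [set g : Rn R n -> R | continuous (g : 'rV[R]_n -> R)].
Local Notation papx := (papprox mu B n K).

Let mB : measurable B. Proof. exact: measurable_cube. Qed.
Let mK g : K g -> measurable_fun B g.
Proof.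
move=> cg; apply: (@measurable_funS _ _ _ _ setT) => //.
exact: continuous_measurable_rV.
Qed.
Let K0 : K (cst 0). Proof. by move=> x; exact: cst_continuous. Qed.
Let KD g h : K g -> K h -> K (fun x => g x + h x).
Proof. by move=> cg ch x; apply: continuousD; [exact: cg|exact: ch]. Qed.
Let KZ c g : K g -> K (fun x => c * g x).
Proof. by move=> cg x; apply: continuousM; [exact: cst_continuous|exact: cg]. Qed.
Let Kmax g h : K g -> K h -> K (fun x => Num.max (g x) (h x)).
Proof.
move=> cg ch.
rewrite (_ : (fun x => _) = (fun x => 2^-1 * (g x + h x + `|g x - h x|))); last first.
  by apply/funext => y; rewrite maxr_absE mulrC.
apply: KZ; apply: KD; first exact: KD.
move=> x; apply: (@continuous_comp _ _ _ (fun x => g x - h x) (@Num.norm _ R)); last exact: norm_continuous.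
by apply: continuousB; [exact: cg|exact: ch].
Qed.

Lemma pint_indic_le (f : 'rV[R]_n -> R) (S : set (Rn R n)) : measurable_fun B f ->
  measurable S -> (forall x, cube x0 r x -> `|f x| <= \1_S x) ->
  (pint mu B n f <= mu S)%E.
Proof.
move=> mf mS fS; have m1 : measurable_fun B (\1_S : _ -> R) by exact: measurable_indic.
apply: (@le_trans _ _ (pint mu B n (\1_S))).
  by apply: pint_le => // x Bx; rewrite [X in _ <= X]ger0_norm ?indicE//; have := fS x Bx; rewrite indicE.
rewrite /pint (eq_integral (fun x => (\1_S x : R)%:E)); last first.
  by move=> x _; rewrite indicE; case: (x \in S); rewrite ?normr1 ?normr0 ?expr1n ?expr0n ?gtn_eqF.
by rewrite integral_indic//; apply: measureIl.
Qed.

Lemma box_volume_enlarge (p : 'rV[R]_n * 'rV[R]_n) (del : R) : 0 < del ->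
  exists2 s, 0 < s &
    box_volume (p.1 - const_mx s, p.2 + const_mx s) <= box_volume p + del.
Proof.
move=> del0; pose c i := p.2 0 i - p.1 0 i.
pose V (s : R) : R := \prod_(i < n) Num.max 0 (c i + 2 * s).
have cV : V s @[s --> 0] --> V 0.
  apply: (@cvg_big R _ *%R 1 xpredT (@mul_continuous _) _ (nbhs (0 : R)) (index_enum _) (fun i s => Num.max 0 (c i + 2 * s)) (fun i => Num.max 0 (c i + 2 * 0))) => i _.
  rewrite maxr_absE; under eq_fun do rewrite maxr_absE.
  have c1 : c i + 2 * s @[s --> (0 : R)] --> c i + 2 * 0.
    by apply: cvgD; [exact: cvg_cst|apply: cvgM; [exact: cvg_cst|exact: cvg_id]].
  apply: cvgM; last exact: cvg_cst.
  apply: cvgD; first by apply: cvgD; [exact: cvg_cst|exact: c1].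
  by apply: cvg_norm; apply: cvgB; [exact: cvg_cst|exact: c1].
have V0 : V 0 = box_volume p by apply: eq_bigr => i _; rewrite mulr0 addr0.
have /cvgrPdist_lt/(_ _ del0) := cV.
move=> [/= d d0 Hd]; exists (d / 2); first by rewrite divr_gt0.
have /Hd : ball (0 : R) d (d / 2) by rewrite /ball/= sub0r normrN gtr0_norm; lra.
rewrite V0 ltr_norml => /andP[+ _].
rewrite (_ : box_volume (_, _) = V (d / 2)); first by lra.
by apply: eq_bigr => i _; rewrite !mxE /c; congr Num.max; lra.
Qed.

Lemma papprox_box (p : 'rV[R]_n * 'rV[R]_n) : papx (\1_(box p)).
Proof.
have mp := @measurable_box R n n0 p.
have m1 : measurable_fun B (\1_(box p) : _ -> R) by exact: measurable_indic.
split=> // del del0.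
have [s s0 vs] := box_volume_enlarge p del0.
pose q := (p.1 - const_mx s, p.2 + const_mx s).
have mq := @measurable_box R n n0 q.
have pq : box p `<=` box q.
  by move=> x px i; have := px i; rewrite !mxE; lra.
(* [D] measures how far [x] lies outside the box; [g] is 1 on the box and 0 off the enlarged box
   [q], so the error lives on the shell between them, of volume at most [del]. *)
pose D (x : 'rV[R]_n) := \sum_(i < n) (Num.max (p.1 0 i - x 0 i) 0 + Num.max (x 0 i - p.2 0 i) 0).
pose g (x : 'rV[R]_n) := Num.max (1 + - s^-1 * D x) 0.
have cD : continuous D.
  move=> x; apply: continuous_sum_at => i.
  have cc : continuous (fun x : 'rV[R]_n => x 0 i) by exact: coord_continuous.
  have c1 : K (fun x => p.1 0 i - x 0 i) by move=> y; apply: continuousB; [exact: cst_continuous|exact: cc].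
  have c2 : K (fun x => x 0 i - p.2 0 i) by move=> y; apply: continuousB; [exact: cc|exact: cst_continuous].
  exact: (KD (Kmax c1 K0) (Kmax c2 K0)).
have cg : K g.
  apply: Kmax K0; apply: KD; first by move=> y; exact: cst_continuous.
  exact: KZ.
exists g => //.
have term0 (x : 'rV[R]_n) i : 0 <= Num.max (p.1 0 i - x 0 i) 0 + Num.max (x 0 i - p.2 0 i) 0.
  by rewrite addr_ge0// le_max lexx orbT.
have Dge0 x : 0 <= D x by apply: sumr_ge0.
have Dp x : box p x -> D x = 0.
  move=> px; rewrite /D big1// => i _; have /andP[p1 p2] := px i.
  by rewrite !max_r ?addr0//; lra.
have Dq x : ~ box q x -> s <= D x.
  move=> /existsNP[i /negP]; rewrite negb_and -leNgt -ltNge !mxE => qx.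
  rewrite /D (bigD1 i)//=; apply: (@le_trans _ _ (Num.max (p.1 0 i - x 0 i) 0 + Num.max (x 0 i - p.2 0 i) 0)).
    case/orP: qx => h.
      by apply: (@le_trans _ _ (Num.max (p.1 0 i - x 0 i) 0)); rewrite ?lerDl ?le_max ?lexx ?orbT//; apply/orP; left; lra.
    by apply: (@le_trans _ _ (Num.max (x 0 i - p.2 0 i) 0)); rewrite ?lerDr ?le_max ?lexx ?orbT//; apply/orP; left; lra.
  by rewrite lerDl sumr_ge0.
apply: (@le_trans _ _ (mu (box q `\` box p))).
  apply: pint_indic_le; first by apply: measurable_funB => //; exact: mK.
    exact: measurableD.
  move=> x _; rewrite !indicE.
  have [px|px] := pselect (box p x).
    rewrite (mem_set px) memNset; last by case.
    by rewrite /g Dp// mulr0 addr0 max_l// subrr normr0.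
  rewrite memNset// sub0r normrN ger0_norm ?le_max ?lexx ?orbT//.
  have [qx|qx] := pselect (box q x).
    rewrite mem_set//= ge_max ler01 andbT gerDl mulNr oppr_le0 mulr_ge0 ?invr_ge0//; exact: ltW.
  rewrite memNset; last by case.
  rewrite /g ge_max lexx andbT mulNr subr_le0 mulrC ler_pdivlMr// mul1r.
  exact: Dq.
have fp : (mu (box p) < +oo)%E by rewrite mu_box// ltry.
have fq : (mu (box q) < +oo)%E by rewrite mu_box// ltry.
rewrite measureD//; last first.
rewrite setIC (setIidl pq).
rewrite [X in (X - _)%E](_ : _ = (box_volume q)%:E); last exact: mu_box.
rewrite [X in (_ - X)%E](_ : _ = (box_volume p)%:E); last exact: mu_box.
by rewrite -EFinB lee_fin lerBlDl.
Qed.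

Lemma papprox_bigcup_box (q : nat -> 'rV[R]_n * 'rV[R]_n) N :
  papx (\1_(\bigcup_(k in `I_N) box (q k))).
Proof.
elim: N => [|N IH].
  have -> : (\1_(\bigcup_(k in `I_0) box (q k)) : Rn R n -> R) = cst 0.
    by apply/funext => x; rewrite II0 bigcup_set0 indicE in_set0.
  split; first exact: measurable_cst.
  move=> del del0; exists (cst 0) => //.
  rewrite /pint integral0_eq ?lee_fin ?ltW // => x _.
  by rewrite subrr normr0 expr0n gtn_eqF.
have -> : (\1_(\bigcup_(k in `I_N.+1) box (q k)) : Rn R n -> R) =
    (fun x => Num.max (\1_(\bigcup_(k in `I_N) box (q k)) x) (\1_(box (q N)) x)).
  apply/funext => x; rewrite IIS bigcup_setU bigcup_set1 !indicE.
  have -> : (x \in (\bigcup_(k in `I_N) box (q k)) `|` box (q N)) =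
    (x \in \bigcup_(k in `I_N) box (q k)) || (x \in box (q N)) by rewrite in_setU.
  by do 2 case: (x \in _) => /=; rewrite ?maxxx// ?(max_l (@ler01 R))// ?(max_r (@ler01 R)).
exact: (papprox_max mB mK Kmax IH (papprox_box (q N))).
Qed.

(** Cover [E'], the part of [E] in the cube, by boxes with excess volume at most [del / 2] and keep
    finitely many of them, the others having total volume below [del / 2]. Inside the cube, [E] and
    the finite union differ only on the excess and the tail. *)
Lemma papprox_measurable (E : set (Rn R n)) : measurable E -> papx (\1_E).
Proof.
move=> mE; have m1 : measurable_fun B (\1_E : _ -> R) by exact: measurable_indic.
apply: (papprox_lim mB mK) => // del del0.
have d2 : 0 < del / 2 by rewrite divr_gt0.
pose E' := E `&` B.
have mE' : measurable E' by exact: measurableI.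
have fE : (mu E' < +oo)%E.
  by apply: le_lt_trans (mu_cube_lty n0 x0 r0); apply: measureIr.
have fE' : lebesgue_outer_rV E' \is a fin_num by rewrite ge0_fin_numE//; exact: outer_measure_ge0.
have [q Eq Sq] := outer_series_adherent n0 d2 fE'.
have mq k : measurable (box (q k) : set (Rn R n)) by exact: measurable_box.
pose U : set (Rn R n) := \bigcup_k box (q k).
have mU : measurable U by exact: bigcup_measurable.
have vol0 k : (0 <= (box_volume (q k))%:E)%E by exact: box_volume_ge0.
have sfin : (\sum_(0 <= k <oo) (box_volume (q k))%:E < +oo)%E.
  by apply: le_lt_trans Sq _; rewrite lte_add_pinfty// ltry.
have tail := nneseries_tail_cvg sfin (fun k _ => vol0 k).
have /= [N _ HN] : \forall N \near \oo, (\sum_(N <= k <oo) (box_volume (q k))%:E < (del / 2)%:E)%E.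
  apply: (tail [set y | (y < (del / 2)%:E)%E]); apply: open_nbhs_nbhs; split; last by rewrite /= lte_fin.
  exact: open_ereal_lt_ereal.
exists (\1_(\bigcup_(k in `I_N) box (q k))); first exact: papprox_bigcup_box.
pose V : set (Rn R n) := \bigcup_(k in `I_N) box (q k).
have mV : measurable V by exact: bigcup_measurable.
have mW : measurable ((\bigcup_(k in ~` `I_N) box (q k)) : set (Rn R n)) by exact: bigcup_measurable.
apply: (@le_trans _ _ (mu ((U `\` E') `|` (\bigcup_(k in ~` `I_N) box (q k))))).
  apply: pint_indic_le.
  - by apply: measurable_funB => //; exact: measurable_indic.
  - by apply: measurableU => //; exact: measurableD.
  move=> x Bx; rewrite !indicE.
  have [Ex|Ex] := pselect (E x); have [Vx|Vx] := pselect (V x).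
  - by rewrite (mem_set Ex) (mem_set Vx) subrr normr0.
  - rewrite (mem_set Ex) (memNset Vx) subr0 normr1.
    rewrite mem_set//; right; have [k _ qx] := Eq x (conj Ex Bx); exists k => //= kN.
    by apply: Vx; exists k.
  - rewrite (memNset Ex) (mem_set Vx) sub0r normrN normr1 mem_set//; left; split.
      by case: Vx => k _ qx; exists k.
    by case.
  - by rewrite (memNset Ex) (memNset Vx) subrr normr0.
apply: (le_trans (outer_measureU2 _ _ _)).
rewrite [del]splitr EFinD; apply: leeD.
  have fU : (mu U < +oo)%E.
    by apply: le_lt_trans sfin; exact: outer_le_series.
  have E'U : E' `<=` U by [].
  rewrite -[leLHS]/(mu (U `\` E')) measureD// setIC (setIidl E'U).
  rewrite leeBlDl ?ge0_fin_numE//.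
  by apply: le_trans Sq; exact: outer_le_series.
apply: le_trans (ltW (HN N (leqnn N))).
apply: (le_trans (outer_measure_sigma_subadditive_tail _ _ _)).
by apply: lee_nneseries => [k _ _|k _]; [exact: outer_measure_ge0|exact: outer_box_le].
Qed.

Lemma continuous_dense_Ln (g : 'rV[R]_n -> R) (del : R) : 0 < del -> measurable_fun B g ->
  (\int[mu]_(x in B) (`|g x| ^+ n)%:E < +oo)%E ->
  exists2 k, continuous k & (\int[mu]_(x in B) (`|g x - k x| ^+ n)%:E <= del%:E)%E.
Proof.
move=> del0 mg gfin.
have [_ /(_ _ del0)[k ck gk]] := papprox_all mB n0 mK K0 KD KZ papprox_measurable mg gfin.
by exists k.
Qed.

End ContinuousDense.

(** * The maximum principle *)

(** The graph of the power lies above its tangent at [A]. Integrated with [A] a mean value, this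
    gives Jensen's inequality. *)
Lemma bernoulli_tangent (R : realDomainType) (p : nat) (t A : R) : 0 <= t -> 0 <= A ->
  A ^+ p.+1 + p.+1%:R * A ^+ p * (t - A) <= t ^+ p.+1.
Proof.
move=> t0 A0; elim: p => [|p IH]; first by rewrite !expr1 expr0; lra.
have h1 : 0 <= t * (t ^+ p.+1 - (A ^+ p.+1 + p.+1%:R * A ^+ p * (t - A))).
  by rewrite mulr_ge0// subr_ge0.
have h2 : 0 <= p.+1%:R * A ^+ p * (t - A) ^+ 2.
  by rewrite mulr_ge0 ?sqr_ge0// mulr_ge0// exprn_ge0.
rewrite -subr_ge0 (_ : _ - _ = t * (t ^+ p.+1 - (A ^+ p.+1 + p.+1%:R * A ^+ p * (t - A))) +
  p.+1%:R * A ^+ p * (t - A) ^+ 2); first exact: addr_ge0.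
rewrite -[p.+2]addn1 natrD addn1 (exprS t p.+1) (exprS A p.+1) (exprS A p).
by ring.
Qed.

Lemma Rintegral_jensen d (T : measurableType d) (R : realType) (mu : {measure set T -> \bar R})
    (S : set T) (E : T -> R) (m : R) (p : nat) : (0 < p)%N -> 0 < m ->
  measurable S -> (mu S <= m%:E)%E -> (forall x, S x -> 0 <= E x) ->
  mu.-integrable S (EFin \o E) -> mu.-integrable S (EFin \o (fun x => E x ^+ p)) ->
  (\int[mu]_(x in S) E x) ^+ p <= m ^+ p.-1 * \int[mu]_(x in S) E x ^+ p.
Proof.
case: p => // p _ m0 mS Sm E0 iE iEp /=.
(* The mean is taken with respect to the upper bound [m] instead of the measure [M] of [S]; the
   discrepancy is [p%:R * A ^+ p.+1 * (m - M)] and has the favourable sign. *)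
set I := \int[mu]_(x in S) E x; pose A := I / m.
have I0 : 0 <= I by exact: Rintegral_ge0.
have A0 : 0 <= A by rewrite divr_ge0// ltW.
have finS : (mu S < +oo)%E by rewrite (le_lt_trans Sm)// ltry.
have ci (c : R) : mu.-integrable S (EFin \o cst c).
  apply: measurable_bounded_integrable => //.
  by exists `|c|; split; [exact: num_real|move=> t ct y _ /=; rewrite ltW].
pose k := p.+1%:R * A ^+ p.
have i1 : mu.-integrable S (EFin \o (fun x => (A ^+ p.+1 - k * A) + k * E x)).
  have i2 : mu.-integrable S (EFin \o (fun x => k * E x)).
    by have := integrableZl mS k iE; apply: eq_integrable => // x _; rewrite /= EFinM.
  have := integrableD mS (ci (A ^+ p.+1 - k * A)) i2.
  by apply: eq_integrable => // x _; rewrite /= EFinD.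
have : \int[mu]_(x in S) ((A ^+ p.+1 - k * A) + k * E x) <= \int[mu]_(x in S) E x ^+ p.+1.
  apply: le_Rintegral => // x Sx.
  have := bernoulli_tangent p (E0 x Sx) A0; rewrite -/k.
  by rewrite mulrBr; lra.
rewrite RintegralD//; last 2 first.
  exact: (ci (A ^+ p.+1 - k * A)).
  by have := integrableZl mS k iE; apply: eq_integrable => // x _; rewrite /= EFinM.
rewrite Rintegral_cst// RintegralZl// -/I.
set M := fine (mu S) => H.
have Mm : M <= m by rewrite -lee_fin fineK// ge0_fin_numE.
have IE : I = A * m by rewrite /A divfK// gt_eqF.
have step : m * A ^+ p.+1 <= \int[mu]_(x in S) E x ^+ p.+1.
  apply: le_trans H; rewrite IE -subr_ge0.
  rewrite (_ : _ - _ = p%:R * A ^+ p.+1 * (m - M)).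
    by rewrite mulr_ge0 ?subr_ge0// mulr_ge0// exprn_ge0.
  by rewrite /k -[p.+1]addn1 natrD addn1 exprS; ring.
rewrite IE exprMn (_ : A ^+ p.+1 * m ^+ p.+1 = m ^+ p * (m * A ^+ p.+1)); last by rewrite (exprS m); ring.
by apply: ler_wpM2l step; rewrite exprn_ge0// ltW.
Qed.

(** Heine's theorem with only [x] confined to the compact set. The point [y] may lie outside, as
    happens for cells near the boundary of the cube, so continuity is required in the ambient
    space. *)
Lemma uniform_continuity_cube (R : realType) (n : nat) (K : set 'rV[R]_n) (I : finType)
    (g : I -> 'rV[R]_n -> R) (eta : R) : compact K -> 0 < eta ->
  (forall s x, K x -> {for x, continuous (g s)}) ->
  exists2 h0, 0 < h0 & forall s x y, K x -> cube x h0 y -> `|g s y - g s x| <= eta.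
Proof.
move=> cK eta0 cg.
suff H s : exists h0, 0 < h0 /\ forall x y, K x -> cube x h0 y -> `|g s y - g s x| <= eta.
  have /choice[h hP] := H.
  exists (\big[Num.min/1]_s h s); first by apply: lt_bigmin => // s _; have [] := hP s.
  move=> s x y Kx xy; apply: (hP s).2 => // i; apply: le_trans (xy i) _.
  exact: bigmin_le.
have e2 : 0 < eta / 2 by rewrite divr_gt0.
have /compact_near_coveringP cov := cK.
have := cov R 0^'+ (fun h x => forall y, cube x h y -> `|g s y - g s x| <= eta) _.
move=> /(_ _)[].
  move=> x Kx; have [d d0 Hd] := (continuous_rVP _ _).1 (cg s x Kx) _ e2.
  exists (cube x (d / 2), [set h | h <= d / 2]).
    split => /=; first by apply: nbhs_cube; rewrite divr_gt0.
    by exists (d / 2); rewrite /= ?divr_gt0// => t; rewrite /ball/= sub0r normrN => td t0; rewrite (le_trans (ler_norm _))// ltW.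
  move=> [x' h] /= [xx' hd] y x'y.
  have dd : d / 2 <= d by lra.
  have g1 := Hd x' (fun i => le_trans (xx' i) dd).
  have g2 : `|g s y - g s x| < eta / 2.
    apply: Hd => i; have := xx' i; have := x'y i; move: hd; rewrite !ler_norml; lra.
  by move: g1 g2; rewrite ltr_norml ler_norml ltr_norml; lra.
move=> d /= d0 Hd; exists (d / 2); split; first by rewrite divr_gt0.
move=> x y Kx xy; apply: (Hd (d / 2)) => //; last by rewrite divr_gt0.
by rewrite /ball/= sub0r normrN gtr0_norm; lra.
Qed.

(** * Overlap and volume of enlarged cells *)

Section Overlap.
Context {R : realType} {n : nat}.
Hypothesis n0 : (0 < n)%N.
Local Notation mu := (@lebesgue_rV R n).

Let win (t : R) (k : nat) : R := if -1 <= t - k%:R <= 2 then 1 else 0.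

Let win01 t k : 0 <= win t k <= 1.
Proof. by rewrite /win; case: ifP => _; rewrite ?ler01 ?lexx. Qed.

Let winS t k : win t k.+1 = win (t - 1) k.
Proof. by rewrite /win -natr1 opprD addrA addrAC. Qed.

Let win_sum_lt (N : nat) (t : R) (j : nat) : t < j%:R - 1 -> \sum_(k < N) win t k <= j%:R.
Proof.
elim: N t j => [|N IH] t j tj; first by rewrite big_ord0.
rewrite big_ord_recl/=; under eq_bigr do rewrite /bump/= add1n winS.
case: j tj => [|j] tj.
  have -> : win t 0 = 0 by rewrite /win ifF//; apply/negbTE; move: tj; rewrite subr0 sub0r; lra.
  by rewrite add0r IH//; lra.
rewrite -natr1 addrC; apply: lerD; last by have /andP[] := win01 t 0.
by apply: IH; move: tj; rewrite -natr1; lra.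
Qed.

Let win_sum (N : nat) (t : R) : \sum_(k < N) win t k <= 4.
Proof.
elim: N t => [|N IH] t; first by rewrite big_ord0.
have [t2|t2] := leP t 2; first by apply: (@win_sum_lt _ t 4); lra.
rewrite big_ord_recl/=; under eq_bigr do rewrite /bump/= add1n winS.
have -> : win t 0 = 0 by rewrite /win ifF//; apply/negbTE; rewrite subr0; lra.
by rewrite add0r IH.
Qed.

Variables (x0 : 'rV[R]_n) (rho : R) (N : nat).
Hypotheses (rho0 : 0 < rho) (N0 : (0 < N)%N).
Local Notation h := (2 * rho / N%:R).
Implicit Types (q : {ffun 'I_n -> 'I_N}) (m : R).

Let h0 : 0 < h. Proof. by rewrite divr_gt0 ?mulr_gt0// ltr0n. Qed.

(** In each coordinate a point meets at most four enlarged cells, because a closed interval of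
    length 3 contains at most four integers; the product over the coordinates gives [4 ^+ n]. *)
Lemma sum_indic_cell (y : 'rV[R]_n) : \sum_(q : {ffun 'I_n -> 'I_N}) \1_(cell x0 rho q 1) y <= 4 ^+ n :> R.
Proof.
pose t i := (y 0 i - (x0 0 i - rho)) / h.
apply: (@le_trans _ _ (\prod_(i < n) \sum_(k < N) win (t i) k)).
  rewrite bigA_distr_bigA; apply: ler_sum => q _; rewrite indicE.
  have [qy|qy] := boolP (y \in cell x0 rho q 1); last first.
    by apply: prodr_ge0 => i _; have /andP[] := win01 (t i) (q i).
  rewrite big1// => i _; rewrite /win ifT//.
  by have := set_mem qy i; rewrite -/(t i); lra.
rewrite -[X in _ ^+ X]card_ord -prodr_const; apply: ler_prod => i _.
by rewrite win_sum andbT sumr_ge0// => k _; have /andP[] := win01 (t i) k.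
Qed.

Definition cell_center q : 'rV[R]_n := \row_i (x0 0 i - rho + ((q i)%:R + 2^-1) * h).

Lemma cell_cubeE q m : cell x0 rho q m = cube (cell_center q) ((2^-1 + m) * h).
Proof.
have E (y : 'rV[R]_n) i : `|y 0 i - cell_center q 0 i| <= (2^-1 + m) * h =
    (- m <= (y 0 i - (x0 0 i - rho)) / h - (q i)%:R <= 1 + m).
  have hn0 : h != 0 by rewrite gt_eqF.
  have -> : y 0 i - cell_center q 0 i = ((y 0 i - (x0 0 i - rho)) / h - (q i)%:R - 2^-1) * h.
    by rewrite /cell_center mxE; move: hn0; move: (2 * rho / N%:R) => H H0; field.
  rewrite normrM (gtr0_norm h0) ler_pM2r// ler_norml; apply/idP/idP; lra.
by apply/seteqP; split => y H i; have := H i; rewrite E.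
Qed.

Lemma measurable_cell q m : measurable (cell x0 rho q m : set (Rn R n)).
Proof. by rewrite cell_cubeE; exact: measurable_cube. Qed.

Lemma sum_integral_cell (B : set (Rn R n)) (E : 'rV[R]_n -> R) : measurable B ->
  measurable_fun B E -> (forall y, 0 <= E y) -> (forall q, cell x0 rho q 1 `<=` B) ->
  (\sum_(q : {ffun 'I_n -> 'I_N}) \int[mu]_(y in cell x0 rho q 1) (E y)%:E <=
   (4 ^+ n)%:E * \int[mu]_(y in B) (E y)%:E)%E.
Proof.
move=> mB mE E0 sub.
have mEq q : measurable_fun B (fun y => (E y * \1_(cell x0 rho q 1) y)%:E).
  apply/measurable_EFinP; apply: measurable_funM => //.
  by apply: measurable_indic; exact: measurable_cell.
rewrite (eq_bigr (fun q => \int[mu]_(y in B) (E y * \1_(cell x0 rho q 1) y)%:E)%E); last first.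
  move=> q _; rewrite (integral_supp (sub q)); last by move=> y qy; rewrite indicE memNset// mulr0.
  by apply: eq_integral => y qy; rewrite indicE qy mulr1.
rewrite -ge0_integral_sum//; last first.
  by move=> q y _; rewrite lee_fin mulr_ge0// indicE.
rewrite -ge0_integralZl_EFin; last 4 first.
- exact: mB.
- by move=> y _; rewrite lee_fin.
- exact/measurable_EFinP.
- exact: exprn_ge0.
apply: ge0_le_integral; first exact: mB.
- by move=> y _; apply: sume_ge0 => q _; rewrite lee_fin mulr_ge0// indicE.
- by apply: emeasurable_sum => q; exact: mEq.
- apply/measurable_EFinP; apply: measurable_funM => //; exact: measurable_cst.
- move=> y _; rewrite sumEFin -EFinM lee_fin -mulr_sumr mulrC ler_wpM2r//.
  exact: sum_indic_cell.
Qed.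

(** Homogeneous in [r], unlike [mu_cube_le]: the powers of the mesh have to cancel exactly. The
    lower corner of the box lies beyond the cube, since boxes omit their lower faces. *)
Lemma mu_cube_le3 (x : 'rV[R]_n) r : 0 < r -> (mu (cube x r) <= ((3 * r) ^+ n)%:E)%E.
Proof.
move=> r0; pose p := (\row_i (x 0 i - 2 * r), \row_i (x 0 i + r)) : 'rV[R]_n * 'rV[R]_n.
apply: (@le_trans _ _ (mu (box p))).
  apply: le_measure; rewrite ?inE; [exact: measurable_cube|exact: measurable_box|].
  by move=> y xy i; rewrite !mxE; have := xy i; rewrite ler_norml; lra.
rewrite mu_box// lee_fin /box_volume (eq_bigr (fun=> 3 * r)).
  by rewrite prodr_const card_ord.
by move=> i _; rewrite !mxE (max_idPr _); lra.
Qed.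

Lemma mu_cube_ge (x : 'rV[R]_n) r : 0 < r -> (((2 * r) ^+ n)%:E <= mu (cube x r))%E.
Proof.
move=> r0; pose p := (\row_i (x 0 i - r), \row_i (x 0 i + r)) : 'rV[R]_n * 'rV[R]_n.
apply: (@le_trans _ _ (mu (box p))).
  rewrite mu_box// lee_fin /box_volume (eq_bigr (fun=> 2 * r)).
    by rewrite prodr_const card_ord.
  by move=> i _; rewrite !mxE (max_idPr _); lra.
apply: le_measure; rewrite ?inE; [exact: measurable_box|exact: measurable_cube|].
by move=> y py i; have := py i; rewrite !mxE ler_norml; lra.
Qed.

End Overlap.

Lemma EFin_Rintegral d (T : measurableType d) (R : realType) (mu : {measure set T -> \bar R})
    (D : set T) (g : T -> R) : measurable D -> mu.-integrable D (EFin \o g) ->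
  ((\int[mu]_(y in D) g y)%:E = \int[mu]_(y in D) (g y)%:E)%E.
Proof. by move=> mD gi; rewrite /Rintegral fineK//; exact: integrable_fin_num. Qed.

Lemma sum_exp_le (R : realDomainType) (I : finType) (e : I -> R) (p : nat) : (0 < #|I|)%N ->
  (forall s, 0 <= e s) -> (\sum_s e s) ^+ p <= #|I|%:R ^+ p * \sum_s e s ^+ p.
Proof.
move=> /card_gt0P[i0 _] e0.
pose s0 := [arg max_(s > i0) e s]%O.
have max_s0 s : e s <= e s0 by rewrite /s0; case: arg_maxP => // k _ H; exact: H.
apply: (@le_trans _ _ ((#|I|%:R * e s0) ^+ p)).
  apply: lerXn2r; rewrite ?nnegrE ?mulr_ge0 ?sumr_ge0//.
  by rewrite mulr_natl -sumr_const; apply: ler_sum => s _; exact: max_s0.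
rewrite exprMn ler_wpM2l ?exprn_ge0// (bigD1 s0)//= lerDl sumr_ge0// => s _.
exact: exprn_ge0.
Qed.

(* P and H are the mollified gradient and Hessian at a contact point; d1 and d2 are
   the weak derivatives, which satisfy the differential inequality. *)
Lemma hessian_trace_le (R : realType) (n : nat) (a H d2 : 'I_n -> 'I_n -> R) (b P d1 : 'I_n -> R)
    (lam A0 kappa r e : R) : 0 <= A0 ->
  symf a -> symf H -> (forall xi, lam * (\sum_(i < n) xi i ^+ 2) <= qform a xi) ->
  (forall xi, qform H xi <= 0) -> (forall i j, `|a i j| <= A0) -> (forall i, `|b i| <= A0) ->
  (forall i, `|P i| <= r) -> n%:R * (A0 * r) <= kappa ->
  (forall i j, `|d2 i j - H i j| <= e) -> (forall i, `|d1 i - P i| <= e) ->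
  kappa <= \sum_(i < n) \sum_(j < n) a i j * d2 i j + \sum_(i < n) b i * d1 i ->
  lam * (- \sum_(i < n) H i i) <= A0 * (n%:R * n%:R + n%:R) * e.
Proof.
move=> A00 sa sH aell H0 aA bA Pr nr d2H d1P kap.
have tr := elliptic_nsd_le sa sH aell H0.
have s1 : \sum_(i < n) \sum_(j < n) a i j * d2 i j <=
    \sum_(i < n) \sum_(j < n) a i j * H i j + n%:R * (n%:R * (A0 * e)).
  rewrite -lerBlDl -sumrB [leRHS]mulr_natl -[X in _ *+ X]card_ord -sumr_const.
  apply: ler_sum => i _; rewrite -sumrB [leRHS]mulr_natl -[X in _ *+ X]card_ord -sumr_const.
  apply: ler_sum => j _; rewrite -mulrBr (le_trans (ler_norm _))// normrM.
  by apply: ler_pM.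
have s2 : \sum_(i < n) b i * d1 i <= n%:R * (A0 * r) + n%:R * (A0 * e).
  rewrite -mulrDr -mulrDr mulr_natl -[X in _ *+ X]card_ord -sumr_const.
  apply: ler_sum => i _; rewrite (le_trans (ler_norm _))// normrM; apply: ler_pM => //.
  by rewrite -(subrK (P i) (d1 i)) (le_trans (ler_normD _ _))// addrC lerD.
rewrite mulrN (_ : _ * e = n%:R * (n%:R * (A0 * e)) + n%:R * (A0 * e)); last by ring.
lra.
Qed.

Section Bony.
Context {R : realType} {n : nat}.
Hypothesis n0 : (0 < n)%N.
Local Notation mu := (@lebesgue_rV R n).
Local Notation m0 := ((fun=> 0%N) : 'I_n -> nat).
Variables (Om : set 'rV[R]_n) (f : 'rV[R]_n -> R) (g1 : 'I_n -> 'rV[R]_n -> R)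
  (g2 : 'I_n -> 'I_n -> 'rV[R]_n -> R) (x0 : 'rV[R]_n) (rho : R)
  (phi : 'rV[R]_n -> R) (phi1 : 'I_n -> 'rV[R]_n -> R)
  (phi2 : 'I_n -> 'I_n -> 'rV[R]_n -> R)
  (a : 'I_n -> 'I_n -> 'rV[R]_n -> R) (b : 'I_n -> 'rV[R]_n -> R) (lam A0 kappa delta : R).
Hypotheses (oOm : open Om) (W : weak2 Om f g1 g2) (rho0 : 0 < rho)
  (sub : cube x0 (3 * rho) `<=` Om) (Phi : C2on (cube x0 (3 * rho)) phi phi1 phi2)
  (lam0 : 0 < lam) (A00 : 0 < A0) (kappa0 : 0 < kappa) (delta0 : 0 < delta).
Hypotheses (a_sym : forall y, cube x0 (3 * rho) y -> symf (fun i j => a i j y))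
  (a_ell : forall y, cube x0 (3 * rho) y -> forall xi,
     lam * (\sum_(i < n) xi i ^+ 2) <= qform (fun i j => a i j y) xi)
  (a_bnd : forall y, cube x0 (3 * rho) y -> forall i j, `|a i j y| <= A0)
  (b_bnd : forall y, cube x0 (3 * rho) y -> forall i, `|b i y| <= A0)
  (strict : forall y, cube x0 rho y -> (exists i, `|y 0 i - x0 0 i| = rho) ->
     f y + phi y + delta <= f x0 + phi x0)
  (Lw : {ae mu, forall y : 'rV[R]_n, cube x0 (3 * rho) y -> kappa <=
     \sum_(i < n) \sum_(j < n) a i j y * (g2 i j y + phi2 i j y) +
     \sum_(i < n) b i y * (g1 i y + phi1 i y)}).

Local Notation B := (cube x0 (2 * rho) : set (Rn R n)).
Local Notation S := ('I_n + 'I_n * 'I_n)%type.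
Local Notation A := (expR 4 ^+ n : R).
(** First and second derivatives are treated alike and share one index set. [G] holds those of the
    weak summand, which is mollified, and [Ph] those of the C^2 summand, which is left as it is. *)
Let G (s : S) := match s with inl i => g1 i | inr p => g2 p.1 p.2 end.
Let Ph (s : S) := match s with inl i => phi1 i | inr p => phi2 p.1 p.2 end.

Let aeF : Filter (almost_everywhere mu) := ae_filter_ringOfSetsType mu.

Let cube_le (t u : R) : t <= u -> cube x0 t `<=` cube x0 u.
Proof. by move=> tu y xy i; rewrite (le_trans (xy i)). Qed.

Let B3 : cube x0 (2 * rho) `<=` cube x0 (3 * rho).
Proof. by apply: cube_le; have := rho0; lra. Qed.

Let BOm : cube x0 (2 * rho) `<=` Om.
Proof. exact: subset_trans sub. Qed.

Let mB : measurable B. Proof. exact: measurable_cube. Qed.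

Let finB : (mu B < +oo)%E. Proof. by apply: mu_cube_lty => //; have := rho0; lra. Qed.

Let locG s : loc_integrable Om (G s).
Proof.
by case: s => [i|p]; [have [] := weak2_derive1 W i|have [] := weak2_derive2 W p.1 p.2].
Qed.

Let intG s : mu.-integrable B (EFin \o G s).
Proof. exact: (loc_integrable_cube n0 oOm (locG s) BOm). Qed.

Let mG s : measurable_fun B (G s).
Proof. by have [m _] := locG s; exact: (measurable_fun_cube n0 oOm m BOm). Qed.

Let powG s : (\int[mu]_(y in B) (`|G s y| ^+ n)%:E < +oo)%E.
Proof.
have r1 : 0 < 2 * rho by have := rho0; lra.
have r2 : 2 * rho < 3 * rho by have := rho0; lra.
by case: s => [i|p]; [exact: weak2_int1 W i _ _ _ r1 r2 sub|exact: weak2_int2 W p.1 p.2 _ _ _ r1 r2 sub].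
Qed.

Section Cells.
Variables (eta hm : R) (gam : S -> 'rV[R]_n -> R) (N : nat).
Hypotheses (eta0 : 0 < eta) (N0 : (0 < N)%N).
Local Notation h := (2 * rho / N%:R).
Hypotheses (h_rho : h <= rho)
  (ugam : forall s x y, cube x0 (2 * rho) x -> cube x (3 * h) y -> `|gam s y - gam s x| <= eta)
  (uphi : forall s x y, cube x0 (2 * rho) x -> cube x (3 * h) y -> `|Ph s y - Ph s x| <= eta)
  (uf : forall x y, cube x0 (2 * rho) x -> cube x h y -> `|f y - f x| <= delta / (4 * (A * 3 ^+ n))).
Variables (F : 'rV[R]_n -> R) (F1 : 'I_n -> 'rV[R]_n -> R) (F2 : 'I_n -> 'I_n -> 'rV[R]_n -> R).
Hypotheses (CF : C2on setT F F1 F2) (FE : forall x, cube x h `<=` cube x0 (2 * rho) ->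
  [/\ F x = kconv (cube x0 (2 * rho)) h m0 f x / @mass R n h,
      forall i, F1 i x = kconv (cube x0 (2 * rho)) h m0 (g1 i) x / @mass R n h &
      forall i j, F2 i j x = kconv (cube x0 (2 * rho)) h m0 (g2 i j) x / @mass R n h]).

Let E (y : 'rV[R]_n) := \sum_s `|G s y - gam s y|.
Hypotheses (iE : mu.-integrable B (EFin \o E)).

Let h0 : 0 < h. Proof. by rewrite divr_gt0 ?mulr_gt0// ltr0n. Qed.
Let A1 : 0 < A. Proof. by rewrite exprn_gt0// expR_gt0. Qed.
Let Fs (s : S) := match s with inl i => F1 i | inr p => F2 p.1 p.2 end.
Let Sq (q : {ffun 'I_n -> 'I_N}) : set (Rn R n) := cell x0 rho q 1.
(** The mean deviation over the enlarged cell up to a dimensional factor, as [h ^+ n] replaces the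
    measure of that cell. *)
Let aq q := (h ^+ n)^-1 * \int[mu]_(y in Sq q) E y.

Let E0 y : 0 <= E y. Proof. exact: sumr_ge0. Qed.

Let GE s y : `|G s y - gam s y| <= E y.
Proof. by rewrite /E (bigD1 s)//= lerDl sumr_ge0. Qed.

Let SqB q : Sq q `<=` B.
Proof.
move=> y qy i; have := qy i.
have hn0 : h != 0 by rewrite gt_eqF.
have qN : (q i)%:R + 1 <= N%:R :> R by rewrite natr1 ler_nat ltn_ord.
have q0 : 0 <= (q i)%:R :> R by [].
have NE : N%:R * h = 2 * rho by rewrite mulrCA divff ?mulr1// pnatr_eq0 -lt0n.
set t := (_ - _) / h => /andP[t1 t2].
have tE : y 0 i - x0 0 i = t * h - rho by rewrite /t divfK//; ring.
have t3 : - h <= t * h by rewrite -mulN1r ler_pM2r//; lra.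
have t4 : t * h <= 2 * rho + h.
  have -> : 2 * rho + h = (N%:R + 1) * h by rewrite [RHS]mulrDl NE mul1r.
  by rewrite ler_pM2r//; lra.
by rewrite tE ler_norml; have := h_rho; lra.
Qed.

Let cell01 q : cell x0 rho q 0 `<=` Sq q.
Proof. by move=> y qy i; have := qy i; lra. Qed.

Let cube_cell q z : cell x0 rho q 0 z -> cube z h `<=` Sq q.
Proof.
by move=> qz y zy; apply: (cell_widen rho0 N0 qz) => i; rewrite mul1r; exact: zy.
Qed.

Let mSq q : measurable (Sq q). Proof. exact: measurable_cell. Qed.

Let muSq q : (mu (Sq q) <= ((6 * h) ^+ n)%:E)%E.
Proof.
rewrite /Sq cell_cubeE//; apply: (le_trans (mu_cube_le3 n0 _ _)).
  by rewrite mulr_gt0// addr_gt0.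
rewrite lee_fin; apply: lerXn2r; rewrite ?nnegrE; [|by rewrite mulr_ge0// ltW|].
  by rewrite !mulr_ge0// ?addr_ge0// ltW.
by have := h0; lra.
Qed.

Let finSq q : (mu (Sq q) < +oo)%E.
Proof. by apply: le_lt_trans (muSq q) _; exact: ltry. Qed.

Let icst (C : set (Rn R n)) (c : R) : measurable C -> (mu C < +oo)%E ->
  mu.-integrable C (EFin \o cst c).
Proof.
move=> mC fC; apply: measurable_bounded_integrable => //.
by exists `|c|; split; [exact: num_real|move=> t ct y _ /=; rewrite ltW].
Qed.

Let iESq q : mu.-integrable (Sq q) (EFin \o E).
Proof. exact: (integrableS mB (mSq q) (@SqB q) iE). Qed.

Let aq0 q : 0 <= aq q.
Proof. by rewrite mulr_ge0 ?invr_ge0 ?exprn_ge0 ?(ltW h0)// Rintegral_ge0. Qed.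

Let FsE s x : cube x h `<=` cube x0 (2 * rho) ->
  Fs s x = kconv (cube x0 (2 * rho)) h m0 (G s) x / @mass R n h.
Proof. by move=> /FE[_ H1 H2]; case: s => [i|p] /=; [exact: H1|exact: H2]. Qed.

Let cell_close q x y : cell x0 rho q 0 x -> Sq q y -> cube x (3 * h) y.
Proof.
move=> /cell01 qx qy i; have := cell_dist rho0 N0 qy qx i.
by rewrite mulr1 (_ : 1 + 2 = 3)//; lra.
Qed.

(** The kernel has the size of the mesh, so for every [z] of the cell its support stays in the
    enlarged cell. One number [aq q] thus controls the mollified derivatives on the whole cell;
    [eta] accounts for the variation of [gam]. *)
Let dev s q x z : cell x0 rho q 0 x -> cell x0 rho q 0 z ->
  `|Fs s z - gam s x| <= A * (aq q + 6 ^+ n * eta).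
Proof.
move=> qx qz; have zB := subset_trans (cube_cell qz) (@SqB q).
have xB : cube x0 (2 * rho) x by apply: SqB; exact: cell01 qx.
rewrite FsE//; apply: (le_trans (kconv_mean_dev n0 (gam s x) h0 mB (mSq q) finB (intG s) (cube_cell qz) (@SqB q))).
rewrite -mulrA ler_pM2l//.
have iG : mu.-integrable (Sq q) (EFin \o (fun y => G s y - gam s x)).
  have iGs := integrableS mB (mSq q) (@SqB q) (intG s).
  by have := integrableB (mSq q) iGs (icst (gam s x) (mSq q) (finSq q)); exact.
have le1 : \int[mu]_(y in Sq q) `|G s y - gam s x| <= \int[mu]_(y in Sq q) (E y + eta).
  apply: le_Rintegral => //; first exact: integrable_norm.
    by have := integrableD (mSq q) (iESq q) (icst eta (mSq q) (finSq q)); exact.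
  move=> y qy; rewrite -(subrKA (gam s y)) (le_trans (ler_normD _ _))// lerD ?GE//.
  by apply: ugam => //; exact: cell_close qx qy.
have le2 : \int[mu]_(y in Sq q) (E y + eta) <= \int[mu]_(y in Sq q) E y + eta * (6 * h) ^+ n.
  rewrite RintegralD//; last exact: (icst eta (mSq q) (finSq q)).
  rewrite lerD2l Rintegral_cst// ler_wpM2l ?(ltW eta0)// -lee_fin fineK ?muSq//.
  by rewrite ge0_fin_numE//; exact: finSq.
have hn : 0 < (h ^+ n)^-1 by rewrite invr_gt0 exprn_gt0.
rewrite -(ler_pM2l hn) in le1; rewrite -(ler_pM2l hn) in le2.
apply: (le_trans le1); apply: (le_trans le2).
rewrite mulrDr lerD2l [(6 * _) ^+ n]exprMn.
have : h ^+ n != 0 by rewrite gt_eqF// exprn_gt0.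
by move: (h ^+ n) => H H0; rewrite le_eqVlt; apply/orP; left; apply/eqP; field.
Qed.

Let sumF0 : (0 < #|{: S}|)%N. Proof. by rewrite card_sum card_ord addn_gt0 n0. Qed.

(** The contact occurs at one point, the inequality holds at almost every [y]. Pairing the
    coefficients at [y] with the mollified Hessian at [x] shows [c <= E y] for almost all [y] of the
    cell, where [c] is the scaled trace less the controlled errors. If [c] is positive, integration
    over the cell, whose volume is at least [h ^+ n], gives [c <= aq q]. *)
Let contact_trace q x r : cell x0 rho q 0 x -> cube x0 rho x ->
  n%:R * (A0 * r) <= kappa -> (forall i, `|F1 i x + phi1 i x| <= r) ->
  (forall xi, qform (fun i j => F2 i j x + phi2 i j x) xi <= 0) ->
  - \sum_(i < n) (F2 i i x + phi2 i i x) <=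
    A0 * (n%:R * n%:R + n%:R) / lam * (aq q + (2 * eta + A * (aq q + 6 ^+ n * eta))).
Proof.
move=> qx xx nr F1r Fn; set e0 := 2 * eta + _.
have xB : cube x0 (2 * rho) x by apply: SqB; exact: cell01 qx.
have x3 := B3 xB.
set T := - \sum_(i < n) _.
set D := A0 * (n%:R * n%:R + n%:R).
have D0 : 0 < D by rewrite mulr_gt0// addr_gt0 ?mulr_gt0 ?ltr0n.
rewrite -ler_pdivrMl; last by rewrite divr_gt0.
rewrite -lerBlDr; set c := _ - e0.
have [c0|c0] := leP c 0; first exact: le_trans (aq0 q).
have Hc : {ae mu, forall y, cell x0 rho q 0 y -> c <= E y}.
  apply: (@filterS _ _ aeF _ _ _ Lw) => y Ly qy.
  have yS := cell01 qy; have y3 := B3 (SqB yS).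
  have xy := cell_close qx yS.
  have close s : `|G s y + Ph s y - (Fs s x + Ph s x)| <= E y + e0.
    rewrite (_ : _ - _ = (G s y - gam s y) + ((gam s y - gam s x) - (Fs s x - gam s x) + (Ph s y - Ph s x))); last by ring.
    rewrite (le_trans (ler_normD _ _))// lerD//.
    have h1 := ugam s xB xy; have h2 := uphi s xB xy; have h3 := dev s qx qx.
    by move: h1 h2 h3; rewrite /e0 !ler_norml; lra.
  have sH : symf (fun i j => F2 i j x + phi2 i j x).
    by move=> i j; rewrite (C2_sym CF)// (C2_sym Phi).
  have := @hessian_trace_le R n (fun i j => a i j y) (fun i j => F2 i j x + phi2 i j x)
    (fun i j => g2 i j y + phi2 i j y) (b^~ y) (fun i => F1 i x + phi1 i x)
    (fun i => g1 i y + phi1 i y) lam A0 kappa r (E y + e0) (ltW A00) (a_sym y3) sH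
    (a_ell y3) Fn (a_bnd y3) (b_bnd y3) F1r nr
    (fun i j => close (inr (i, j))) (fun i => close (inl i)) (Ly y3).
  rewrite -/T -/D /c lerBlDr => le.
  rewrite ler_pdivrMl ?divr_gt0// -(ler_pM2l lam0).
  rewrite (_ : lam * (D / lam * _) = D * (E y + e0))//.
  by have ln0 : lam != 0 by [rewrite gt_eqF]; field.
have mc : measurable (cell x0 rho q 0 : set (Rn R n)) by exact: measurable_cell.
have cS : cell x0 rho q 0 `<=` Sq q by exact: cell01.
have finc : (mu (cell x0 rho q 0) < +oo)%E.
  by apply: le_lt_trans (finSq q); apply: le_measure; rewrite ?inE.
have iEc : mu.-integrable (cell x0 rho q 0) (EFin \o E) by exact: (integrableS (mSq q) mc cS (iESq q)).
have le1 : (\int[mu]_(y in cell x0 rho q 0) (c%:E) <= \int[mu]_(y in Sq q) (E y)%:E)%E.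
  apply: (@le_trans _ _ (\int[mu]_(y in cell x0 rho q 0) (E y)%:E)%E).
    have Hc' : {ae mu, forall y, cell x0 rho q 0 y -> (c%:E <= (E y)%:E)%E}.
      by apply: (@filterS _ _ aeF _ _ _ Hc) => y Hy qy; rewrite lee_fin; exact: Hy.
    apply: (@ae_ge0_le_integral _ _ _ mu _ mc (fun=> c%:E) (fun y => (E y)%:E) _ _ _ _ Hc').
    - by move=> y _; rewrite lee_fin ltW.
    - exact: measurable_cst.
    - by move=> y _; rewrite lee_fin.
    - exact: measurable_int iEc.
  apply: (@ge0_subset_integral _ _ _ mu _ _ mc (mSq q) (fun y => (E y)%:E));
    [exact: measurable_int (iESq q)|by move=> y _; rewrite lee_fin|exact: cS].
rewrite -(EFin_Rintegral (mSq q) (iESq q)) in le1.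
have le2 : ((c * h ^+ n)%:E <= \int[mu]_(y in cell x0 rho q 0) (c%:E))%E.
  have := @integral_cst _ _ _ mu _ mc c%:E; rewrite /= => ->.
  rewrite EFinM lee_wpmul2l ?lee_fin ?(ltW c0)// cell_cubeE//.
  apply: le_trans (mu_cube_ge n0 _ _); last by rewrite addr0 mulr_gt0.
  by rewrite addr0 mulrA divff// mul1r.
have := le_trans le2 le1; rewrite lee_fin /aq => le3.
by rewrite ler_pdivlMl ?exprn_gt0// mulrC.
Qed.

(** Mollification costs [delta / 4] at the centre and [delta / 4] on the boundary, which leaves half
    of the gap [delta]. The tolerance in [uf] is chosen to cancel the constant of the averaging
    estimate. *)
Let fdev y : cube x0 rho y -> `|F y - f y| <= delta / 4.
Proof.
move=> xy.
have yB : cube y h `<=` B.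
  move=> z yz i; have := yz i; have := xy i; have := h_rho; rewrite !ler_norml; lra.
have y2 : cube x0 (2 * rho) y by apply: yB => i; rewrite subrr normr0 ltW.
have [fl _ _] := weak2_derive1 W (Ordinal n0).
have fB := loc_integrable_cube n0 oOm fl BOm.
have [-> _ _] := FE yB.
have mc := @measurable_cube R n n0 y h.
have fc : (mu (cube y h) < +oo)%E by apply: mu_cube_lty => //; exact: ltW.
apply: (le_trans (kconv_mean_dev n0 (f y) h0 mB mc finB fB (fun _ H => H) yB)).
set z := delta / (4 * (A * 3 ^+ n)).
have A3 : 0 < A * 3 ^+ n by rewrite mulr_gt0// exprn_gt0.
have z0 : 0 <= z by rewrite divr_ge0 ?ltW// mulr_gt0.
have le1 : \int[mu]_(x in cube y h) `|f x - f y| <= \int[mu]_(x in cube y h) z.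
  apply: le_Rintegral => //.
  - apply: integrable_norm => //.
    have fi := integrableS mB mc yB fB.
    by have := integrableB mc fi (icst (f y) mc fc); exact.
  - exact: icst.
  - by move=> x yx; exact: uf.
have le2 : \int[mu]_(x in cube y h) z <= z * (3 * h) ^+ n.
  rewrite Rintegral_cst// ler_wpM2l// -lee_fin fineK; first exact: mu_cube_le3.
  by rewrite ge0_fin_numE//; exact: fc.
have hn : 0 < h ^+ n by rewrite exprn_gt0.
apply: (le_trans (ler_wpM2l _ (le_trans le1 le2))); first by rewrite divr_ge0// ltW.
rewrite [(3 * _) ^+ n]exprMn /z; have hn0 : h ^+ n != 0 by rewrite gt_eqF.
have An0 : A != 0 by rewrite gt_eqF.
have t0 : (3 ^+ n : R) != 0 by rewrite gt_eqF// exprn_gt0.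
move: hn0 An0 t0; move: (h ^+ n) A (3 ^+ n : R) => H a' t H0 a0 t0.
by rewrite le_eqVlt; apply/orP; left; apply/eqP; field; rewrite t0 a0 H0.
Qed.

(** The first summand bounds the Hessian entries at a contact point through the trace. The second
    bounds the oscillation of the Hessian over the cell: twice the error from [dev], plus 1 for the
    modulus of continuity of [phi2]. *)
Local Notation C1 := (A0 * (n%:R * n%:R + n%:R) / lam * (3 + A * (1 + 6 ^+ n)) +
  (2 * (A * (1 + 6 ^+ n)) + 1)).

Lemma contact_cells_sum r : 0 <= r -> n%:R * (rho * r) < delta / 2 ->
  n%:R * (A0 * r) <= kappa ->
  (2 * r) ^+ n <= \sum_q (2 * (n%:R * (C1 * (aq q + eta) * h))) ^+ n.
Proof.
move=> r0 rd rk.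
have K0 : 0 <= A * (1 + 6 ^+ n) by rewrite mulr_ge0 ?(ltW A1)// addr_ge0// exprn_ge0.
have D0 : 0 <= A0 * (n%:R * n%:R + n%:R) / lam.
  by rewrite divr_ge0 ?(ltW lam0)// mulr_ge0 ?(ltW A00)// addr_ge0// mulr_ge0.
have C10 : 0 <= C1.
  by apply: addr_ge0; [apply: mulr_ge0 => //; exact: addr_ge0|apply: addr_ge0 => //; exact: mulr_ge0].
have sixn : 0 <= 6 ^+ n :> R by rewrite exprn_ge0.
apply: (@contact_slopes_cover R n x0 rho (2 * rho) (delta / 2) r N _ _ _
  (fun q => C1 * (aq q + eta)) n0 rho0 _ N0
  (C2onD (C2on_sub (@subsetT _ _) CF) (C2on_sub B3 Phi))) => //.
- by have := rho0; lra.
- move=> y xy bd; have := strict xy bd; have := fdev xy.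
  have x0x : cube x0 rho x0 by move=> i; rewrite subrr normr0 ltW.
  by have := fdev x0x; rewrite !ler_norml; lra.
- by move=> q; rewrite mulr_ge0// addr_ge0// ltW.
move=> q x qx xx F1r Fn z i j qz xz.
have T := contact_trace qx xx rk F1r Fn.
have xB : cube x0 (2 * rho) x by apply: SqB; exact: cell01 qx.
have sH : symf (fun i j => F2 i j x + phi2 i j x).
  by move=> k l; rewrite (C2_sym CF)// (C2_sym Phi)//; exact: B3.
have H1 := nsd_entry_le i j sH Fn.
have H2 := dev (inr (i, j)) qx qx.
have H3 := dev (inr (i, j)) qx qz.
have H4 := uphi (inr (i, j)) xB (cell_close qx (cell01 qz)).
have a0 := aq0 q; have e0 := ltW eta0.
move: T H2 H3 H4; rewrite /Fs /Ph/=; set X := aq q; set K := A * (1 + 6 ^+ n).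
set D := A0 * (n%:R * n%:R + n%:R) / lam => T H2 H3 H4.
have K1 : A * (X + 6 ^+ n * eta) <= K * (X + eta).
  rewrite /K -mulrA ler_wpM2l ?(ltW A1)// mulrDl mul1r.
  rewrite -subr_ge0 (_ : _ - _ = eta + 6 ^+ n * X); last by ring.
  by rewrite addr_ge0// mulr_ge0.
have T' : - \sum_(i < n) (F2 i i x + phi2 i i x) <= D * (3 + K) * (X + eta).
  apply: (le_trans T); rewrite -mulrA ler_wpM2l// mulrDl.
  by have : 0 <= X := a0; lra.
rewrite mulrDl mulrDl mul1r -mulrA.
move: H1 H2 H3 H4 T'; rewrite !ler_norml -mulrA.
have : 0 <= X := a0.
by lra.
Qed.

(** Here the exponent n meets the dimension: the factor [h ^+ n] of each term is what Jensen's
    inequality consumes to turn the n-th power of a mean into an integral of [E ^+ n]. The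
    continuity errors add up through [N%:R * h = 2 * rho]. *)
Lemma sum_cells_le (I : R) : mu.-integrable B (EFin \o (fun y => E y ^+ n)) ->
  \int[mu]_(y in B) E y ^+ n <= I ->
  \sum_q (2 * (n%:R * (C1 * (aq q + eta) * h))) ^+ n <=
  (2 * (n%:R * C1)) ^+ n * (2 ^+ n * ((6 ^+ n) ^+ n.-1 * (4 ^+ n * I) + (2 * rho) ^+ n * eta ^+ n)).
Proof.
move=> iEn EI.
have K0 : 0 <= A * (1 + 6 ^+ n) by rewrite mulr_ge0 ?(ltW A1)// addr_ge0// exprn_ge0.
have D0 : 0 <= A0 * (n%:R * n%:R + n%:R) / lam.
  by rewrite divr_ge0 ?(ltW lam0)// mulr_ge0 ?(ltW A00)// addr_ge0// mulr_ge0.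
have C10 : 0 <= C1.
  by apply: addr_ge0; [apply: mulr_ge0 => //; exact: addr_ge0|apply: addr_ge0 => //; exact: mulr_ge0].
have H0 : 0 < h ^+ n by rewrite exprn_gt0.
have iEnq q : mu.-integrable (Sq q) (EFin \o (fun y => E y ^+ n)).
  exact: (integrableS mB (mSq q) (@SqB q) iEn).
have jen q : h ^+ n * aq q ^+ n <= (6 ^+ n) ^+ n.-1 * \int[mu]_(y in Sq q) E y ^+ n.
  have m6 : 0 < (6 * h) ^+ n by rewrite exprn_gt0// mulr_gt0.
  have := Rintegral_jensen n0 m6 (mSq q) (muSq q) (fun y _ => E0 y) (iESq q) (iEnq q).
  rewrite /aq; set J := \int[mu]_(y in Sq q) E y; set J' := \int[mu]_(y in Sq q) _.
  rewrite [(6 * _) ^+ n]exprMn [(_ * J) ^+ n]exprMn => Jle.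
  have c0 : 0 <= h ^+ n * (h ^+ n)^-1 ^+ n.
    by rewrite mulr_ge0 ?(ltW H0)// exprn_ge0// invr_ge0 ltW.
  rewrite mulrA (le_trans (ler_wpM2l c0 Jle))//.
  rewrite le_eqVlt; apply/orP; left; apply/eqP.
  rewrite mulrA; congr (_ * _).
  have Hn0 : h ^+ n != 0 by rewrite gt_eqF.
  move: Hn0; move: (h ^+ n) => H Hn0.
  rewrite [(_ * H) ^+ _]exprMn exprVn.
  rewrite (_ : H * (H ^+ n)^-1 * ((6 ^+ n) ^+ n.-1 * H ^+ n.-1) =
    (6 ^+ n) ^+ n.-1 * ((H ^+ n)^-1 * (H * H ^+ n.-1))); last by ring.
  by rewrite -exprS prednK// mulVf ?mulr1// expf_neq0.
pose T q := (2 * (n%:R * C1)) ^+ n * (2 ^+ n * ((6 ^+ n) ^+ n.-1 * \int[mu]_(y in Sq q) E y ^+ n + h ^+ n * eta ^+ n)).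
apply: (@le_trans _ _ (\sum_q T q)).
  apply: ler_sum => q _.
  rewrite (_ : 2 * _ = (2 * (n%:R * C1)) * (h * (aq q + eta))); last by ring.
  rewrite exprMn /T ler_wpM2l ?exprn_ge0 ?mulr_ge0// exprMn.
  have := exprD_le n (aq q) eta.
  rewrite !ger0_norm ?addr_ge0 ?(ltW eta0) ?aq0// => le.
  apply: (le_trans (ler_wpM2l (ltW H0) le)).
  rewrite mulrCA ler_wpM2l ?exprn_ge0// mulrDr lerD2r.
  exact: jen.
rewrite /T -mulr_sumr -mulr_sumr big_split/= -mulr_sumr.
rewrite ler_wpM2l ?exprn_ge0 ?mulr_ge0// ler_wpM2l ?exprn_ge0// lerD//.
  rewrite ler_wpM2l ?exprn_ge0//.
  have mEn : measurable_fun B (fun y => E y ^+ n) by apply/measurable_EFinP; exact: measurable_int iEn.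
  have En0 y : 0 <= E y ^+ n by rewrite exprn_ge0.
  have := @sum_integral_cell R n n0 x0 rho N rho0 N0 B _ mB mEn En0 SqB.
  rewrite -(EFin_Rintegral mB iEn).
  under eq_bigr do rewrite -(EFin_Rintegral (mSq _) (iEnq _)).
  rewrite sumEFin -EFinM lee_fin => /le_trans; apply.
  by rewrite ler_wpM2l// exprn_ge0.
rewrite -mulr_suml ler_wpM2r ?exprn_ge0 ?(ltW eta0)//.
rewrite sumr_const card_ffun !card_ord -[h ^+ n *+ _]mulr_natr natrX -exprMn divfK//.
by rewrite pnatr_eq0 -lt0n.
Qed.

End Cells.
Lemma bony_strict : False.
Proof.
have A1 : 0 < A by rewrite exprn_gt0// expR_gt0.
have sumF0 : (0 < #|{: S}|)%N by rewrite card_sum card_ord addn_gt0 n0.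
pose D := A0 * (n%:R * n%:R + n%:R) / lam.
have D0 : 0 <= D by rewrite divr_ge0 ?(ltW lam0)// mulr_ge0 ?(ltW A00)// addr_ge0// mulr_ge0.
pose C1 : R := D * (3 + A * (1 + 6 ^+ n)) + (2 * (A * (1 + 6 ^+ n)) + 1).
have K0 : 0 <= A * (1 + 6 ^+ n) by rewrite mulr_ge0 ?(ltW A1)// addr_ge0// exprn_ge0.
have C10 : 0 <= C1.
  by apply: addr_ge0; [apply: mulr_ge0 => //; exact: addr_ge0|apply: addr_ge0 => //; exact: mulr_ge0].
pose M : R := #|{: S}|%:R.
pose C2 : R := (2 * (n%:R * C1)) ^+ n *
  (2 ^+ n * ((6 ^+ n) ^+ n.-1 * (4 ^+ n * (M ^+ n * M)) + (2 * rho) ^+ n)).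
have C20 : 0 <= C2.
  have := ltW rho0 => r0.
  apply: mulr_ge0; first by rewrite exprn_ge0// !mulr_ge0.
  apply: mulr_ge0; first exact: exprn_ge0.
  apply: addr_ge0; last by rewrite exprn_ge0// mulr_ge0.
  apply: mulr_ge0; first by rewrite !exprn_ge0.
  by apply: mulr_ge0; [exact: exprn_ge0|apply: mulr_ge0 => //; exact: exprn_ge0].
have nR : 0 < n%:R :> R by rewrite ltr0n.
(* The first bound keeps slopes below [r] from compensating the drop [delta / 2]; the second lets
   [kappa] absorb the drift term at such slopes. *)
pose r := Num.min (delta / (4 * (n%:R * rho))) (kappa / (n%:R * A0)).
have nrho : 0 < n%:R * rho by rewrite mulr_gt0.
have r0 : 0 < r by rewrite lt_min !divr_gt0// mulr_gt0.
have rd : n%:R * (rho * r) < delta / 2.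
  have : r <= delta / (4 * (n%:R * rho)) by rewrite ge_min lexx.
  rewrite ler_pdivlMr ?mulr_gt0// mulrA => H.
  have := delta0; have -> : n%:R * (rho * r) = r * 4 * (n%:R * rho) / 4 by field.
  lra.
have rk : n%:R * (A0 * r) <= kappa.
  have : r <= kappa / (n%:R * A0) by rewrite ge_min lexx orbT.
  by rewrite ler_pdivlMr ?mulr_gt0// mulrC mulrA.
suff claim theta : 0 < theta -> theta <= 1 -> (2 * r) ^+ n <= C2 * theta.
  have p0 : 0 < (2 * r) ^+ n by rewrite exprn_gt0// mulr_gt0.
  pose th := Num.min 1 ((2 * r) ^+ n / (2 * (C2 + 1))).
  have c21 : 0 < 2 * (C2 + 1) by lra.
  have th0 : 0 < th by rewrite lt_min ltr01 divr_gt0.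
  have th1 : th <= 1 by rewrite ge_min lexx.
  have := claim th th0 th1.
  have : th <= (2 * r) ^+ n / (2 * (C2 + 1)) by rewrite ge_min lexx orbT.
  rewrite ler_pdivlMr// mulrCA mulrDr mulr1 [th * _]mulrC.
  by lra.
move=> th0 th1.
(* Order of choices: [theta], then [gam], then the mesh. The constant [C2] depends on none of them,
   so the fixed number [(2 * r) ^+ n] will be at most [C2 * theta] for every small [theta]. *)
have /choice[gam gamP] : forall s, exists k : 'rV[R]_n -> R, continuous k /\
    (\int[mu]_(x in B) (`|G s x - k x| ^+ n)%:E <= theta%:E)%E.
  move=> s; have r2 : 0 <= 2 * rho by have := rho0; lra.
  have [k ck kG] := continuous_dense_Ln n0 r2 th0 (mG s) (powG s).
  by exists k.
have cgam s : continuous (gam s) by have [] := gamP s.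
pose E (y : 'rV[R]_n) := \sum_s `|G s y - gam s y|.
have E0 y : 0 <= E y by exact: sumr_ge0.
have mgam s : measurable_fun B (gam s).
  exact: (measurable_funS measurableT (@subsetT _ _) (continuous_measurable_rV n0 (cgam s))).
have md s : measurable_fun B (fun y => `|G s y - gam s y|).
  by apply: measurableT_comp; [exact: normr_measurable|exact: measurable_funB].
have mE : measurable_fun B E.
  by apply: measurable_sum => s; exact: md.
have mEn : measurable_fun B (fun y => E y ^+ n) by exact: measurable_funX.
have Ebound : (\int[mu]_(y in B) (E y ^+ n)%:E <= (M ^+ n * M * theta)%:E)%E.
  have mp s : measurable_fun B (fun y => (`|G s y - gam s y| ^+ n)%:E).
    by apply/measurable_EFinP; apply: measurable_funX; exact: md.
  have Mn0 : 0 <= M ^+ n by rewrite exprn_ge0// ler0n.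
  apply: (@le_trans _ _ (\int[mu]_(y in B) ((M ^+ n)%:E * \sum_s (`|G s y - gam s y| ^+ n)%:E))%E).
    apply: ge0_le_integral; first exact: mB.
    - by move=> y _; rewrite lee_fin exprn_ge0.
    - exact/measurable_EFinP.
    - by apply: emeasurable_funM; [exact: measurable_cst|apply: emeasurable_sum => s; exact: mp].
    - by move=> y _; rewrite sumEFin -EFinM lee_fin; exact: sum_exp_le.
  rewrite (ge0_integralZl_EFin mu mB _ _ Mn0); last 2 first.
  - by move=> y _; apply: sume_ge0 => s _; rewrite lee_fin exprn_ge0.
  - by apply: emeasurable_sum => s; exact: mp.
  have p0 s y : B y -> (0 <= (`|G s y - gam s y| ^+ n)%:E)%E by rewrite lee_fin exprn_ge0.
  rewrite (ge0_integral_sum mu mB mp p0).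
  rewrite -mulrA EFinM lee_wpmul2l ?lee_fin//.
  apply: (@le_trans _ _ (\sum_(s : S) theta%:E)%E).
    by apply: lee_sum => s _; have [] := gamP s.
  by rewrite sumEFin sumr_const -mulr_natl.
have iEn : mu.-integrable B (EFin \o (fun y => E y ^+ n)).
  apply/integrableP; split; first exact/measurable_EFinP.
  rewrite (eq_integral (fun y : Rn R n => (E y ^+ n)%:E)).
    by apply: le_lt_trans Ebound _; exact: ltry.
  by move=> y _; rewrite gee0_abs// lee_fin exprn_ge0.
have ic : mu.-integrable B (EFin \o cst (1 : R)).
  apply: measurable_bounded_integrable => //.
  by exists 1; split; [exact: num_real|move=> t ct y _ /=; rewrite normr1 ltW].
have iE : mu.-integrable B (EFin \o E).
  apply: (le_integrable mB _ _ (integrableD mB ic iEn)); first exact/measurable_EFinP.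
  move=> y _; rewrite /= lee_fin !ger0_norm ?addr_ge0 ?exprn_ge0//.
  have [E1|E1] := leP (E y) 1; first by rewrite (le_trans E1)// lerDl exprn_ge0.
  rewrite (@le_trans _ _ (E y ^+ n))// ?lerDr//.
  by rewrite -[leLHS]expr1 ler_eXn2l.
have [h1 h10 H1] := uniform_continuity_cube (@cube_compact R n x0 (2 * rho)) th0 (fun s x _ => cgam s x).
have [h2 h20 H2] := uniform_continuity_cube (I := S) (g := Ph) (@cube_compact R n x0 (2 * rho)) th0
  (fun s x xB => match s with inl i => C2_cont1 (i:=i) Phi (B3 xB) | inr p => C2_cont2 (i:=p.1) (j:=p.2) Phi (B3 xB) end).
have z0 : 0 < delta / (4 * (A * 3 ^+ n)) by rewrite divr_gt0// !mulr_gt0// exprn_gt0.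
have [h3 h30 H3] := uniform_continuity_cube (I := unit) (g := fun=> f) (@cube_compact R n x0 (2 * rho)) z0
  (fun _ x xB => weak2_cont W (BOm xB)).
(* Enlarged cells are three meshes wide, hence the thirds for [gam] and [Ph]; [f] is compared on
   kernel supports only, and [rho] keeps the enlarged cells in the cube of size [2 * rho]. *)
pose hm := Num.min (Num.min (h1 / 3) (h2 / 3)) (Num.min h3 rho).
have hm0 : 0 < hm by rewrite !lt_min !divr_gt0// h30 rho0.
pose N := (Num.truncn (2 * rho / hm)).+1.
have N0 : (0 < N)%N by [].
have NR : 0 < N%:R :> R by rewrite ltr0n.
have hhm : 2 * rho / N%:R <= hm.
  have : 2 * rho / hm < N%:R by rewrite truncnS_gt.
  by rewrite ltr_pdivrMr// ler_pdivrMr// [N%:R * _]mulrC => /ltW.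
have [hh1 hh2 hh3 hhr] : [/\ 3 * (2 * rho / N%:R) <= h1, 3 * (2 * rho / N%:R) <= h2,
    2 * rho / N%:R <= h3 & 2 * rho / N%:R <= rho].
  by move: hhm; rewrite /hm !le_min => /andP[/andP[q1 q2] /andP[q3 q4]]; move: q1 q2 q3 q4; move: (2 * rho / N%:R) => z q1 q2 q3 q4; split => //; lra.
have h0 : 0 < 2 * rho / N%:R by rewrite divr_gt0// mulr_gt0.
have [F [F1 [F2 [CF FE]]]] := weak2_mollify n0 oOm W BOm h0.
have ugam s x y : cube x0 (2 * rho) x -> cube x (3 * (2 * rho / N%:R)) y -> `|gam s y - gam s x| <= theta.
  by move=> xB xy; apply: H1 => // i; exact: le_trans (xy i) hh1.
have uphi s x y : cube x0 (2 * rho) x -> cube x (3 * (2 * rho / N%:R)) y -> `|Ph s y - Ph s x| <= theta.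
  by move=> xB xy; apply: H2 => // i; exact: le_trans (xy i) hh2.
have uf x y : cube x0 (2 * rho) x -> cube x (2 * rho / N%:R) y -> `|f y - f x| <= delta / (4 * (A * 3 ^+ n)).
  by move=> xB xy; apply: (H3 tt) => // i; exact: le_trans (xy i) hh3.
have S1 := contact_cells_sum th0 N0 hhr ugam uphi uf CF FE iE (ltW r0) rd rk.
have EI : \int[mu]_(y in B) E y ^+ n <= M ^+ n * M * theta.
  by rewrite -lee_fin (EFin_Rintegral mB iEn).
have S2 := sum_cells_le th0 N0 hhr iE iEn EI.
apply: (le_trans S1); apply: (le_trans S2).
rewrite -/D -/C1 /C2 -[leRHS]mulrA.
apply: ler_wpM2l; first by rewrite exprn_ge0// !mulr_ge0.
rewrite -[leRHS]mulrA ler_wpM2l ?exprn_ge0// [leRHS]mulrDl.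
apply: lerD; first by rewrite !mulrA.
apply: ler_wpM2l; first by rewrite exprn_ge0// mulr_ge0// ltW.
(* Since [theta <= 1], its n-th power is at most [theta]. *)
rewrite -(prednK n0) exprS ger_pMr//.
by rewrite exprn_ile1// ltW.
Qed.

End Bony.

(** * Differences of weakly differentiable functions and sums with C^2 functions *)

Section WeakSub.
Context {R : realType} {n : nat}.
Hypothesis n0 : (0 < n)%N.
Local Notation mu := (@lebesgue_rV R n).
Variables (Om : set 'rV[R]_n) (oOm : open Om).

Lemma pderiv_eq0 (phi : 'rV[R]_n -> R) s x : ~ closure [set y | phi y != 0] x -> pderiv s phi x = 0.
Proof.
have oC : open (~` closure [set y | phi y != 0]).
  by apply: closed_openC; exact: closed_closure.
elim: s x => [|i s IH] x xC /=.
  by apply: contrapT => /eqP px; apply: xC; exact: subset_closure.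
rewrite (@near_eq_derive _ _ _ _ (cst 0)) ?derive_cst//.
by apply: (filterS _ (open_nbhs_nbhs (conj oC xC))) => y /IH.
Qed.

Lemma compact_measurable_rV (K : set 'rV[R]_n) : compact K -> measurable (K : set (Rn R n)).
Proof.
by move=> cK; apply: closed_measurable_rV => //; apply: compact_closed => //; exact: norm_hausdorff.
Qed.

Lemma loc_integrable_compact (f : 'rV[R]_n -> R) (K : set 'rV[R]_n) : loc_integrable Om f -> compact K ->
  K `<=` Om -> mu.-integrable K (EFin \o f).
Proof.
move=> [mf fi] cK sub; apply/integrableP; split; last exact: fi.
by apply/measurable_EFinP; exact: (measurable_funS (open_measurable_rV n0 oOm) sub mf).
Qed.

Lemma loc_integrableB (f g : 'rV[R]_n -> R) : loc_integrable Om f -> loc_integrable Om g ->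
  loc_integrable Om (fun x => f x - g x).
Proof.
move=> F G; split; first by apply: measurable_funB; [exact: F.1|exact: G.1].
move=> K cK KOm; have mK := compact_measurable_rV cK.
have := integrableB mK (loc_integrable_compact F cK KOm) (loc_integrable_compact G cK KOm).
by case/integrableP.
Qed.

Lemma loc_integrable0 : loc_integrable Om (fun=> 0).
Proof.
split; first exact: measurable_cst.
move=> K cK _; rewrite (eq_integral (cst 0%E)) ?integral0 ?ltry//.
by move=> y _; rewrite normr0.
Qed.

Lemma is_weak_pderiv0 s : is_weak_pderiv Om s (fun=> 0) (fun=> 0).
Proof.
split; [exact: loc_integrable0|exact: loc_integrable0|move=> phi _].
have E (h : 'rV[R]_n -> R) : \int[mu]_(x in Om) (0 * h x) = 0.
  by rewrite /Rintegral (eq_integral (cst 0%E)) ?integral0// => y _; rewrite mul0r.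
by rewrite !E mulr0.
Qed.

Lemma is_weak_pderivB s (f g f' g' : 'rV[R]_n -> R) : is_weak_pderiv Om s f f' -> is_weak_pderiv Om s g g' ->
  is_weak_pderiv Om s (fun x => f x - g x) (fun x => f' x - g' x).
Proof.
move=> [lf lf' F] [lg lg' G]; split; [exact: loc_integrableB|exact: loc_integrableB|].
move=> phi tphi; have [ck cK KOm] := tphi.
(* The functions are only locally integrable, so the integrals are first reduced to the compact
   support of [phi], where they may be split. *)
set K := closure _ in cK KOm.
have mK := compact_measurable_rV cK.
have bnd t : exists M : R, forall y, K y -> `|pderiv t phi y| <= M.
  have c0 : {within K, continuous (pderiv t phi)}.
    by apply: continuous_in_subspaceT => y _; exact: (ck (size t)).2.
  have /compact_bounded[M [_ MP]] := continuous_compact c0 cK.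
  by exists (M + 1) => y Ky; apply: MP; [rewrite ltrDl|exists y].
have I t h : loc_integrable Om h ->
    mu.-integrable K (EFin \o (fun y => h y * pderiv t phi y)).
  move=> lh; have [M MP] := bnd t.
  apply: (@integrable_mul_bounded _ _ _ _ _ _ _ M) => //; first exact: loc_integrable_compact.
  apply: (@measurable_funS _ _ _ _ setT) => //.
  by apply: continuous_measurable_rV => // y; exact: (ck (size t)).2.
have Eq t h1 h2 : loc_integrable Om h1 -> loc_integrable Om h2 ->
    \int[mu]_(x in Om) ((h1 x - h2 x) * pderiv t phi x) =
    \int[mu]_(x in Om) (h1 x * pderiv t phi x) - \int[mu]_(x in Om) (h2 x * pderiv t phi x).
  move=> l1 l2; have z h y : ~ K y -> h y * pderiv t phi y = 0 by move=> Ky; rewrite pderiv_eq0 ?mulr0.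
  rewrite (Rintegral_supp KOm (z _)) (Rintegral_supp KOm (z h1)) (Rintegral_supp KOm (z h2)).
  rewrite -(RintegralB mK (I t h1 l1) (I t h2 l2)).
  by apply: eq_Rintegral => y _; rewrite mulrBl.
by rewrite (Eq s)// (Eq [::])// mulrBr F// G.
Qed.

Lemma weak2_zero : weak2 Om (fun=> 0 : R) (fun _ _ => 0) (fun _ _ _ => 0).
Proof.
have Z x r : (\int[mu]_(y in cube x r) (`|0 : R| ^+ n)%:E < +oo)%E.
  rewrite (eq_integral (cst 0%E)) ?integral0 ?ltry// => y _.
  by rewrite normr0 expr0n gtn_eqF.
split; [|by move=> i; exact: is_weak_pderiv0|by move=> i j; exact: is_weak_pderiv0|..] => *;
  [exact: cst_continuous|exact: Z|exact: Z].
Qed.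

Lemma weak2B f f1 f2 g g1 g2 : weak2 Om f f1 f2 -> weak2 Om g g1 g2 ->
  weak2 Om (fun x => f x - g x) (fun i x => f1 i x - g1 i x) (fun i j x => f2 i j x - g2 i j x).
Proof.
move=> F G.
have P h k x r r' : 0 < r -> r < r' -> cube x r' `<=` Om ->
    loc_integrable Om h -> loc_integrable Om k ->
    (\int[mu]_(y in cube x r) (`|h y| ^+ n)%:E < +oo)%E ->
    (\int[mu]_(y in cube x r) (`|k y| ^+ n)%:E < +oo)%E ->
    (\int[mu]_(y in cube x r) (`|h y - k y| ^+ n)%:E < +oo)%E.
  move=> r0 rr sub [mh _] [mk _] ih ik.
  have sub' : cube x r `<=` Om.
    by move=> y xy; apply: sub => i; rewrite (le_trans (xy i))// ltW.
  have mC : measurable (cube x r : set (Rn R n)) := measurable_cube n0 x r.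
  have mh' := measurable_fun_cube n0 oOm mh sub'.
  have mk' := measurable_fun_cube n0 oOm mk sub'.
  have mp (l : 'rV[R]_n -> R) : measurable_fun (cube x r : set (Rn R n)) l ->
      measurable_fun (cube x r : set (Rn R n)) (fun y => (`|l y| ^+ n)%:E).
    move=> ml; apply/measurable_EFinP; apply: measurable_funX.
    by apply: measurableT_comp; [exact: normr_measurable|].
  have t0 : 0 <= 2 ^+ n :> R by rewrite exprn_ge0.
  apply: (@le_lt_trans _ _ (\int[mu]_(y in cube x r)
      ((2 ^+ n)%:E * ((`|h y| ^+ n)%:E + (`|k y| ^+ n)%:E)))%E).
    apply: ge0_le_integral; first exact: mC.
    - by move=> y _; rewrite lee_fin exprn_ge0.
    - by apply: mp; exact: measurable_funB.
    - by apply: emeasurable_funM; [exact: measurable_cst|apply: emeasurable_funD; exact: mp].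
    - by move=> y _; rewrite -EFinD -EFinM lee_fin -[`|k y|]normrN exprD_le.
  rewrite (ge0_integralZl_EFin mu mC _ _ t0); last 2 first.
  - by move=> y _; rewrite -EFinD lee_fin addr_ge0// exprn_ge0.
  - by apply: emeasurable_funD; exact: mp.
  have p0 (l : 'rV[R]_n -> R) y : cube x r y -> (0 <= (`|l y| ^+ n)%:E)%E.
    by rewrite lee_fin exprn_ge0.
  rewrite (ge0_integralD mu mC (p0 h) (mp h mh') (p0 k) (mp k mk')).
  by rewrite lte_mul_pinfty// lte_add_pinfty.
split.
- by move=> x Ox; apply: continuousB; [exact: (weak2_cont F)|exact: (weak2_cont G)].
- by move=> i; apply: is_weak_pderivB; [exact: weak2_derive1 F i|exact: weak2_derive1 G i].
- by move=> i j; apply: is_weak_pderivB; [exact: weak2_derive2 F i j|exact: weak2_derive2 G i j].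
- move=> i x r r' r0 rr sub; apply: (P _ _ _ _ r') => //.
  + by have [] := weak2_derive1 F i.
  + by have [] := weak2_derive1 G i.
  + exact: weak2_int1 F i x r r' r0 rr sub.
  + exact: weak2_int1 G i x r r' r0 rr sub.
- move=> i j x r r' r0 rr sub; apply: (P _ _ _ _ r') => //.
  + by have [] := weak2_derive2 F i j.
  + by have [] := weak2_derive2 G i j.
  + exact: weak2_int2 F i j x r r' r0 rr sub.
  + exact: weak2_int2 G i j x r r' r0 rr sub.
Qed.

(* Functions on an open subset U of Om which are the sum of a W^{2,n}_loc(Om) function and
   a C^2(U) function, with their derivatives of order one and two. *)
Definition D2on (U : set 'rV[R]_n) (w : 'rV[R]_n -> R) (w1 : 'I_n -> 'rV[R]_n -> R)
    (w2 : 'I_n -> 'I_n -> 'rV[R]_n -> R) : Prop :=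
  exists f g1 g2 phi phi1 phi2, [/\ weak2 Om f g1 g2, C2on U phi phi1 phi2,
    forall x, w x = f x + phi x, forall i x, w1 i x = g1 i x + phi1 i x &
    forall i j x, w2 i j x = g2 i j x + phi2 i j x].

Lemma D2on_weak2 U f f1 f2 : weak2 Om f f1 f2 -> D2on U f f1 f2.
Proof.
move=> F; exists f, f1, f2, (fun=> 0), (fun _ _ => 0), (fun _ _ _ => 0).
split => // [|x|i x|i j x]; rewrite ?addr0//.
by split => *; [exact: cst_continuous..|exact: is_derive_cst|exact: is_derive_cst|].
Qed.

Lemma D2on_C2on U f f1 f2 : C2on U f f1 f2 -> D2on U f f1 f2.
Proof.
move=> F; exists (fun=> 0), (fun _ _ => 0), (fun _ _ _ => 0), f, f1, f2.
by split => // [|x|i x|i j x]; rewrite ?add0r//; exact: weak2_zero.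
Qed.

Lemma D2on_sub U V f f1 f2 : V `<=` U -> D2on U f f1 f2 -> D2on V f f1 f2.
Proof.
move=> VU [k [k1 [k2 [p [p1 [p2 [? P ? ? ?]]]]]]].
by exists k, k1, k2, p, p1, p2; split => //; exact: C2on_sub VU P.
Qed.

Lemma D2onB U f f1 f2 g g1 g2 : D2on U f f1 f2 -> D2on U g g1 g2 ->
  D2on U (fun x => f x - g x) (fun i x => f1 i x - g1 i x) (fun i j x => f2 i j x - g2 i j x).
Proof.
move=> [k [k1 [k2 [p [p1 [p2 [K P e0 e1 e2]]]]]]] [l [l1 [l2 [q [q1 [q2 [L Q d0 d1 d2]]]]]]].
exists (fun x => k x - l x), (fun i x => k1 i x - l1 i x), (fun i j x => k2 i j x - l2 i j x).
exists (fun x => p x + - q x), (fun i x => p1 i x + - q1 i x), (fun i j x => p2 i j x + - q2 i j x).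
split; [exact: weak2B K L|exact: C2onD P (C2onN Q)|move=> x|move=> i x|move=> i j x];
  rewrite ?e0 ?e1 ?e2 ?d0 ?d1 ?d2 opprD addrACA //.
Qed.

Lemma D2on_cont U f f1 f2 x : U `<=` Om -> D2on U f f1 f2 -> U x -> {for x, continuous f}.
Proof.
move=> UOm [k [k1 [k2 [p [p1 [p2 [K P e0 _ _]]]]]]] Ux.
rewrite (_ : f = (fun x => k x + p x)); last by apply/funext.
by apply: continuousD; [apply: (weak2_cont K); exact: UOm|exact: C2_cont P _ Ux].
Qed.

End WeakSub.

Lemma sum_le_const (R : numDomainType) (n : nat) (F : 'I_n -> R) M :
  (forall i, F i <= M) -> \sum_(i < n) F i <= n%:R * M.
Proof.
move=> FM; rewrite mulr_natl -[X in _ *+ X]card_ord -sumr_const.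
by apply: ler_sum => i _; exact: FM.
Qed.

Section Quadratic.
Context {R : realType} {n : nat}.
Implicit Types (x y z : 'rV[R]_n).

(** One family for all quadratic comparisons: [beta = -1] for the ball barrier, [beta = 0] with
    [gam] a unit normal for the signed distance to a hyperplane, small negative [beta] to make a
    maximum strict, positive [beta] for the bump in [sol_le]. *)
Definition quad z (beta : R) (gam : 'I_n -> R) y : R :=
  \sum_(i < n) (beta * (y 0 i - z 0 i) ^+ 2 + gam i * (y 0 i - z 0 i)).

Lemma is_derive_coord x (i j : 'I_n) :
  is_derive x (delta_mx 0 j) (fun y : 'rV[R]_n => y 0 i) ((i == j)%:R : R).
Proof.
apply: is_derive_line0.
rewrite (_ : (fun s => _) = (fun s : R => x 0 i + (i == j)%:R * s)); last first.
  by apply/funext => s; rewrite !mxE eqxx/= mulrC.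
have D := is_deriveD (is_derive_cst (x 0 i) (0 : R) 1)
  (is_deriveZ (i == j)%:R (is_derive_id (0 : R) 1)).
by apply: (is_derive_eq D); rewrite add0r /GRing.scale/= mulr1.
Qed.

Lemma quad_C2on z beta gam : C2on setT (quad z beta gam)
  (fun i y => 2 * beta * (y 0 i - z 0 i) + gam i) (fun i j _ => 2 * beta * (i == j)%:R).
Proof.
have cc i : continuous (fun y : 'rV[R]_n => y 0 i - z 0 i).
  by move=> y; apply: continuousB; [exact: coord_continuous|exact: cst_continuous].
split.
- move=> x _; apply: continuous_sum_at => i; apply: continuousD.
    apply: continuousM; first exact: cst_continuous.
    by apply: (@continuousM _ _ (fun y : 'rV[R]_n => y 0 i - z 0 i) (fun y : 'rV[R]_n => y 0 i - z 0 i)); exact: cc.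
  by apply: continuousM; [exact: cst_continuous|exact: cc].
- move=> i x _; apply: continuousD; last exact: cst_continuous.
  by apply: continuousM; [exact: cst_continuous|exact: cc].
- by move=> i j x _; exact: cst_continuous.
- move=> j x _.
  have D i : is_derive x (delta_mx 0 j) (fun y : 'rV[R]_n => beta * (y 0 i - z 0 i) ^+ 2 + gam i * (y 0 i - z 0 i))
      ((i == j)%:R * (2 * beta * (x 0 i - z 0 i) + gam i)).
    have d1 := is_deriveB (is_derive_coord x i j) (is_derive_cst (z 0 i) x (delta_mx 0 j)).
    have d2 := is_deriveD (is_deriveZ beta (is_deriveM d1 d1)) (is_deriveZ (gam i) d1).
    apply: (is_derive_eq d2).
    by rewrite /GRing.scale/= subr0 (_ : ((fun y : 'rV[R]_n => y 0 i) - cst (z 0 i)) x = x 0 i - z 0 i)//; ring.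
  have S := is_derive_sum D.
  rewrite (_ : quad z beta gam = \sum_(i < n) (fun y : 'rV[R]_n => beta * (y 0 i - z 0 i) ^+ 2 + gam i * (y 0 i - z 0 i))); last first.
    by apply/funext => y; rewrite fct_sumE.
  apply: (is_derive_eq S); rewrite (bigD1 j)//= eqxx mul1r big1 ?addr0// => i /negbTE ->.
  by rewrite mul0r.
- move=> i j x _.
  have d1 := is_deriveB (is_derive_coord x i j) (is_derive_cst (z 0 i) x (delta_mx 0 j)).
  have d2 := is_deriveD (is_deriveZ (2 * beta) d1) (is_derive_cst (gam i) x (delta_mx 0 j)).
  by apply: (is_derive_eq d2); rewrite /GRing.scale/= subr0 addr0.
- by move=> i j x _; rewrite eq_sym.
Qed.

End Quadratic.

Definition diff_op {R : realType} {n : nat} (a : 'I_n -> 'I_n -> 'rV[R]_n -> R)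
    (b : 'I_n -> 'rV[R]_n -> R) (w1 : 'I_n -> 'rV[R]_n -> R)
    (w2 : 'I_n -> 'I_n -> 'rV[R]_n -> R) (y : 'rV[R]_n) : R :=
  \sum_(i < n) \sum_(j < n) a i j y * w2 i j y + \sum_(i < n) b i y * w1 i y.

Record coef_bounds {R : realType} {n : nat} (U : set 'rV[R]_n)
    (a : 'I_n -> 'I_n -> 'rV[R]_n -> R) (b : 'I_n -> 'rV[R]_n -> R) (lam A0 : R) : Prop :=
  coef_intro {
  coef_lam : 0 < lam;
  coef_A0 : 0 < A0;
  coef_sym : forall y, U y -> symf (fun i j => a i j y);
  coef_ell : forall y, U y -> forall xi,
     lam * (\sum_(i < n) xi i ^+ 2) <= qform (fun i j => a i j y) xi;
  coef_a : forall y, U y -> forall i j, `|a i j y| <= A0;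
  coef_b : forall y, U y -> forall i, `|b i y| <= A0 }.

Section MaxPrinciple.
Context {R : realType} {n : nat}.
Hypothesis n0 : (0 < n)%N.
Local Notation mu := (@lebesgue_rV R n).
Variables (Om : set 'rV[R]_n) (oOm : open Om).
Variables (a : 'I_n -> 'I_n -> 'rV[R]_n -> R) (b : 'I_n -> 'rV[R]_n -> R) (lam A0 : R).
Hypothesis coef : coef_bounds Om a b lam A0.

Let aeF : Filter (almost_everywhere mu) := ae_filter_ringOfSetsType mu.

Lemma diff_opD (w1 v1 : 'I_n -> 'rV[R]_n -> R) (w2 v2 : 'I_n -> 'I_n -> 'rV[R]_n -> R) y :
  diff_op a b (fun i x => w1 i x + v1 i x) (fun i j x => w2 i j x + v2 i j x) y =
  diff_op a b w1 w2 y + diff_op a b v1 v2 y.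
Proof.
rewrite /diff_op [RHS]addrACA; congr (_ + _); rewrite -big_split.
  by apply: eq_bigr => i _; rewrite -big_split; apply: eq_bigr => j _; rewrite mulrDr.
by apply: eq_bigr => i _; rewrite mulrDr.
Qed.

Lemma diff_opB (w1 v1 : 'I_n -> 'rV[R]_n -> R) (w2 v2 : 'I_n -> 'I_n -> 'rV[R]_n -> R) y :
  diff_op a b (fun i x => w1 i x - v1 i x) (fun i j x => w2 i j x - v2 i j x) y =
  diff_op a b w1 w2 y - diff_op a b v1 v2 y.
Proof.
rewrite /diff_op opprD addrACA; congr (_ + _); rewrite -sumrB.
  by apply: eq_bigr => i _; rewrite -sumrB; apply: eq_bigr => j _; rewrite mulrBr.
by apply: eq_bigr => i _; rewrite mulrBr.
Qed.

Lemma diff_op_quad (z : 'rV[R]_n) (beta : R) (gam : 'I_n -> R) (y : 'rV[R]_n) :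
  diff_op a b (fun i y => 2 * beta * (y 0 i - z 0 i) + gam i) (fun i j _ => 2 * beta * (i == j)%:R) y =
  2 * beta * \sum_(i < n) a i i y + \sum_(i < n) b i y * (2 * beta * (y 0 i - z 0 i) + gam i).
Proof.
rewrite /diff_op; congr (_ + _); rewrite mulr_sumr; apply: eq_bigr => i _.
rewrite (bigD1 i)//= eqxx mulr1 big1 ?addr0 1?mulrC// => j /negbTE ji.
by rewrite eq_sym ji !mulr0.
Qed.

(** Subtracting [s * |y - x0|^2] makes the maximum strict, with drop [s * rho ^+ 2] on the boundary
    of the cube. As [Cq] bounds the operator applied to the squared distance there, [s] is chosen so
    that at most [kappa / 2] is lost. *)
Theorem max_principle U w w1 w2 x0 kappa : open U -> U `<=` Om ->
  D2on Om U w w1 w2 -> U x0 -> (forall y, U y -> w y <= w x0) -> 0 < kappa ->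
  {ae mu, forall y : 'rV[R]_n, U y -> kappa <= diff_op a b w1 w2 y} -> False.
Proof.
move=> oU UOm [f [g1 [g2 [phi [phi1 [phi2 [F P e0 e1 e2]]]]]]] Ux0 wmax kappa0 Lw.
have [lam0 A00 a_sym a_ell a_bnd b_bnd] := coef.
have /nbhs_rVP[r r0 rU] : nbhs x0 U by exact: open_nbhs_nbhs.
pose rho := r / 4.
have rho0 : 0 < rho by rewrite divr_gt0.
have cU : cube x0 (3 * rho) `<=` U.
  by move=> y xy; apply: rU => i; apply: (le_lt_trans (xy i)); rewrite /rho; have := r0; lra.
pose Cq := n%:R * (2 * A0 + A0 * (2 * (3 * rho))).
have Cq0 : 0 <= Cq by rewrite mulr_ge0// addr_ge0 ?mulr_ge0 ?ltW.
have n1R : 1 <= n%:R :> R by rewrite ler1n.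
pose s := kappa / (2 * (Cq + 1)).
have s0 : 0 < s by rewrite divr_gt0//; lra.
have sC : s * Cq <= kappa / 2.
  rewrite /s mulrAC ler_pdivrMr; last by lra.
  have -> : kappa / 2 * (2 * (Cq + 1)) = kappa * Cq + kappa by field.
  by rewrite lerDl ltW.
have Q := C2on_sub (@subsetT _ _) (quad_C2on x0 (- s) (fun=> 0)).
have d0 : 0 < s * rho ^+ 2 by rewrite mulr_gt0// exprn_gt0.
have k20 : 0 < kappa / 2 by rewrite divr_gt0.
have cOm := subset_trans cU UOm.
have Qle y : quad x0 (- s) (fun=> 0) y = - s * \sum_(i < n) (y 0 i - x0 0 i) ^+ 2.
  by rewrite mulr_sumr; apply: eq_bigr => i _; rewrite mul0r addr0.
refine (@bony_strict R n n0 Om f g1 g2 x0 rho _ _ _ a b lam A0 (kappa / 2) (s * rho ^+ 2)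
  oOm F rho0 cOm (C2onD (C2on_sub cU P) (Q _)) lam0 A00 k20 d0 _ _ _ _ _ _).
- by move=> y /cOm; exact: a_sym.
- by move=> y /cOm; exact: a_ell.
- by move=> y /cOm; exact: a_bnd.
- by move=> y /cOm; exact: b_bnd.
- move=> y xy [i yi]; have yU : U y by apply: cU => j; apply: le_trans (xy j) _; have := rho0; lra.
  have := wmax y yU; rewrite !e0 !Qle.
  rewrite [\sum_(i < n) (x0 0 i - _) ^+ 2]big1 ?mulr0 ?addr0; last first.
    by move=> j _; rewrite subrr expr0n.
  have : rho ^+ 2 <= \sum_(i < n) (y 0 i - x0 0 i) ^+ 2.
    rewrite (bigD1 i)//= -[X in X <= _]addr0 lerD ?sumr_ge0// => [|j _]; last exact: sqr_ge0.
    by rewrite -yi real_normK// num_real.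
  move=> /(ler_wpM2l (ltW s0)); lra.
apply: (@filterS _ _ aeF _ _ _ Lw) => y Ly yc.
have := Ly (cU _ yc); have yOm := cOm _ yc.
rewrite (_ : w1 = fun i x => g1 i x + phi1 i x); last by apply/funext => i; apply/funext => x.
rewrite (_ : w2 = fun i j x => g2 i j x + phi2 i j x); last first.
  by apply/funext => i; apply/funext => j; apply/funext => x.
move=> Lk.
have := diff_opD (fun i x => g1 i x + phi1 i x) (fun i y => 2 * (- s) * (y 0 i - x0 0 i) + 0)
  (fun i j x => g2 i j x + phi2 i j x) (fun i j _ => 2 * (- s) * (i == j)%:R) y.
rewrite diff_op_quad => E.
have -> : \sum_(i < n) \sum_(j < n) a i j y * (g2 i j y + (phi2 i j y + 2 * - s * (i == j)%:R)) +
  \sum_(i < n) b i y * (g1 i y + (phi1 i y + (2 * - s * (y 0 i - x0 0 i) + 0))) =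
  diff_op a b (fun i x => g1 i x + phi1 i x + (2 * - s * (x 0 i - x0 0 i) + 0))
    (fun i j x => g2 i j x + phi2 i j x + 2 * - s * (i == j)%:R) y.
  rewrite /diff_op; congr (_ + _); apply: eq_bigr => i _; last by rewrite addrA.
  by apply: eq_bigr => j _; rewrite addrA.
rewrite E.
have T1 : \sum_(i < n) a i i y <= n%:R * A0.
  by apply: sum_le_const => i; exact: le_trans (ler_norm _) (a_bnd y yOm i i).
have T2 : - (\sum_(i < n) b i y * (2 * - s * (y 0 i - x0 0 i) + 0)) <= n%:R * (s * (A0 * (2 * (3 * rho)))).
  rewrite -sumrN; apply: sum_le_const => i.
  rewrite [leLHS](_ : _ = s * (b i y * (2 * (y 0 i - x0 0 i)))); last by ring.
  rewrite ler_wpM2l ?(ltW s0)// (le_trans (ler_norm _))// normrM; apply: ler_pM => //.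
    exact: b_bnd.
  by rewrite normrM ger0_norm// ler_wpM2l//; exact: yc.
have := ler_wpM2l (ltW s0) T1.
move: sC; rewrite /Cq; move: Lk T2; lra.
Qed.

End MaxPrinciple.

(** * Comparison and convex geometry *)

Section Compare.
Context {R : realType} {n : nat}.
Hypothesis n0 : (0 < n)%N.
Local Notation mu := (@lebesgue_rV R n).
Variables (Om : set 'rV[R]_n) (oOm : open Om).
Variables (a : 'I_n -> 'I_n -> 'rV[R]_n -> R) (b : 'I_n -> 'rV[R]_n -> R) (lam A0 : R).
Hypothesis coef : coef_bounds Om a b lam A0.

Let aeF : Filter (almost_everywhere mu) := ae_filter_ringOfSetsType mu.

Lemma diff_op_comp (f1 : 'I_n -> 'rV[R]_n -> R) (f2 : 'I_n -> 'I_n -> 'rV[R]_n -> R)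
    (dg ddg : 'rV[R]_n -> R) y :
  diff_op a b (fun i x => dg x * f1 i x) (fun i j x => ddg x * (f1 i x * f1 j x) + dg x * f2 i j x) y =
  ddg y * qform (fun i j => a i j y) (f1^~ y) + dg y * diff_op a b f1 f2 y.
Proof.
rewrite /diff_op /qform mulrDr !mulr_sumr addrA; congr (_ + _); rewrite -?big_split/=; apply: eq_bigr => i _.
  rewrite !mulr_sumr -big_split/=; apply: eq_bigr => j _; ring.
by rewrite mulrCA.
Qed.

Lemma max_compact (Kc : set 'rV[R]_n) f : compact Kc -> Kc !=set0 ->
  (forall x, Kc x -> {for x, continuous f}) -> exists2 y, Kc y & forall x, Kc x -> f x <= (f y : R).
Proof.
move=> cK K0 cf; have wc : {within Kc, continuous f}.
  by apply: continuous_in_subspaceT => x; rewrite inE; exact: cf.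
have [y yK ymax] := compact_EVT_max K0 cK wc.
by exists y; [rewrite inE in yK|move=> x Kx; apply: ymax; rewrite inE].
Qed.

(** A positive supremum is attained in [Kc]. Continuity of [h] bounds it below by half its value
    near that point, the uniform strictness wanted by [max_principle]. So [h] may degenerate where
    [w] vanishes, as a difference of exponentials does. *)
Lemma comparison U w w1 w2 (Kc : set 'rV[R]_n) (h : 'rV[R]_n -> R) : open U -> U `<=` Om ->
  D2on Om U w w1 w2 -> compact Kc -> Kc `<=` U -> (forall y, U y -> 0 < w y -> Kc y) ->
  (forall y, U y -> {for y, continuous h}) -> (forall y, U y -> 0 < w y -> 0 < h y) ->
  {ae mu, forall y : 'rV[R]_n, U y -> 0 < w y -> h y <= diff_op a b w1 w2 y} ->
  forall y, U y -> w y <= 0.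
Proof.
move=> oU UOm Dw cK KU wK hc h0 Lw y1 Uy1; rewrite leNgt; apply/negP => wy1.
have cw y : U y -> {for y, continuous w} by move=> Uy; exact: (D2on_cont UOm Dw Uy).
have [y0 Ky0 ymax] := max_compact cK (ex_intro _ y1 (wK _ Uy1 wy1)) (fun y Ky => cw y (KU _ Ky)).
have Uy0 := KU _ Ky0.
have wy0 : 0 < w y0 by apply: (lt_le_trans wy1); apply: ymax; exact: wK.
have hy0 := h0 _ Uy0 wy0.
pose V := [set y | U y /\ 0 < w y /\ h y0 / 2 < h y].
have Vy0 : nbhs y0 V.
  have N1 : nbhs y0 U by exact: open_nbhs_nbhs.
  have N2 : nbhs y0 [set y | 0 < w y] := (@cvgr_gt R _ (nbhs y0) (nbhs_filter y0) w (w y0) (cw _ Uy0) 0 wy0).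
  have N3 : nbhs y0 [set y | h y0 / 2 < h y].
    by apply: (@cvgr_gt R _ (nbhs y0) (nbhs_filter y0) h (h y0) (hc _ Uy0)); lra.
  by near=> y; split; [near: y|split; near: y].
have VU : interior V `<=` U by move=> y /interior_subset[].
apply: (@max_principle R n n0 Om oOm a b lam A0 coef (interior V) w w1 w2 y0 (h y0 / 2)).
- exact: open_interior.
- exact: subset_trans UOm.
- exact: D2on_sub VU Dw.
- exact: Vy0.
- move=> y /interior_subset[Uy [wy _]]; apply: ymax; exact: wK.
- by rewrite divr_gt0.
- apply: (@filterS _ _ aeF _ _ _ Lw) => y Ly /interior_subset[Uy [wy hy]].
  exact: le_trans (ltW hy) (Ly Uy wy).
Unshelve. all: by end_near. Qed.

End Compare.

Section Geometry.
Context {R : realType} {n : nat}.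
Implicit Types (x y z : 'rV[R]_n).

Definition sqd z y : R := \sum_(i < n) (y 0 i - z 0 i) ^+ 2.

Lemma sqd_ge0 z y : 0 <= sqd z y.
Proof. by apply: sumr_ge0 => i _; exact: sqr_ge0. Qed.

Lemma sqdxx z : sqd z z = 0.
Proof. by rewrite /sqd big1// => i _; rewrite subrr expr0n. Qed.

Lemma sqd_continuous z : continuous (sqd z).
Proof.
move=> y; apply: continuous_sum_at => i.
apply: (@continuousM _ _ (fun y : 'rV[R]_n => y 0 i - z 0 i) (fun y : 'rV[R]_n => y 0 i - z 0 i));
  by apply: continuousB; [exact: coord_continuous|exact: cst_continuous].
Qed.

Lemma sqd_coord z y i (r : R) : 0 <= r -> sqd z y <= r ^+ 2 -> `|y 0 i - z 0 i| <= r.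
Proof.
move=> r0 H; rewrite -(@ler_pXn2r _ 2)//.
rewrite real_normK ?num_real//; apply: le_trans H.
by rewrite /sqd (bigD1 i)//= lerDl sumr_ge0// => j _; exact: sqr_ge0.
Qed.

Lemma sqd_open z (r : R) : open [set y | sqd z y < r].
Proof.
rewrite openE => y yr; rewrite /interior; exact: (@cvgr_lt R _ (nbhs y) (nbhs_filter y) _ _ (@sqd_continuous z y)).
Qed.

Lemma sqd_compact z (r : R) : 0 <= r -> compact [set y | sqd z y <= r ^+ 2].
Proof.
move=> r0; apply: (subclosed_compact _ (@cube_compact R n z r)).
  rewrite (_ : [set y | _] = ~` [set y | r ^+ 2 < sqd z y]); last first.
    by apply/seteqP; split => y /=; rewrite leNgt => /negP.
  apply: open_closedC; rewrite openE => y yr; rewrite /interior.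
  exact: (@cvgr_gt R _ (nbhs y) (nbhs_filter y) _ _ (@sqd_continuous z y)).
by move=> y H i; exact: sqd_coord.
Qed.

Lemma sqd_enorm z y : enorm (y - z) ^+ 2 = sqd z y.
Proof.
rewrite /enorm sqr_sqrtr; last by apply: sumr_ge0 => i _; exact: sqr_ge0.
by apply: eq_bigr => i _; rewrite !mxE.
Qed.

Lemma bounded_setP (A : set 'rV[R]_n) : bounded_set A ->
  exists2 D, 0 < D & A `<=` cube 0 D.
Proof.
move=> /ex_strict_bound_gt0[D D0 AD]; exists D => // x Ax i.
rewrite mxE subr0; apply: le_trans (ltW (AD _ Ax)).
by rewrite [leRHS]/Num.norm/= mx_normrE; exact: (le_bigmax _ (fun p : 'I_1 * 'I_n => `|x p.1 p.2|) (0, i)).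
Qed.

Variable Om : set 'rV[R]_n.
Hypotheses (oOm : open Om) (cOm : convex_set Om).

Lemma nearest_point x0 : Om x0 -> Om != setT ->
  exists2 z, ~ Om z & forall y, ~ Om y -> sqd x0 z <= sqd x0 y.
Proof.
move=> Ox0 /eqP OmT.
have [p Op] : exists p, ~ Om p.
  by apply: contrapT => H; apply: OmT; apply/seteqP; split => // y _; apply: contrapT => Oy; apply: H; exists y.
pose r := sqd x0 p + 1.
have r0 : 0 <= r by rewrite addr_ge0// sqd_ge0.
have pr : sqd x0 p <= r ^+ 2.
  by have := sqd_ge0 x0 p; rewrite /r; nra.
have cK : compact ([set y | sqd x0 y <= r ^+ 2] `&` ~` Om).
  by apply: compact_closedI; [exact: sqd_compact|exact: open_closedC].
have [z [zr zO] zmax] := max_compact cK (ex_intro _ p (conj pr Op))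
  (fun y _ => continuousN (@sqd_continuous x0 y)).
exists z => // y Oy; have [yr|yr] := leP (sqd x0 y) (r ^+ 2).
  by rewrite -lerN2; exact: zmax.
exact: le_trans zr (ltW yr).
Qed.

Lemma convex_segment x y (t : R) : Om x -> Om y -> 0 <= t <= 1 ->
  Om (\row_i (t * x 0 i + (1 - t) * y 0 i)).
Proof.
move=> Ox Oy /andP[t0 t1]; have := @cOm x y (Itv01 t0 t1) (mem_set Ox) (mem_set Oy).
rewrite inE; congr Om; apply/rowP => i; by rewrite !mxE.
Qed.

(** Suppose [y] is on the wrong side. Openness moves it to [y'] strictly on that side, and the line
    from [y'] through [z], continued slightly beyond [z], reaches a point [m] closer to [x0] than
    [z]. By minimality [m] is in [Om], hence so is [z] by convexity. *)
Lemma supporting_halfspace x0 z : Om x0 -> ~ Om z ->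
  (forall y, ~ Om y -> sqd x0 z <= sqd x0 y) ->
  forall y, Om y -> 0 < \sum_(i < n) (y 0 i - z 0 i) * (x0 0 i - z 0 i).
Proof.
move=> Ox0 Oz zmin y Oy; rewrite ltNge; apply/negP => yle.
pose g i := x0 0 i - z 0 i.
have g0 : 0 < \sum_i g i ^+ 2.
  rewrite lt_neqAle sumr_ge0 ?andbT// => [|i _]; last exact: sqr_ge0.
  apply/negP => /eqP/esym/eqP; rewrite psumr_eq0 => [/allP H|i _]; last exact: sqr_ge0.
  apply: Oz; rewrite (_ : z = x0)//; apply/rowP => i.
  have /implyP/(_ isT) := H i (mem_index_enum i).
  by rewrite sqrf_eq0 subr_eq0 => /eqP.
have /nbhs_rVP[e e0 yO] : nbhs y Om by exact: open_nbhs_nbhs.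
have [G G0 gG] : exists2 G : R, 0 < G & forall i, `|g i| <= G.
  exists (1 + \sum_i `|g i|); first by rewrite ltr_pwDl// sumr_ge0.
  by move=> i; rewrite (bigD1 i)//= addrCA lerDl addr_ge0// sumr_ge0.
pose s := e / (2 * G).
have s0 : 0 < s by rewrite divr_gt0// mulr_gt0.
pose y' := \row_i (y 0 i - s * g i).
have Oy' : Om y'.
  apply: yO => i; rewrite mxE addrAC subrr add0r normrN normrM (gtr0_norm s0).
  rewrite (@le_lt_trans _ _ (s * G))// ?ler_wpM2l ?(ltW s0)//.
  by rewrite /s invfM mulrA mulfVK ?gt_eqF//; lra.
pose p := \sum_i (y' 0 i - z 0 i) * g i.
have p0 : p < 0.
  rewrite /p (eq_bigr (fun i => (y 0 i - z 0 i) * g i - s * g i ^+ 2)); last first.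
    by move=> i _; rewrite mxE; ring.
  rewrite sumrB -mulr_sumr; have := mulr_gt0 s0 g0.
  by move: yle; rewrite -/(g _); lra.
pose Q := sqd z y'.
have Q0 : 0 <= Q := sqd_ge0 z y'.
pose t := - p / (Q + 1).
have t0 : 0 < t by rewrite divr_gt0 ?oppr_gt0//; lra.
pose m := \row_i (z 0 i + t * (z 0 i - y' 0 i)).
have Om_m : Om m.
  apply: contrapT => /zmin; apply/negP; rewrite -ltNge.
  rewrite (_ : sqd x0 m = sqd x0 z + t * (2 * p + t * Q)); last first.
    rewrite /sqd /p /Q /sqd mulrDr !mulr_sumr -!big_split/=; apply: eq_bigr => i _.
    by rewrite /g !mxE; ring.
  rewrite gtrDl pmulr_rlt0//.
  have : t * Q <= - p.
    rewrite /t mulrAC ler_pdivrMr ?ltr_wpDl// mulrDr mulr1 lerDl oppr_ge0; exact: ltW.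
  by lra.
apply: Oz; have t1 : 0 < 1 + t by lra.
have := @convex_segment m y' (1 + t)^-1 Om_m Oy'.
rewrite (_ : \row_i _ = z); last first.
  by apply/rowP => i; rewrite !mxE; field; rewrite gt_eqF.
by apply; rewrite invr_ge0 ltW//= invf_le1//; lra.
Qed.

End Geometry.

(** * Barriers *)

Section Barriers.
Context {R : realType} {n : nat}.
Hypothesis n0 : (0 < n)%N.
Local Notation mu := (@lebesgue_rV R n).
Variables (Om : set 'rV[R]_n) (oOm : open Om).
Variables (a : 'I_n -> 'I_n -> 'rV[R]_n -> R) (b : 'I_n -> 'rV[R]_n -> R) (c : 'rV[R]_n -> R)
  (lam A0 K alpha : R).
Hypotheses (coef : coef_bounds Om a b lam A0) (K0 : 0 < K) (alpha0 : 0 < alpha)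
  (c_bound : forall x, Om x -> 0 <= c x <= K).

Let aeF : Filter (almost_everywhere mu) := ae_filter_ringOfSetsType mu.

(** Common form of the two notions of solution. The zero-order term stands on the right, so the
    comparison deals with [diff_op] alone and the sign of [c u] is discussed case by case. *)
Definition blowup_sol (u : 'rV[R]_n -> R) u1 u2 : Prop :=
  [/\ D2on Om Om u u1 u2,
      {ae mu, forall y : 'rV[R]_n, Om y -> diff_op a b u1 u2 y = expR (alpha * u y) + c y * u y} &
      blows_up Om u].

Lemma exp_barrier (p X : R) : 0 < p -> 0 < X ->
  expR (alpha * (- (2 / alpha) * ln p + ln X / alpha)) = X / p ^+ 2.
Proof.
move=> p0 X0; have a0 : alpha != 0 by rewrite gt_eqF.
rewrite (_ : alpha * _ = ln X - 2%:R * ln p); last by field.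
by rewrite expRD expRN expRM_natl !lnK.
Qed.

Lemma continuous_exp_scaled (f : 'rV[R]_n -> R) y : {for y, continuous f} ->
  {for y, continuous (fun x => expR (alpha * f x))}.
Proof.
move=> cf; apply: (@continuous_comp _ _ _ (fun x => alpha * f x) expR); last exact: continuous_expR.
by apply: continuousM; [exact: cst_continuous|].
Qed.

(** The points at distance at least [d] from the boundary contain the sublevel set. A limit of such
    points outside [Om] would be a boundary point, and nearby points would be closer to it than
    [d]. *)
Lemma blow_compact v M : bounded_set Om -> blows_up Om v ->
  exists Kc, [/\ compact Kc, Kc `<=` Om & forall y, Om y -> v y <= M -> Kc y].
Proof.
move=> bOm /(_ M)[d d0 dv].
pose S := [set y | Om y /\ d <= Defs.edist y (boundary Om)].
have cS : compact (closure S).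
  have [D D0 OD] := bounded_setP bOm.
  apply: (subclosed_compact (@closed_closure _ S) (@cube_compact R n 0 D)).
  rewrite [X in _ `<=` X](closure_id _).1; last exact: compact_cube_closed.
  by apply: closureS => y [/OD].
exists (closure S); split => // [x Sx|y Oy vy].
  apply: contrapT => Ox.
  have bx : boundary Om x.
    split; last by move=> /interior_subset.
    by apply: closureS Sx => y [].
  have Nx : nbhs x [set y | sqd x y < d ^+ 2].
    by apply: open_nbhs_nbhs; split; [exact: sqd_open|rewrite /= sqdxx exprn_gt0].
  have [y [[Oy dy] yx]] := Sx _ Nx.
  suff : Defs.edist y (boundary Om) < d by rewrite ltNge dy.
  apply: (@le_lt_trans _ _ (enorm (y - x))).
    apply: ge_inf; last by exists x.
    by exists 0 => _ [w _ <-]; exact: sqrtr_ge0.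
  by rewrite -(@ltr_pXn2r _ 2) ?nnegrE ?sqrtr_ge0 ?(ltW d0)// sqd_enorm.
apply: subset_closure; split => //; rewrite leNgt; apply/negP => /(dv _ Oy).
by rewrite ltNge vy.
Qed.

(** The first summand absorbs the operator applied to the barrier, estimated with
    [|y - x0| <= rho <= D]. The summand [D ^+ 2] makes the barrier nonnegative. *)
Definition up_const (D : R) : R := 2 / alpha * (n%:R * (n%:R * (A0 * (2 * 2))) + (2 * (n%:R * A0) + n%:R * (A0 * (2 * D)))) + D ^+ 2.

(* The barrier is W = -(2/alpha) ln (rho^2 - |y - x0|^2) + ln X / alpha, for which
   exp (alpha W) = X / (rho^2 - |y - x0|^2)^2. *)
Lemma upper_barrier u u1 u2 x0 rho D : blowup_sol u u1 u2 -> 0 < rho -> rho <= D ->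
  (forall y, sqd x0 y <= rho ^+ 2 -> Om y) ->
  expR (alpha * u x0) <= up_const D / rho ^+ 2.
Proof.
move=> [Du Lu _] rho0 rD BOm.
have [lam0 A00 a_sym a_ell a_bnd b_bnd] := coef.
have D0 : 0 < D by exact: lt_le_trans rD.
have a20 : 0 < 2 / alpha by rewrite divr_gt0.
have nR : 0 <= n%:R :> R by [].
pose C1 : R := n%:R * (n%:R * (A0 * (2 * 2))) + (2 * (n%:R * A0) + n%:R * (A0 * (2 * D))).
have C10 : 0 <= C1 by rewrite !addr_ge0// !mulr_ge0// ltW.
have CD : up_const D = 2 / alpha * C1 + D ^+ 2 by [].
have up_const0 : 0 < up_const D by rewrite CD ltr_wpDl ?exprn_gt0// mulr_ge0// ltW.
pose X := up_const D * rho ^+ 2.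
have X0 : 0 < X by rewrite mulr_gt0// exprn_gt0.
pose q := quad x0 (-1) (fun=> 0 : R).
pose q1 i (y : 'rV[R]_n) : R := 2 * (-1) * (y 0 i - x0 0 i) + 0.
pose q2 (i j : 'I_n) (_ : 'rV[R]_n) : R := 2 * (-1) * (i == j)%:R.
have qE y : q y = - sqd x0 y.
  by rewrite /q /quad -sumrN; apply: eq_bigr => i _; ring.
pose U := [set y | sqd x0 y < rho ^+ 2].
have UOm : U `<=` Om by move=> y /ltW; exact: BOm.
pose g (t : R) := - (2 / alpha) * ln (rho ^+ 2 + t) + ln X / alpha.
pose dg (t : R) := - (2 / alpha) * (rho ^+ 2 + t)^-1.
pose ddg (t : R) := (2 / alpha) * (rho ^+ 2 + t) ^- 2.
have Q : C2on U q q1 q2 by exact: C2on_sub (@subsetT _ _) (quad_C2on x0 (-1) (fun=> 0)).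
have pos y : U y -> 0 < rho ^+ 2 + q y by rewrite qE /U/= subr_gt0.
have Dlin (t : R) : is_derive t 1 (fun s => rho ^+ 2 + s) (1 : R).
  by have D1 := is_deriveD (is_derive_cst (rho ^+ 2) t (1 : R)) (is_derive_id t (1 : R));
    apply: (is_derive_eq D1); rewrite add0r.
have CW : C2on U (fun y => g (q y)) (fun i y => dg (q y) * q1 i y)
    (fun i j y => ddg (q y) * (q1 i y * q1 j y) + dg (q y) * q2 i j y).
  apply: C2on_comp Q _ _ _ => y Uy; have p := pos y Uy.
  - have D1 := is_derive1_comp (is_derive1_ln p) (Dlin (q y)).
    have D2 := is_deriveD (is_deriveZ (- (2 / alpha)) D1) (is_derive_cst (ln X / alpha) (q y) (1 : R)).
    by apply: (is_derive_eq D2); rewrite addr0 /GRing.scale/= mulr1.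
  - have D1 := is_deriveZ (- (2 / alpha)) (is_deriveV (lt0r_neq0 p) (Dlin (q y))).
    by apply: (is_derive_eq D1); rewrite /GRing.scale/= mulr1 mulNr mulrN opprK.
  - apply: continuousM; first exact: cst_continuous.
    apply: continuousV; first by rewrite expf_neq0// gt_eqF.
    apply: (@continuousM _ _ (fun t => rho ^+ 2 + t) (fun t => rho ^+ 2 + t));
      by apply: continuousD; [exact: cst_continuous|exact: cvg_id].
pose W y := g (q y).
have eW y : U y -> expR (alpha * W y) = X / (rho ^+ 2 + q y) ^+ 2.
  by move=> Uy; exact: (exp_barrier (pos y Uy) X0).
(* Where [u > W], also [u > 0], so that [c u >= 0] may be dropped from the equation of [u]. *)
have W0 y : U y -> 0 <= W y.
  move=> Uy; rewrite -(@pmulr_rge0 _ alpha)// -ler_expR expR0 eW// ler_pdivlMr ?exprn_gt0 ?pos//.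
  rewrite mul1r; have p := pos y Uy; have s0 := sqd_ge0 x0 y.
  have pr : rho ^+ 2 + q y <= rho ^+ 2 by rewrite qE gerDl oppr_le0.
  rewrite expr2 (le_trans (ler_pM (ltW p) (ltW p) pr pr))// /X ler_wpM2r ?sqr_ge0//.
  have rD2 : rho ^+ 2 <= D ^+ 2 by apply: lerXn2r => //; rewrite nnegrE ltW.
  by rewrite (le_trans rD2)// CD lerDr mulr_ge0// ltW.
have [M MP] : exists M, forall y, sqd x0 y <= rho ^+ 2 -> u y <= M.
  have B0 : [set y | sqd x0 y <= rho ^+ 2] !=set0 by exists x0; rewrite /= sqdxx sqr_ge0.
  have [y0 _ ymax] := max_compact (@sqd_compact R n x0 rho (ltW rho0)) B0
    (fun y By => D2on_cont (@subset_refl _ Om) Du (BOm y By)).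
  by exists (u y0).
(* [eps] is the value of [rho ^+ 2 - |y - x0|^2] at which the barrier equals [M]. Nearer to the
   sphere the barrier exceeds [u], so [u > W] only in the ball of radius [r < rho]. *)
pose eps := expR (- (alpha / 2) * (M - ln X / alpha)).
have eps0 : 0 < eps by exact: expR_gt0.
pose r := Num.sqrt (Num.max 0 (rho ^+ 2 - eps)).
have rE : r ^+ 2 = Num.max 0 (rho ^+ 2 - eps) by rewrite sqr_sqrtr// le_max lexx.
have rr : r ^+ 2 < rho ^+ 2 by rewrite rE gt_max exprn_gt0//= ltrBlDr ltrDl.
have main : forall y, U y -> u y - W y <= 0.
  have ra : alpha != 0 by rewrite gt_eqF.
  refine (@comparison R n n0 Om oOm a b lam A0 coef U _ _ _ [set y | sqd x0 y <= r ^+ 2]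
    (fun y => expR (alpha * u y) - expR (alpha * W y)) (@sqd_open R n x0 _) UOm
    (D2onB n0 oOm (D2on_sub UOm Du) (D2on_C2on n0 Om CW)) _ _ _ _ _ _).
  - by apply: sqd_compact; exact: sqrtr_ge0.
  - by move=> y /= yr; exact: le_lt_trans rr.
  - move=> y Uy wy /=; rewrite rE le_max; apply/orP; right.
    have uM := MP y (ltW Uy); have p := pos y Uy.
    have WM : W y < M by move: wy; rewrite subr_gt0 => /lt_le_trans; exact.
    suff : eps < rho ^+ 2 + q y by rewrite qE; lra.
    rewrite -(lnK p) ltr_expR; move: WM; rewrite /W /g => WM.
    rewrite -(@ltr_pM2l _ (2 / alpha))//.
    rewrite (_ : 2 / alpha * (- (alpha / 2) * (M - ln X / alpha)) = - (M - ln X / alpha)); last by field.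
    by lra.
  - move=> y Uy; apply: continuousB; apply: continuous_exp_scaled.
      exact: (D2on_cont (@subset_refl _ Om) Du (UOm _ Uy)).
    exact: C2_cont CW _ Uy.
  - by move=> y Uy; rewrite subr_gt0 => wy; rewrite subr_gt0 ltr_expR ltr_pM2l.
  apply: (@filterS _ _ aeF _ _ _ Lu) => y Ly Uy; rewrite subr_gt0 => wy.
  have Oy := UOm _ Uy; have /andP[cy0 _] := c_bound Oy.
  have cu : 0 <= c y * u y.
    by rewrite mulr_ge0// (le_trans (W0 y Uy))// ltW.
  rewrite (diff_opB a b u1 (fun i y => dg (q y) * q1 i y) u2 (fun i j y => ddg (q y) * (q1 i y * q1 j y) + dg (q y) * q2 i j y) y).
  rewrite (Ly Oy) -addrA lerD2l.
  suff : diff_op a b (fun i y => dg (q y) * q1 i y) (fun i j y => ddg (q y) * (q1 i y * q1 j y) + dg (q y) * q2 i j y) y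
    <= expR (alpha * W y) by lra.
  rewrite (diff_op_comp a b q1 q2 (fun y => dg (q y)) (fun y => ddg (q y)) y) eW//.
  have p := pos y Uy; have s0 := sqd_ge0 x0 y.
  have zb i : `|y 0 i - x0 0 i| <= rho by apply: sqd_coord (ltW rho0) (ltW Uy).
  have qb : qform (fun i j => a i j y) (q1^~ y) <= n%:R * (n%:R * (A0 * (2 * 2) * rho ^+ 2)).
    apply: sum_le_const => i; apply: sum_le_const => j.
    rewrite (le_trans (ler_norm _))// !normrM.
    rewrite (_ : A0 * (2 * 2) * rho ^+ 2 = A0 * (2 * rho) * (2 * rho)); last by ring.
    apply: ler_pM; rewrite ?mulr_ge0//; first apply: ler_pM => //.
    + exact: a_bnd.
    + by rewrite /q1 addr0 !normrM normrN1 mulr1 ger0_norm// ler_wpM2l.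
    + by rewrite /q1 addr0 !normrM normrN1 mulr1 ger0_norm// ler_wpM2l.
  have ob : - diff_op a b q1 q2 y <= 2 * (n%:R * A0) + n%:R * (A0 * (2 * rho)).
    rewrite /q1 /q2 diff_op_quad opprD; apply: lerD.
      rewrite (_ : - _ = 2 * \sum_(i < n) a i i y); last by ring.
      rewrite ler_wpM2l//; apply: sum_le_const => i.
      by rewrite (le_trans (ler_norm _))// a_bnd.
    rewrite -sumrN; apply: sum_le_const => i; rewrite (le_trans (ler_norm _))// normrN normrM.
    apply: ler_pM => //; first exact: b_bnd.
    by rewrite addr0 !normrM normrN1 mulr1 ger0_norm// ler_wpM2l.
  set P := rho ^+ 2 + q y in p *.
  have pr : P <= rho ^+ 2 by rewrite /P qE gerDl oppr_le0.
  rewrite /ddg /dg -/P.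
  rewrite ler_pdivlMr ?exprn_gt0// mulrDl.
  have P0 : P != 0 by rewrite gt_eqF.
  rewrite (_ : 2 / alpha * P ^- 2 * _ * P ^+ 2 = 2 / alpha * qform (fun i j => a i j y) (q1^~ y)); last first.
    by field; rewrite P0 gt_eqF.
  rewrite (_ : - (2 / alpha) / P * _ * P ^+ 2 = 2 / alpha * (P * (- diff_op a b q1 q2 y))); last first.
    by field; rewrite P0 gt_eqF.
  rewrite -mulrDr /X CD [leRHS]mulrDl -[leLHS]addr0.
  apply: lerD; last by rewrite mulr_ge0 ?sqr_ge0.
  rewrite -[leRHS]mulrA ler_wpM2l ?(ltW a20)//.
  rewrite /C1 [leRHS]mulrDl; apply: lerD; first by rewrite (le_trans qb)// !mulrA.
  have E0 : 0 <= 2 * (n%:R * A0) + n%:R * (A0 * (2 * rho)).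
    by rewrite addr_ge0// !mulr_ge0// ltW.
  rewrite (le_trans (ler_wpM2l (ltW p) ob))// (le_trans (ler_wpM2r E0 pr))//.
  rewrite mulrC ler_wpM2r ?sqr_ge0// lerD2l ler_wpM2l// ler_wpM2l ?(ltW A00)//.
  by rewrite ler_wpM2l.
have Ux0 : U x0 by rewrite /U/= sqdxx exprn_gt0.
have := main x0 Ux0; rewrite subr_le0 => uW.
have q0 : q x0 = 0 by rewrite qE sqdxx oppr0.
apply: (@le_trans _ _ (expR (alpha * W x0))); first by rewrite ler_expR ler_pM2l.
rewrite eW// q0 addr0 /X.
have r20 : rho ^+ 2 != 0 by rewrite expf_neq0// gt_eqF.
by rewrite expr2 invfM mulrA mulfK.
Qed.

End Barriers.

Section Barriers.
Context {R : realType} {n : nat}.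
Hypothesis n0 : (0 < n)%N.
Local Notation mu := (@lebesgue_rV R n).
Variables (Om : set 'rV[R]_n) (oOm : open Om).
Variables (a : 'I_n -> 'I_n -> 'rV[R]_n -> R) (b : 'I_n -> 'rV[R]_n -> R) (c : 'rV[R]_n -> R)
  (lam A0 K alpha : R).
Hypotheses (coef : coef_bounds Om a b lam A0) (K0 : 0 < K) (alpha0 : 0 < alpha)
  (c_bound : forall x, Om x -> 0 <= c x <= K).

Let aeF : Filter (almost_everywhere mu) := ae_filter_ringOfSetsType mu.


(** Chosen with [low_rate * lam = n%:R * A0 + 1], so that for the exponential profile the
    second-order term outweighs the drift by at least 1. *)
Definition low_rate : R := (n%:R * A0 + 1) / lam.

(** [T] bounds the shifted distance, so the exponential factor is a lower bound for the profile on
    [Om]. Dividing by [1 + K / alpha] makes the barrier pay for the zero-order term as well. *)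
Definition low_weight (T : R) : R := 2 / alpha * low_rate * expR (- low_rate * T) / (1 + K / alpha).

(** From [1 - exp (- k t) <= k t] and [t <= (n + 2) d] for the shifted distance [t] at points within
    [d] of [x0]. *)
Definition low_const (T : R) : R := low_weight T / (low_rate * (n%:R + 2)) ^+ 2.

Lemma low_rate_gt0 : 0 < low_rate.
Proof.
have [lam0 A00 _ _ _ _] := coef.
by rewrite divr_gt0// ltr_wpDl// mulr_ge0// ltW.
Qed.

Lemma low_weight_gt0 T : 0 < low_weight T.
Proof.
apply: divr_gt0; last by rewrite addr_gt0// divr_gt0.
by apply: mulr_gt0; [rewrite mulr_gt0 ?low_rate_gt0// divr_gt0|exact: expR_gt0].
Qed.

Lemma low_const_gt0 T : 0 < low_const T.
Proof.
apply: divr_gt0; first exact: low_weight_gt0.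
by rewrite exprn_gt0// mulr_gt0 ?low_rate_gt0// ltr_wpDl.
Qed.

(* Om lies in the half space {q > 0} with q the signed distance to the hyperplane
   through z orthogonal to x0 - z. The barrier is
   W = -(2/alpha) ln (1 - exp (- low_rate (q + d))) + ln X / alpha; the shift by d keeps it
   bounded on Om, so that v exceeds it near the boundary, and costs only a constant. *)
Lemma lower_barrier v v1 v2 z x0 (d T : R) : bounded_set Om -> blowup_sol Om a b c alpha v v1 v2 ->
  0 < d -> sqd x0 z = d ^+ 2 ->
  (forall y, Om y -> 0 < \sum_(i < n) (y 0 i - z 0 i) * (x0 0 i - z 0 i)) ->
  (forall y, Om y -> (\sum_(i < n) (y 0 i - z 0 i) * (x0 0 i - z 0 i)) / d + d <= T) ->
  forall y, Om y -> sqd x0 y <= d ^+ 2 -> low_const T / d ^+ 2 <= expR (alpha * v y).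
Proof.
move=> bOm [Dv Lv blow] d0 zd half tT.
have [lam0 A00 a_sym a_ell a_bnd b_bnd] := coef.
have nA0 : 0 <= n%:R * A0 by rewrite mulr_ge0// ltW.
have k0 := low_rate_gt0.
have a20 : 0 < 2 / alpha by rewrite divr_gt0.
have Ka0 : 0 < 1 + K / alpha by rewrite addr_gt0// divr_gt0.
have dN0 : d != 0 by rewrite gt_eqF.
pose X := low_weight T.
have X0 : 0 < X := low_weight_gt0 T.
pose nu i := (x0 0 i - z 0 i) / d.
pose q := quad z 0 nu.
pose q1 i (y : 'rV[R]_n) : R := 2 * 0 * (y 0 i - z 0 i) + nu i.
pose q2 (i j : 'I_n) (_ : 'rV[R]_n) : R := 2 * 0 * (i == j)%:R.
have qE y : q y = (\sum_(i < n) (y 0 i - z 0 i) * (x0 0 i - z 0 i)) / d.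
  by rewrite /q /quad mulr_suml; apply: eq_bigr => i _; rewrite /nu; field.
have nu1 : \sum_(i < n) nu i ^+ 2 = 1.
  rewrite (eq_bigr (fun i => (z 0 i - x0 0 i) ^+ 2 / d ^+ 2)); last first.
    by move=> i _; rewrite /nu; field.
  by rewrite -mulr_suml -/(sqd x0 z) zd divff// expf_neq0.
have nub i : `|nu i| <= 1.
  rewrite -(@ler_pXn2r _ 2) ?nnegrE// expr1n real_normK ?num_real// -nu1.
  by rewrite (bigD1 i)//= lerDl sumr_ge0// => j _; exact: sqr_ge0.
have qpos y : Om y -> 0 < q y by move=> Oy; rewrite qE divr_gt0// half.
pose E (t : R) := expR (- low_rate * (t + d)).
have E0 t : 0 < E t by exact: expR_gt0.
have E1 t : 0 < t -> 0 < 1 - E t.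
  by move=> t0; rewrite subr_gt0 -expR0 ltr_expR mulNr oppr_lt0 mulr_gt0// addr_gt0.
pose g (t : R) := - (2 / alpha) * ln (1 - E t) + ln X / alpha.
pose dg (t : R) := - (2 / alpha) * ((1 - E t)^-1 * (low_rate * E t)).
pose ddg (t : R) := 2 / alpha * (low_rate ^+ 2 * E t / (1 - E t) ^+ 2).
have Q : C2on Om q q1 q2 by exact: C2on_sub (@subsetT _ _) (quad_C2on z 0 nu).
have DE (t : R) : is_derive t 1 E (- (low_rate * E t)).
  have D1 := is_deriveZ (- low_rate) (is_deriveD (is_derive_id t (1 : R)) (is_derive_cst d t (1 : R))).
  have D2 := @is_derive1_comp R expR (fun s => - low_rate * (s + d)) t _ _ (is_derive_expR (- low_rate * (t + d))) D1.
  by apply: (is_derive_eq D2); rewrite /GRing.scale/= addr0 mulr1 mulrN mulrC.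
have DP (t : R) : is_derive t 1 (fun s => 1 - E s) (low_rate * E t).
  have D1 := is_deriveB (is_derive_cst (1 : R) t (1 : R)) (DE t).
  by apply: (is_derive_eq D1); rewrite sub0r opprK.
have CE (t : R) : {for t, continuous E}.
  by apply/differentiable_continuous/derivable1_diffP; have [] := DE t.
have CW : C2on Om (fun y => g (q y)) (fun i y => dg (q y) * q1 i y)
    (fun i j y => ddg (q y) * (q1 i y * q1 j y) + dg (q y) * q2 i j y).
  apply: C2on_comp Q _ _ _ => y Oy; have p := E1 _ (qpos _ Oy); have pN0 := lt0r_neq0 p.
  - have D1 := @is_derive1_comp R (@ln R) (fun s => 1 - E s) (q y) _ _ (is_derive1_ln p) (DP (q y)).
    have D2 := is_deriveD (is_deriveZ (- (2 / alpha)) D1) (is_derive_cst (ln X / alpha) (q y) (1 : R)).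
    by apply: (is_derive_eq D2); rewrite addr0.
  - have D1 := is_deriveM (@is_deriveV R (fun s => 1 - E s) (q y) _ _ pN0 (DP (q y))) (is_deriveZ low_rate (DE (q y))).
    have D2 := is_deriveZ (- (2 / alpha)) D1.
    apply: (is_derive_eq D2); rewrite /= /GRing.scale/= /ddg.
    by field; rewrite pN0 gt_eqF.
  - apply: continuousM; first exact: cst_continuous.
    apply: continuousM; first by apply: continuousM; [exact: cst_continuous|exact: CE].
    apply: continuousV; first by rewrite expf_neq0.
    apply: (@continuousM _ _ (fun t => 1 - E t) (fun t => 1 - E t));
      by apply: continuousB; [exact: cst_continuous|exact: CE].
pose W y := g (q y).
have eW y : Om y -> expR (alpha * W y) = X / (1 - E (q y)) ^+ 2.
  by move=> Oy; exact: (exp_barrier alpha0 (E1 _ (qpos _ Oy)) X0).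
have main : forall y, Om y -> W y - v y <= 0.
  pose M := - (2 / alpha) * ln (1 - expR (- low_rate * d)) + ln X / alpha.
  have WM y : Om y -> W y <= M.
    move=> Oy; rewrite /W /g /M lerD2r mulNr [leRHS]mulNr lerN2 ler_wpM2l ?(ltW a20)//.
    have s1 : 0 < 1 - expR (- low_rate * d).
      by rewrite subr_gt0 -expR0 ltr_expR mulNr oppr_lt0 mulr_gt0.
    rewrite ler_ln ?posrE// ?E1 ?qpos// lerD2l lerN2 ler_expR !mulNr lerN2 ler_wpM2l ?(ltW k0)//.
    by rewrite lerDr ltW// qpos.
  have [Kc [cK KO vK]] := blow_compact M bOm blow.
  refine (@comparison R n n0 Om oOm a b lam A0 coef Om _ _ _ Kc
    (fun y => expR (alpha * W y) - expR (alpha * v y)) oOm (@subset_refl _ Om)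
    (D2onB n0 oOm (D2on_C2on n0 Om CW) Dv) cK KO _ _ _ _).
  - by move=> y Oy; rewrite subr_gt0 => /ltW vW; apply: vK => //; exact: le_trans vW (WM _ Oy).
  - move=> y Oy; apply: continuousB; apply: continuous_exp_scaled; first exact: C2_cont CW _ Oy.
    exact: (D2on_cont (@subset_refl _ Om) Dv Oy).
  - by move=> y Oy; rewrite subr_gt0 => wy; rewrite subr_gt0 ltr_expR ltr_pM2l.
  apply: (@filterS _ _ aeF _ _ _ Lv) => y Ly Oy; rewrite subr_gt0 => wy.
  have /andP[cy0 cyK] := c_bound Oy.
  rewrite (diff_opB a b (fun i y => dg (q y) * q1 i y) v1 (fun i j y => ddg (q y) * (q1 i y * q1 j y) + dg (q y) * q2 i j y) v2 y).
  rewrite (Ly Oy).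
  (* The sign of [v] is unknown here, but [v < W] gives [c v <= c W], and
     [alpha W <= expR (alpha W)] charges this to the exponential. *)
  have aW : c y * v y <= K / alpha * expR (alpha * W y).
    apply: (@le_trans _ _ (c y * W y)); first by rewrite ler_wpM2l// ltW.
    have [W0|W0] := leP 0 (W y); last first.
      apply: (@le_trans _ _ 0); first by rewrite mulr_ge0_le0// ltW.
      by rewrite mulr_ge0// ?expR_ge0// divr_ge0// ltW.
    rewrite (le_trans (ler_wpM2r W0 cyK))// -mulrA ler_wpM2l ?(ltW K0)//.
    rewrite mulrC ler_pdivlMr// mulrC.
    by have := expR_ge1Dx (alpha * W y); lra.
  suff : (1 + K / alpha) * expR (alpha * W y) <= diff_op a b (fun i y => dg (q y) * q1 i y)
      (fun i j y => ddg (q y) * (q1 i y * q1 j y) + dg (q y) * q2 i j y) y.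
    by rewrite mulrDl mul1r; lra.
  rewrite (diff_op_comp a b q1 q2 (fun y => dg (q y)) (fun y => ddg (q y)) y) eW//.
  have p := E1 _ (qpos _ Oy).
  have qb : lam <= qform (fun i j => a i j y) (q1^~ y).
    have := a_ell y Oy (q1^~ y); rewrite (eq_bigr (fun i => nu i ^+ 2)); last first.
      by move=> i _; rewrite /q1 mulr0 mul0r add0r.
    by rewrite nu1 mulr1.
  have ob : diff_op a b q1 q2 y <= n%:R * A0.
    rewrite /q1 /q2 diff_op_quad mulr0 mul0r add0r; apply: sum_le_const => i.
    rewrite (le_trans (ler_norm _))// normrM -[leRHS]mulr1; apply: ler_pM => //; first exact: b_bnd.
    by rewrite mul0r add0r.
  have ET : expR (- low_rate * T) <= E (q y).
    by rewrite /E ler_expR !mulNr lerN2 ler_wpM2l ?(ltW k0)// qE; exact: tT.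
  rewrite /ddg /dg /X /low_weight; set P := 1 - E (q y) in p *.
  have P0 : P != 0 by rewrite gt_eqF.
  have P1 : P <= 1 by rewrite /P gerBl ltW.
  have e0 := E0 (q y); set e := E (q y) in ET e0 *.
  have kl : low_rate * lam = n%:R * A0 + 1 by rewrite /low_rate mulfVK// gt_eqF.
  rewrite (_ : (1 + K / alpha) * _ = 2 / alpha * low_rate * expR (- low_rate * T) * P ^- 2); last first.
    by rewrite mulrA mulrCA divff ?mulr1// gt_eqF.
  rewrite (_ : _ + _ = 2 / alpha * low_rate * (low_rate * e * qform (fun i j => a i j y) (q1^~ y) - e * (P * diff_op a b q1 q2 y)) * P ^- 2); last first.
    by field; rewrite P0 gt_eqF.
  rewrite ler_wpM2r ?invr_ge0 ?exprn_ge0 ?(ltW p)//.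
  have ak0 : 0 <= 2 / alpha * low_rate by apply: mulr_ge0; exact: ltW.
  rewrite (ler_wpM2l ak0)//; apply: (le_trans ET); rewrite [low_rate * e]mulrC -mulrA -mulrBr -[leLHS]mulr1 ler_wpM2l ?(ltW e0)//.
  have := ler_wpM2l (ltW k0) qb; rewrite kl.
  have : P * diff_op a b q1 q2 y <= n%:R * A0.
    rewrite (le_trans (ler_wpM2l (ltW p) ob))//.
    by rewrite -[leRHS]mul1r ler_wpM2r.
  by lra.
move=> y Oy yd; have := main y Oy; rewrite subr_le0 => Wv.
apply: (@le_trans _ _ (expR (alpha * W y))); last by rewrite ler_expR ler_pM2l.
rewrite eW// /low_const -/X -mulrA -invfM -exprMn.
have p := E1 _ (qpos _ Oy).
have n2 : 0 < n%:R + 2 :> R by rewrite ltr_wpDl.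
have kd0 : 0 < low_rate * (n%:R + 2) * d by apply: mulr_gt0 => //; exact: mulr_gt0.
rewrite ler_wpM2l ?(ltW X0)// lef_pV2 ?posrE ?exprn_gt0// lerXn2r ?nnegrE ?(ltW p) ?(ltW kd0)//.
have qd : q y <= n%:R * d + d.
  have -> : q y = \sum_(i < n) (y 0 i - x0 0 i) * nu i + d.
    have ds : d = \sum_(i < n) (z 0 i - x0 0 i) ^+ 2 / d.
      by rewrite -mulr_suml -/(sqd x0 z) zd; field.
    rewrite qE mulr_suml [X in _ = _ + X]ds -big_split/=; apply: eq_bigr => i _.
    by rewrite /nu; field.
  rewrite lerD2r; apply: sum_le_const => i; rewrite (le_trans (ler_norm _))// normrM.
  by rewrite -[leRHS]mulr1; apply: ler_pM => //; exact: sqd_coord (ltW d0) yd.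
have e1 := expR_ge1Dx (- low_rate * (q y + d)).
have H : low_rate * (q y + d) <= low_rate * ((n%:R + 2) * d).
  by rewrite ler_wpM2l ?(ltW k0)//; move: qd; lra.
by rewrite /E -mulrA; move: e1 H; lra.
Qed.

End Barriers.

(** * Uniqueness *)

Section Uniqueness.
Context {R : realType} {n : nat}.
Hypothesis n0 : (0 < n)%N.
Local Notation mu := (@lebesgue_rV R n).
Variables (Om : set 'rV[R]_n) (oOm : open Om).
Variables (a : 'I_n -> 'I_n -> 'rV[R]_n -> R) (b : 'I_n -> 'rV[R]_n -> R) (c : 'rV[R]_n -> R)
  (lam A0 K alpha : R).
Hypotheses (coef : coef_bounds Om a b lam A0) (K0 : 0 < K) (alpha0 : 0 < alpha)
  (c_bound : forall x, Om x -> 0 <= c x <= K).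

Let aeF : Filter (almost_everywhere mu) := ae_filter_ringOfSetsType mu.


Hypotheses (bOm : bounded_set Om) (cOm : convex_set Om).
Local Notation blowup_sol := (blowup_sol Om a b c alpha).

Lemma C2on_shift U f f1 f2 (k : R) : C2on U f f1 f2 ->
  C2on U (fun x : 'rV[R]_n => f x + k) f1 f2.
Proof.
move=> F; split; [|exact: C2_cont1 F|exact: C2_cont2 F| |exact: C2_derive2 F|exact: C2_sym F].
  by move=> x Ux; apply: continuousD; [exact: C2_cont F _ Ux|exact: cst_continuous].
move=> i x Ux; have D1 := is_deriveD (C2_derive1 F i Ux) (is_derive_cst k x (delta_mx 0 i)).
by apply: (is_derive_eq D1); rewrite addr0.
Qed.

Lemma inner_geometry : exists D T : R, 0 < D /\ forall x0, Om x0 -> exists z d,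
  [/\ 0 < d <= D, sqd x0 z = d ^+ 2,
      forall y, Om y -> 0 < \sum_(i < n) (y 0 i - z 0 i) * (x0 0 i - z 0 i),
      forall y, Om y -> (\sum_(i < n) (y 0 i - z 0 i) * (x0 0 i - z 0 i)) / d + d <= T &
      forall y, sqd x0 y < d ^+ 2 -> Om y].
Proof.
have [D0 D00 OD] := bounded_setP bOm.
have n1 : 1 <= n%:R :> R by rewrite ler1n.
pose D := n%:R * (2 * D0 + 1).
have Dpos : 0 < D by rewrite mulr_gt0 ?(lt_le_trans ltr01 n1)//; lra.
exists D, (n%:R * (2 * D0 + D) + D); split=> // x0 Ox0.
(* A point just outside the cube containing [Om]; it provides a nonempty complement and bounds the
   distance [d] by [D]. *)
pose p : 'rV[R]_n := const_mx (D0 + 1).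
have Op : ~ Om p.
  move=> /OD /(_ (Ordinal n0)); rewrite !mxE subr0 ger0_norm; last by lra.
  by lra.
have OT : Om != setT by apply/eqP => OT; apply: Op; rewrite OT.
have [z Oz zmin] := nearest_point oOm Ox0 OT.
pose d := Num.sqrt (sqd x0 z).
have dE : sqd x0 z = d ^+ 2 by rewrite sqr_sqrtr// sqd_ge0.
have d0 : 0 < d.
  rewrite lt_neqAle sqrtr_ge0 andbT; apply/negP => /eqP dz.
  apply: Oz; rewrite (_ : z = x0)//; apply/rowP => i.
  have := @sqd_coord R n x0 z i 0 (lexx _); rewrite dE -dz expr0n/= => /(_ (lexx _)).
  by rewrite normr_le0 subr_eq0 => /eqP.
have dD : d <= D.
  rewrite -(@ler_pXn2r _ 2) ?nnegrE ?(ltW d0) ?(ltW Dpos)// -dE (le_trans (zmin _ Op))//.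
  apply: (@le_trans _ _ (n%:R * (2 * D0 + 1) ^+ 2)).
    apply: sum_le_const => i; rewrite -real_normK ?num_real//.
    apply: lerXn2r; rewrite ?nnegrE//; first by lra.
    by have := OD _ Ox0 i; rewrite !mxE subr0 !ler_norml; lra.
  by rewrite /D exprMn ler_wpM2r ?sqr_ge0// expr2 ler_peMl.
exists z, d; split => //; first by rewrite d0.
- exact: supporting_halfspace.
- move=> y Oy; rewrite lerD// mulr_suml; apply: sum_le_const => i.
  rewrite -mulrA (le_trans (ler_norm _))// normrM -[leRHS]mulr1.
  have zd : `|z 0 i - x0 0 i| <= d by apply: sqd_coord (ltW d0) _; rewrite dE.
  apply: ler_pM => //; last by rewrite normrM normfV (gtr0_norm d0) ler_pdivrMr// mul1r distrC.
  move: (OD _ Oy i) (OD _ Ox0 i) zd dD; rewrite !mxE !subr0 !ler_norml.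
  by move=> /andP[? ?] /andP[? ?] /andP[? ?] ?; apply/andP; split; lra.
- by move=> y yd; apply: contrapT => /zmin; rewrite dE leNgt yd.
Qed.

Lemma sol_le u u1 u2 v v1 v2 : blowup_sol u u1 u2 -> blowup_sol v v1 v2 ->
  forall x, Om x -> u x <= v x.
Proof.
move=> Su Sv x Ox; rewrite leNgt; apply/negP => vu.
have [lam0 A00 a_sym a_ell a_bnd b_bnd] := coef.
have [D [T [D0 geo]]] := inner_geometry.
pose Cl := low_const (n:=n) lam A0 K alpha T.
have Cl0 : 0 < Cl := low_const_gt0 coef K0 alpha0 T.
(* The upper bound on the ball of radius [d / 2] over the lower bound at [x0]: the powers of [d]
   cancel. The half radius keeps the closed ball in [Om]. *)
pose B := 4 * up_const (n:=n) A0 alpha D / Cl.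
pose S := [set u y - v y | y in Om].
have ubS : has_ubound S.
  exists (ln B / alpha) => _ [x0 Ox0 <-].
  have [z [d [/andP[d0 dD] zd half tT ball]]] := geo x0 Ox0.
  have d20 : 0 < d / 2 by rewrite divr_gt0.
  have up : expR (alpha * u x0) <= up_const (n:=n) A0 alpha D / (d / 2) ^+ 2.
    apply: (upper_barrier n0 oOm coef alpha0 c_bound Su d20); first by lra.
    move=> y yd; apply: ball; apply: le_lt_trans yd _.
    by rewrite ltr_pXn2r// ?nnegrE; lra.
  have lo : Cl / d ^+ 2 <= expR (alpha * v x0).
    apply: (lower_barrier n0 oOm coef K0 alpha0 c_bound bOm Sv d0 zd half tT Ox0).
    by rewrite sqdxx sqr_ge0.
  have d2 : 0 < d ^+ 2 by rewrite exprn_gt0.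
  have le : expR (alpha * (u x0 - v x0)) <= B.
    rewrite mulrBr expRB ler_pdivrMr ?expR_gt0// (le_trans up)//.
    have B0 : 0 <= B.
      rewrite divr_ge0 ?(ltW Cl0)// mulr_ge0//.
      have := le_trans (expR_ge0 _) up.
      by rewrite pmulr_lge0// invr_gt0 exprn_gt0.
    apply: le_trans (ler_wpM2l B0 lo).
    rewrite le_eqVlt /B; apply/orP; left; apply/eqP; field.
    by rewrite !gt_eqF.
  have B0 : 0 < B by exact: lt_le_trans (expR_gt0 _) le.
  by rewrite ler_pdivlMr// mulrC -ler_expR lnK.
pose M := sup S.
have SM y : Om y -> u y - v y <= M by move=> Oy; apply: ub_le_sup => //; exists y.
have M0 : 0 < M by apply: lt_le_trans (SM _ Ox); rewrite subr_gt0.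
pose Y := Cl * alpha.
have Y0 : 0 < Y by rewrite mulr_gt0.
pose Z := 8 * (n%:R * (A0 * (1 + D))).
have nR : 0 < n%:R :> R by rewrite ltr0n.
have Z0 : 0 < Z by rewrite !mulr_gt0//; lra.
have YZ : 0 < 2 * Y + 4 * Z by lra.
(* The equation gains at least [M * Y / (2 * d ^+ 2)] and the bump costs at most
   [M * (del * Z) / d ^+ 2]. This choice makes [del * Z <= Y / 4], leaving half of the gain, and
   [del <= 1/2]. *)
pose del := Y / (2 * Y + 4 * Z).
have del0 : 0 < del by rewrite divr_gt0.
have del1 : del <= 2^-1.
  by rewrite /del ler_pdivrMr//; lra.
have delZ : del * Z <= Y / 4.
  rewrite /del mulrAC ler_pdivrMr//; have : 0 <= Y * Y by rewrite mulr_ge0// ltW.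
  by lra.
suff contr x0 : Om x0 -> u x0 - v x0 <= M * (1 - del).
  have : M <= M * (1 - del).
    by apply: ge_sup; [exists (u x - v x), x|move=> _ [y Oy <-]; exact: contr].
  by apply/negP; rewrite -ltNge mulrBr mulr1 ltrBlDr ltrDl mulr_gt0.
move=> Ox0; have [z [d [/andP[d0 dD] zd half tT ball]]] := geo x0 Ox0.
have d2 : 0 < d ^+ 2 by rewrite exprn_gt0.
pose U := [set y | sqd x0 y < d ^+ 2].
(* Makes [phi] rise from [M * (1 - del)] at [x0] to [M] on the sphere of radius [d / 2]; beyond it
   [u - v <= M <= phi]. *)
pose beta := M * del * (4 / d ^+ 2).
have beta0 : 0 < beta by apply: mulr_gt0; [exact: mulr_gt0|exact: divr_gt0].
pose phi y := quad x0 beta (fun=> 0) y + M * (1 - del).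
have phiE y : phi y = beta * sqd x0 y + M * (1 - del).
  by rewrite /phi /quad /sqd mulr_sumr; congr (_ + _); apply: eq_bigr => i _; rewrite mul0r addr0.
have P : C2on U phi (fun i y => 2 * beta * (y 0 i - x0 0 i) + 0) (fun i j _ => 2 * beta * (i == j)%:R).
  exact: C2on_shift (C2on_sub (@subsetT _ _) (quad_C2on x0 beta (fun=> 0))).
have [Du Lu _] := Su; have [Dv Lv _] := Sv.
have h20 : 0 <= d / 2 by rewrite divr_ge0// ltW.
(* Where [u - v] exceeds [phi] it is thus at least [M / 2], which makes the gain proportional to
   [M]. *)
have phi0 y : M / 2 <= phi y.
  rewrite phiE ler_wpDl//; first by rewrite mulr_ge0 ?sqd_ge0// ltW.
  by rewrite ler_wpM2l ?(ltW M0)//; move: del1; lra.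
have main : forall y, U y -> u y - v y - phi y <= 0.
  refine (@comparison R n n0 Om oOm a b lam A0 coef U _ _ _ [set y | sqd x0 y <= (d / 2) ^+ 2]
    (fun=> M * Y / (4 * d ^+ 2)) (@sqd_open R n x0 _) ball
    (D2onB n0 oOm (D2onB n0 oOm (D2on_sub ball Du) (D2on_sub ball Dv)) (D2on_C2on n0 Om P))
    (@sqd_compact R n x0 _ h20) _ _ _ _ _).
  - move=> y yd; apply: le_lt_trans yd _.
    by rewrite ltr_pXn2r// ?nnegrE; lra.
  - move=> y Uy wy /=; have := SM y (ball _ Uy); move: wy; rewrite phiE /beta => wy uvM.
    have : M * del * (4 / d ^+ 2 * sqd x0 y) < M * del * 1.
      by move: wy uvM; rewrite mulrA; lra.
    rewrite (ltr_pM2l (mulr_gt0 M0 del0)) mulrAC ltr_pdivrMr// mul1r => /ltW H.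
    by rewrite exprMn exprVn -[2 ^+ 2]/(2 * 2); lra.
  - by move=> y _; exact: cst_continuous.
  - by move=> y _ _; apply: divr_gt0; exact: mulr_gt0.
  apply: (@filterS2 _ _ aeF _ _ _ _ Lu Lv) => y Lu' Lv' Uy wy; have Oy := ball _ Uy.
  have /andP[cy0 _] := c_bound Oy.
  have zb i : `|y 0 i - x0 0 i| <= d by apply: sqd_coord (ltW d0) (ltW Uy).
  have lo : Cl / d ^+ 2 <= expR (alpha * v y).
    exact: (lower_barrier n0 oOm coef K0 alpha0 c_bound bOm Sv d0 zd half tT Oy (ltW Uy)).
  rewrite (diff_opB a b (fun i y => u1 i y - v1 i y) (fun i y => 2 * beta * (y 0 i - x0 0 i) + 0)
    (fun i j y => u2 i j y - v2 i j y) (fun i j _ => 2 * beta * (i == j)%:R) y).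
  rewrite diff_opB (Lu' Oy) (Lv' Oy) diff_op_quad.
  have uv : M / 2 <= u y - v y by apply: le_trans (phi0 y) _; move: wy; lra.
  have cuv : 0 <= c y * (u y - v y).
    by rewrite mulr_ge0// (le_trans _ uv)// divr_ge0// ltW.
  have e1 : Cl / d ^+ 2 * (alpha * (M / 2)) <= expR (alpha * u y) - expR (alpha * v y).
    rewrite -{1}[u y](subrK (v y)) [alpha * (_ + _)]mulrDr expRD.
    rewrite -[X in _ - X]mul1r -mulrBl mulrC.
    apply: ler_pM => //; first by rewrite !mulr_ge0// ltW// invr_gt0.
      by rewrite divr_ge0 ?(ltW Cl0) ?(ltW d2).
    have := expR_ge1Dx (alpha * (u y - v y)).
    have := ler_wpM2l (ltW alpha0) uv; lra.
  have b20 : 0 <= 2 * beta by rewrite mulr_ge0// ltW.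
  have T1 : \sum_(i < n) a i i y <= n%:R * A0.
    by apply: sum_le_const => i; rewrite (le_trans (ler_norm _))// a_bnd.
  have T2 : \sum_(i < n) b i y * (2 * beta * (y 0 i - x0 0 i) + 0) <= n%:R * (A0 * (2 * beta * D)).
    apply: sum_le_const => i; rewrite (le_trans (ler_norm _))// normrM addr0.
    apply: ler_pM => //; first exact: b_bnd.
    by rewrite normrM (ger0_norm b20) (ler_wpM2l b20)// (le_trans (zb i)).
  have T1' := ler_wpM2l b20 T1.
  have E1 : Cl / d ^+ 2 * (alpha * (M / 2)) = M * Y / (4 * d ^+ 2) + M * (Y / 4) / d ^+ 2.
    by rewrite /Y; field; rewrite gt_eqF.
  have E2 : 2 * beta * (n%:R * A0) + n%:R * (A0 * (2 * beta * D)) = M * (del * Z) / d ^+ 2.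
    by rewrite /beta /Z; field; rewrite gt_eqF.
  have E3 : M * (del * Z) / d ^+ 2 <= M * (Y / 4) / d ^+ 2.
    by apply: ler_wpM2r; [rewrite invr_ge0 ltW|apply: ler_wpM2l => //; exact: ltW].
  move: e1 T1' T2 E1 E2 E3 cuv; rewrite mulrBr.
  set p1 := _ * (alpha * (M / 2)); set p2 := M * Y / _; set p3 := M * (Y / 4) / _; set p4 := _ / d ^+ 2.
  by lra.
have Ux0 : U x0 by rewrite /U/= sqdxx.
by have := main _ Ux0; rewrite phiE sqdxx mulr0 add0r subr_le0.
Qed.

End Uniqueness.

(** * Reduction of the hypotheses and of both notions of solution *)

Section Solutions.
Context {R : realType} {n : nat}.
Hypothesis n0 : (0 < n)%N.
Local Notation mu := (@lebesgue_rV R n).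
Variables (Om : set 'rV[R]_n) (oOm : open Om).
Variables (a : 'I_n -> 'I_n -> 'rV[R]_n -> R) (b : 'I_n -> 'rV[R]_n -> R) (c : 'rV[R]_n -> R)
  (alpha : R).

Let aeF : Filter (almost_everywhere mu) := ae_filter_ringOfSetsType mu.

(** One constant serves both families of coefficients: [Lam] bounds the entries of [a], and
    [b_i ^ 2 <= K <= (Lam + K + 1) ^ 2], where the added 1 handles small [K]. *)
Lemma elliptic_bounds (K lam Lam : R) : 0 < K -> 0 < lam -> lam <= Lam ->
  (forall i j x, Om x -> a i j x = a j i x) ->
  (forall x, Om x -> \sum_(i < n) b i x ^+ 2 <= K) ->
  (forall (x xi : 'rV[R]_n), Om x -> lam * enorm xi ^+ 2
     <= \sum_(i < n) \sum_(j < n) a i j x * xi 0 i * xi 0 j <= Lam * enorm xi ^+ 2) ->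
  coef_bounds Om a b lam (Lam + K + 1).
Proof.
move=> K0 lam0 lL a_sym b_bound a_ell.
have enormE (xi : 'I_n -> R) : enorm (\row_i xi i) ^+ 2 = \sum_(i < n) xi i ^+ 2.
  rewrite sqr_sqrtr; last by apply: sumr_ge0 => i _; exact: sqr_ge0.
  by apply: eq_bigr => i _; rewrite mxE.
have ell y (xi : 'I_n -> R) : Om y ->
    lam * \sum_(i < n) xi i ^+ 2 <= qform (fun i j => a i j y) xi <= Lam * \sum_(i < n) xi i ^+ 2.
  move=> Oy; have := a_ell y (\row_i xi i) Oy; rewrite enormE.
  suff -> : \sum_(i < n) \sum_(j < n) a i j y * (\row_i xi i) 0 i * (\row_i xi i) 0 j =
    qform (fun i j => a i j y) xi by [].
  by apply: eq_bigr => i _; apply: eq_bigr => j _; rewrite !mxE.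
have sy y : Om y -> symf (fun i j => a i j y) by move=> Oy i j; exact: a_sym.
have unit1 k : \sum_(i < n) ((i == k)%:R : R) ^+ 2 = 1.
  rewrite (bigD1 k)//= eqxx expr1n big1 ?addr0// => i /negbTE ->.
  by rewrite expr0n.
have diag y k : Om y -> lam <= a k k y <= Lam.
  by move=> Oy; have := ell y (fun i => (i == k)%:R) Oy; rewrite unit1 qform_unit !mulr1.
have L0 : 0 < Lam by exact: lt_le_trans lL.
split => //; first by lra.
- by move=> y Oy xi; have /andP[] := ell y xi Oy.
- move=> y Oy i j; apply: (@le_trans _ _ Lam); last by lra.
  have [<-|ij] := eqVneq i j.
    by have /andP[? ?] := diag y i Oy; rewrite ler_norml; apply/andP; split; lra.
  (* Polarisation: with [t = 1] and [t = -1], and positive diagonal entries, the upper ellipticity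
     bound gives [|a i j| <= Lam]. *)
  have pol (t : R) : 0 <= a i i y + 2 * t * a i j y + t ^+ 2 * a j j y <= Lam * (1 + t ^+ 2).
    have := ell y (fun k => (k == i)%:R + t * (k == j)%:R) Oy.
    rewrite (qform_shift _ _ _ (sy y Oy)) qform_unit.
    have -> : \sum_(k < n) ((k == i)%:R + t * (k == j)%:R) ^+ 2 = 1 + t ^+ 2.
      rewrite (eq_bigr (fun k => ((k == i)%:R : R) ^+ 2 + t ^+ 2 * ((k == j)%:R : R) ^+ 2)).
        by rewrite big_split/= -mulr_sumr !unit1 mulr1.
      move=> k _; have [->|] := eqVneq k i; last by rewrite !add0r expr0n/= add0r exprMn.
      by rewrite (negbTE ij) mulr0 addr0 expr0n/= mulr0 addr0.
    rewrite (sum_pickr (fun k => a k j y) i) => /andP[lo up]; rewrite up andbT.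
    by apply: le_trans lo; rewrite mulr_ge0 ?(ltW lam0)// addr_ge0// sqr_ge0.
  have /andP[_] := pol 1; have /andP[_] := pol (-1).
  have /andP[di _] := diag y i Oy; have /andP[dj _] := diag y j Oy.
  by rewrite sqrrN expr1n ler_norml => ? ?; apply/andP; split; lra.
- move=> y Oy i; rewrite -(@ler_pXn2r _ 2) ?nnegrE//; last by lra.
  rewrite real_normK ?num_real//.
  have : b i y ^+ 2 <= K.
    apply: le_trans (b_bound y Oy); rewrite (bigD1 i)//= lerDl sumr_ge0// => j _; exact: sqr_ge0.
  by move: K0 L0; nra.
Qed.

Lemma C2_sol u : C2_solution a b c alpha Om u ->
  blowup_sol Om a b c alpha u (fun i => pderiv [:: i] u) (fun i j => pderiv [:: j; i] u).
Proof.
move=> [Cu Lu bu]; have C := Ck2_C2on oOm Cu; split => //; first exact: D2on_C2on.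
apply: (@filterS _ _ aeF _ _ _ Lu) => y Ly Oy; rewrite -(Ly Oy) /elliptic_op subrK /diff_op.
apply: (congr1 (fun t => t + _)); apply: eq_bigr => i _; apply: eq_bigr => j _.
(* The second derivatives appear in the two orders of [i] and [j]; the symmetry supplied by
   Schwarz's theorem reconciles them. *)
exact: (congr1 (fun t => a i j y * t) (@C2_sym R n Om u _ _ C i j y Oy)).
Qed.

Lemma W2n_sol u : W2n_solution a b c alpha Om u ->
  blowup_sol Om a b c alpha u (fun i => weak_pderiv Om [:: i] u) (fun i j => weak_pderiv Om [:: i; j] u).
Proof.
move=> [[Wu cu] Lu bu]; split => //; last first.
  by apply: (@filterS _ _ aeF _ _ _ Lu) => y Ly Oy; rewrite -(Ly Oy) /elliptic_op subrK.
apply: D2on_weak2.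
have int s x r r' : (size s <= 2)%N -> 0 < r -> r < r' -> cube x r' `<=` Om ->
    (\int[mu]_(y in cube x r) (`|weak_pderiv Om s u y| ^+ n)%:E < +oo)%E.
  move=> s2 r0 rr sub; have [[_ [mw _] _] fin] := Wu s s2.
  (* The interior of the larger cube is an admissible set in [W2loc] and still contains the smaller
     cube. *)
  pose V := interior (cube x r').
  have VC : V `<=` cube x r' by exact: interior_subset.
  have VO : V `<=` Om := subset_trans VC sub.
  have cV : closure V `<=` Om.
    apply: subset_trans sub; rewrite [X in _ `<=` X](closure_id _).1; last exact: compact_cube_closed.
    exact: closureS.
  have bV : bounded_set V.
    have [N [Nr bN]] := compact_bounded (@cube_compact R n x r').
    by exists N; split => // N' NN' y /VC; exact: bN.
  apply: le_lt_trans (fin V (@open_interior _ _) bV cV).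
  have mV : measurable (V : set (Rn R n)) by apply: open_measurable_rV => //; exact: open_interior.
  have mC : measurable (cube x r : set (Rn R n)) by exact: measurable_cube.
  refine (@ge0_subset_integral _ _ _ mu _ _ mC mV _ _ _ _).
  - apply/measurable_EFinP; apply: measurable_funX.
    apply: measurableT_comp; first exact: normr_measurable.
    exact: (measurable_funS (open_measurable_rV n0 oOm) VO mw).
  - by move=> y _; rewrite lee_fin exprn_ge0.
  move=> y xy; apply: filterS (nbhs_cube y (r := r' - r) _); last by rewrite subr_gt0.
  move=> w yw i; have := xy i; have := yw i; rewrite !ler_norml; lra.
split.
- by move=> x Ox; apply: cu; rewrite inE.
- by move=> i; have [] := Wu [:: i] isT.
- by move=> i j; have [] := Wu [:: i; j] isT.
- by move=> i x r r'; exact: int.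
- by move=> i j x r r'; exact: int.
Qed.

End Solutions.

Theorem theorem3p2 (R : realType) (n : nat) (alpha : R) (Om : set 'rV[R]_n)
  (a : 'I_n -> 'I_n -> 'rV[R]_n -> R) (b : 'I_n -> 'rV[R]_n -> R)
  (c : 'rV[R]_n -> R) (K lam Lam : R)
  (n_ge2 : (2 <= n)%N) (alpha_gt0 : 0 < alpha)
  (Om_domain : domain Om) (Om_bounded : bounded_set Om)
  (Om_convex : convex_set Om)
  (a_meas : forall i j, measurable_fun [set: Rn R n] (a i j))
  (b_meas : forall i, measurable_fun [set: Rn R n] (b i))
  (c_meas : measurable_fun [set: Rn R n] c)
  (K_gt0 : 0 < K) (lam_gt0 : 0 < lam) (lam_le_Lam : lam <= Lam)
  (a_sym : forall i j x, Om x -> a i j x = a j i x)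
  (b_bound : forall x, Om x -> \sum_(i < n) b i x ^+ 2 <= K)
  (c_bound : forall x, Om x -> 0 <= c x <= K)
  (a_elliptic : forall (x xi : 'rV[R]_n), Om x ->
     lam * enorm xi ^+ 2
     <= \sum_(i < n) \sum_(j < n) a i j x * xi 0 i * xi 0 j
     <= Lam * enorm xi ^+ 2) :
  (forall u v, C2_solution a b c alpha Om u -> C2_solution a b c alpha Om v ->
     forall x, Om x -> u x = v x) /\
  (forall u v, W2n_solution a b c alpha Om u -> W2n_solution a b c alpha Om v ->
     forall x, Om x -> u x = v x).
Proof.
have n0 : (0 < n)%N by exact: ltnW n_ge2.
have [oOm _ _] := Om_domain.
have coef := elliptic_bounds K_gt0 lam_gt0 lam_le_Lam a_sym b_bound a_elliptic.
have le := sol_le n0 oOm coef K_gt0 alpha_gt0 c_bound Om_bounded Om_convex.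
split=> u v Su Sv x Ox; apply/eqP; rewrite eq_le.
  have Tu := C2_sol n0 oOm Su; have Tv := C2_sol n0 oOm Sv.
  by rewrite (le _ _ _ _ _ _ Tu Tv x Ox) (le _ _ _ _ _ _ Tv Tu x Ox).
have Tu := W2n_sol n0 oOm Su; have Tv := W2n_sol n0 oOm Sv.
by rewrite (le _ _ _ _ _ _ Tu Tv x Ox) (le _ _ _ _ _ _ Tv Tu x Ox).
Qed.
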